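(* Let $X,V$ be Banach spaces and let $C$ generate a cosine operator function with associated phase space $V\times X$. If $A\in\mathcal{L}(V,X)$, then the operator matrix $$\mathcal{A}:=\begin{pmatrix}0&I_{D(C)}\\ A&C\end{pmatrix},\qquad D(\mathcal{A}):=V\times D(C),$$ generates an analytic semigroup of angle $\frac{\pi}{2}$ on $V\times X$. In particular, the complete second order abstract Cauchy problem $$\ddot u(t)=Au(t)+C\dot u(t),\quad t\ge0,\qquad u(0)=f,\quad \dot u(0)=g,$$ is well-posed, and in fact it admits a unique classical solution $u$ for all initial data $f\in V$, $g\in X$.
   Context: For a closed operator $T$ on a Banach space, $[D(T)]$ denotes the domain of $T$ with the graph norm. $\mathcal{L}(E,F)$ denotes the bounded linear operators from $E$ to $F$. The symbol $\hookrightarrow$ denotes a continuous embedding. In the matrix $\mathcal{A}$, $I_{D(C)}$ is the identity on $D(C)$, regarded as the embedding of $D(C)$ into $V$. A cosine operator function (COF) on a Banach space $E$ is a strongly continuous family $(C(t))_{t\in\mathbb{R}}$ of bounded linear operators on $E$ with $C(0)=I$ and $C(t+s)+C(t-s)=2C(t)C(s)$ for all $s,t\in\mathbb{R}$. Its generator is $Tx=\frac{d^2}{dt^2}C(t)x|_{t=0}$ on the set of $x$ for which $t\mapsto C(t)x$ is $C^2$. A closed operator $T$ on $E$ generates a COF on $E$ if and only if there is a Banach space $F$ with $[D(T)]\hookrightarrow F\hookrightarrow E$ such that $\begin{pmatrix}0&I_F\\ T&0\end{pmatrix}$ with domain $D(T)\times F$ generates a $C_0$-semigroup on $F\times E$.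 Such an $F$ is unique; it is called the Kisyński space, and $F\times E$ is called the associated phase space. ''$T$ generates a COF with associated phase space $F\times E$'' means that $T$ generates a COF on $E$ and its Kisyński space is $F$. Well-posedness of the second order problem means that the reduction matrix $\mathcal{A}$ generates a $C_0$-semigroup on $V\times X$. For $f\in V$, $g\in X$, a classical solution is a function $u$ such that $t\mapsto (u(t),\dot u(t))$ belongs to $C([0,\infty),V\times X)\cap C^1((0,\infty),V\times X)$, $\dot u(t)\in D(C)$ for $t>0$, the differential equation holds for $t>0$, and $u(0)=f$, $\dot u(0)=g$. *)

(* Defs.v *)
From Stdlib Require Import Reals.
From Coquelicot Require Import Coquelicot.

Open Scope R_scope.

(** Complex Banach spaces are [CompleteNormedModule C_AbsRing]; Coquelicot's
    [is_linear] is "linear and bounded", so [is_linear l] with [l : E -> F]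
    means that [l] is in L(E,F). The product [E * F] carries Coquelicot's
    norm [sqrt (norm x ^ 2 + norm y ^ 2)]. *)

(** An unbounded operator is given by its graph: [G x y] means that [x] is in
    the domain of [G] and that [G] maps [x] to [y]. *)
Definition operator (E F : Type) := E -> F -> Prop.

Definition op_domain {E F : Type} (G : operator E F) (x : E) : Prop :=
  exists y, G x y.

Definition op_eq {E F : Type} (G H : operator E F) : Prop :=
  forall x y, G x y <-> H x y.

Record closed_operator {E F : NormedModule C_AbsRing} (G : operator E F) :
  Prop := {
  co_fun : forall x y z, G x y -> G x z -> y = z;
  co_zero : G zero zero;
  co_plus : forall x x' y y', G x y -> G x' y' -> G (plus x x') (plus y y');
  co_scal : forall (k : C) x y, G x y -> G (scal k x) (scal k y);
  co_closed : closed (fun p : E * F => G (fst p) (snd p)) }.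

(** [l] is the derivative at [t] of the restriction of [u] to [P]; at an
    endpoint of an interval [P] this is the one-sided derivative. *)
Definition deriv_on {E : NormedModule C_AbsRing}
  (P : R -> Prop) (u : R -> E) (t : R) (l : E) : Prop :=
  filterlim (fun s => scal (RtoC (/ (s - t))) (minus (u s) (u t)))
    (within P (locally' t)) (locally l).

Record cosine_function {E : NormedModule C_AbsRing} (S : R -> E -> E) :
  Prop := {
  cf_linear : forall t, is_linear (S t);
  cf_zero : forall x, S 0 x = x;
  cf_dalembert : forall s t x,
    plus (S (t + s) x) (S (t - s) x) = scal (RtoC 2) (S t (S s x));
  cf_continuous : forall x t, continuous (fun s => S s x) t }.

Definition cosine_generator {E : NormedModule C_AbsRing} (S : R -> E -> E) :
  operator E E := fun x y =>
  exists S' S'' : R -> E,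
    (forall t, deriv_on (fun _ => True) (fun s => S s x) t (S' t)) /\
    (forall t, deriv_on (fun _ => True) S' t (S'' t)) /\
    (forall t, continuous S'' t) /\
    S'' 0 = y.

Definition generates_COF {E : NormedModule C_AbsRing} (G : operator E E) :
  Prop :=
  exists S : R -> E -> E, cosine_function S /\ op_eq G (cosine_generator S).

(** Only the values [T t] with [0 <= t] are meaningful. *)
Record C0_semigroup {E : NormedModule C_AbsRing} (T : R -> E -> E) : Prop := {
  c0_linear : forall t, 0 <= t -> is_linear (T t);
  c0_zero : forall x, T 0 x = x;
  c0_plus : forall s t x, 0 <= s -> 0 <= t -> T (s + t) x = T s (T t x);
  c0_continuous : forall x, continuous_on (Rle 0) (fun t => T t x) }.

Definition semigroup_generator {E : NormedModule C_AbsRing}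
  (T : R -> E -> E) : operator E E := fun x y =>
  filterlim (fun h => scal (RtoC (/ h)) (minus (T h x) x))
    (at_right 0) (locally y).

Definition generates_C0_semigroup {E : NormedModule C_AbsRing}
  (G : operator E E) : Prop :=
  exists T : R -> E -> E, C0_semigroup T /\ op_eq G (semigroup_generator T).

(** The open sector [{z <> 0 : |arg z| < delta}]. *)
Definition sector (delta : R) (z : C) : Prop :=
  exists r phi : R,
    0 < r /\ Rabs phi < delta /\ z = (r * cos phi, r * sin phi).

(** Complex derivative with respect to the operator norm of L(E,E). *)
Definition op_C_deriv {E : NormedModule C_AbsRing}
  (T : C -> E -> E) (z : C) (L : E -> E) : Prop :=
  forall eps : posreal, locally' z (fun w => forall x,
    norm (minus (scal (Cinv (Cminus w z)) (minus (T w x) (T z x))) (L x))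
      <= eps * norm x).

(** Only the values of [T] at [0] and on the sector are meaningful. *)
Record analytic_semigroup {E : NormedModule C_AbsRing} (delta : R)
  (T : C -> E -> E) : Prop := {
  as_angle : 0 < delta <= PI / 2;
  as_linear : forall z, sector delta z -> is_linear (T z);
  as_zero : forall x, T (RtoC 0) x = x;
  as_plus : forall z w x, sector delta z -> sector delta w ->
    T (Cplus z w) x = T z (T w x);
  as_analytic : forall z, sector delta z ->
    exists L : E -> E, is_linear L /\ op_C_deriv T z L;
  as_continuous : forall delta' x, 0 < delta' < delta ->
    filterlim (fun z => T z x)
      (within (sector delta') (locally (RtoC 0))) (locally x) }.

Definition generates_analytic_semigroup {E : NormedModule C_AbsRing}
  (delta : R) (G : operator E E) : Prop :=
  exists T : C -> E -> E, analytic_semigroup delta T /\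
    op_eq G (semigroup_generator (fun t => T (RtoC t))).

(** A continuous embedding of [F] into [E] is an explicit bounded linear
    injection [j]; [x] in [E] is regarded as an element of [F] when it is in
    the range of [j]. *)
Definition embedding {F E : NormedModule C_AbsRing} (j : F -> E) : Prop :=
  is_linear j /\ (forall v w, j v = j w -> v = w).

(** [D(G)] embeds continuously in [F], for the graph norm on [D(G)]. *)
Definition domain_embeds {F E : NormedModule C_AbsRing} (j : F -> E)
  (G : operator E E) : Prop :=
  (forall x, op_domain G x -> exists v, j v = x) /\
  (exists M : R, forall v y, G (j v) y -> norm v <= M * (norm (j v) + norm y)).

(** The matrix [(0 I_F; G 0)] with domain [D(G) * F] in [F * E]. *)
Definition phase_matrix {F E : NormedModule C_AbsRing} (j : F -> E)
  (G : operator E E) : operator (F * E) (F * E) := fun p q =>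
  j (fst q) = snd p /\ G (j (fst p)) (snd q).

Definition kisynski_space {F E : CompleteNormedModule C_AbsRing} (j : F -> E)
  (G : operator E E) : Prop :=
  embedding j /\ domain_embeds j G /\
  generates_C0_semigroup (phase_matrix j G).

Definition generates_COF_phase_space {F E : CompleteNormedModule C_AbsRing}
  (j : F -> E) (G : operator E E) : Prop :=
  closed_operator G /\ generates_COF G /\ kisynski_space j G.

(** The matrix [(0 I_D(G); A G)] with domain [V * D(G)] in [V * X]. *)
Definition reduction_matrix {V X : NormedModule C_AbsRing} (j : V -> X)
  (A : V -> X) (G : operator X X) : operator (V * X) (V * X) := fun p q =>
  j (fst q) = snd p /\
  exists y, G (snd p) y /\ snd q = plus (A (fst p)) y.

Definition well_posed {V X : NormedModule C_AbsRing} (j : V -> X)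
  (A : V -> X) (G : operator X X) : Prop :=
  generates_C0_semigroup (reduction_matrix j A G).

(** Only the values [u t] with [0 <= t] are meaningful. [w] is the velocity
    [u'], an [X]-valued function on [[0,oo)], and [D] is the derivative of
    [t |-> (u t, u' t)], so that [snd (D t)] is [u'' t]. *)
Definition classical_solution {V X : NormedModule C_AbsRing} (j : V -> X)
  (A : V -> X) (G : operator X X) (f : V) (g : X) (u : R -> V) : Prop :=
  exists (w : R -> X) (D : R -> V * X),
    (forall t, 0 <= t -> deriv_on (Rle 0) (fun s => j (u s)) t (w t)) /\
    continuous_on (Rle 0) (fun t => (u t, w t)) /\
    (forall t, 0 < t -> deriv_on (Rlt 0) (fun s => (u s, w s)) t (D t)) /\
    continuous_on (Rlt 0) D /\
    (forall t, 0 < t ->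
       exists y, G (w t) y /\ snd (D t) = plus (A (u t)) y) /\
    u 0 = f /\ w 0 = g.

(* Main.v *)
(** The reduction matrix [K = (0 I; A C)] is itself the generator of a cosine
    family: [u'' = K u] on [V * X] reads [u1'' = u2], [u2'' = C u2 + A u1], and as
    a first order system for [((u1, u1'), (u2, u2'))] on [(V * V) * (V * X)] it is
    a bounded perturbation of [0 (+) (0 I; C 0)], whose second summand generates a
    semigroup on the phase space.  Its velocity components [Z(s)] satisfy
    [Z'' x = Z K x] and [Z'(0) x = 0], so the Gaussian means
    [T(z) = (pi z)^(-1/2) int_0^oo exp(- s^2 / (4 z)) Z(s) ds], [Re z > 0],
    solve [T' = K T] by the heat equation for the kernel.  Two integrations by
    parts move [K] onto the kernel, so [K T(z)] is bounded and [T] is holomorphic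
    in operator norm.  The semigroup law and the uniqueness of classical solutions
    follow because [T(z + s u) T((1 - s) u) x], respectively [T(t - s) U(s)], has
    derivative zero in [s]. *)

Require Import Defs.
From Stdlib Require Import Reals Lra Lia List Classical ClassicalEpsilon FunctionalExtensionality.
From Coquelicot Require Import Coquelicot.

Open Scope R_scope.

(** The coupling is bounded because of where the components live: in a state [((u1, v1), (u2, v2))]
    of [(V * V) * (V * X)] the position [u2] is an element of [V], the space in which [u1'' = u2]
    has to hold, and [A u1] lands in [X], the space of [v2]. The price is that positions fill
    [V * V] whereas [K] acts on [V * X], so an arbitrary vector of [V * X] can be prescribed only as
    an initial velocity. Hence [Z(s) x] is the velocity at time [s] of the solution that starts at
    position zero with velocity [x]: the derivative of a sine family, which is a cosine family. The
    perturbation is made on the second order equation, and the full angle comes from the Gaussian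
    means alone. Identities involving [K] are first proved on its domain; since the domain is dense,
    [K] closed and the integrated-by-parts formula bounded, they extend to all vectors. Holomorphy
    is tracked by remainders quadratic in the increment and uniform in the vector, a notion stable
    under products and compositions. *)

Notation CSpace := (NormedModule C_AbsRing) (only parsing).

(** * Linear combinations *)

(** Syntax of a reflective procedure for vector identities: two expressions over a common list of
    atoms agree once the coefficients of each atom agree, which turns a goal in a normed module into
    equations in [C] that [ring] can settle. *)
Inductive lexpr : Type :=
  | LVar (n : nat)
  | LZero
  | LPlus (a b : lexpr)
  | LOpp (a : lexpr)
  | LMinus (a b : lexpr)
  | LScal (c : C) (a : lexpr).

Fixpoint leval {E : CSpace} (env : list E) (e : lexpr) : E :=
  match e with
  | LVar n => nth n env zero
  | LZero => zero
  | LPlus a b => plus (leval env a) (leval env b)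
  | LOpp a => opp (leval env a)
  | LMinus a b => minus (leval env a) (leval env b)
  | LScal c a => scal c (leval env a)
  end.

Fixpoint lcoef (e : lexpr) (k : nat) : C :=
  match e with
  | LVar n => if Nat.eqb n k then RtoC 1 else RtoC 0
  | LZero => RtoC 0
  | LPlus a b => Cplus (lcoef a k) (lcoef b k)
  | LOpp a => Copp (lcoef a k)
  | LMinus a b => Cminus (lcoef a k) (lcoef b k)
  | LScal c a => Cmult c (lcoef a k)
  end.

Fixpoint lincomb {E : CSpace} (env : list E) (f : nat -> C) : E :=
  match env with
  | nil => zero
  | x :: l => plus (scal (f 0%nat) x) (lincomb l (fun k => f (S k)))
  end.

Lemma scal_C0 {E : CSpace} (x : E) : scal (RtoC 0) x = zero.
Proof. exact (scal_zero_l x). Qed.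

Lemma scal_C1 {E : CSpace} (x : E) : scal (RtoC 1) x = x.
Proof. exact (scal_one x). Qed.

Lemma scal_Cplus {E : CSpace} (c d : C) (x : E) :
  scal (Cplus c d) x = plus (scal c x) (scal d x).
Proof. exact (scal_distr_r c d x). Qed.

Lemma scal_Cmult {E : CSpace} (c d : C) (x : E) :
  scal (Cmult c d) x = scal c (scal d x).
Proof. exact (eq_sym (scal_assoc c d x)). Qed.

Lemma scal_Copp {E : CSpace} (c : C) (x : E) :
  scal (Copp c) x = opp (scal c x).
Proof. exact (scal_opp_l c x). Qed.

Lemma lincomb_zero {E : CSpace} (env : list E) :
  lincomb env (fun _ => RtoC 0) = zero.
Proof.
induction env as [|x l IH]; simpl; trivial.
now rewrite IH, scal_C0, plus_zero_r.
Qed.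

Lemma lincomb_plus {E : CSpace} (env : list E) f g :
  lincomb env (fun k => Cplus (f k) (g k)) = plus (lincomb env f) (lincomb env g).
Proof.
revert f g; induction env as [|x l IH]; intros f g; simpl.
- now rewrite plus_zero_r.
- rewrite (IH (fun k => f (S k)) (fun k => g (S k))), scal_Cplus, <- !plus_assoc.
  f_equal. rewrite !plus_assoc. f_equal. apply plus_comm.
Qed.

Lemma lincomb_scal {E : CSpace} (env : list E) c f :
  lincomb env (fun k => Cmult c (f k)) = scal c (lincomb env f).
Proof.
revert f; induction env as [|x l IH]; intros f; simpl.
- symmetry; exact (scal_zero_r c).
- rewrite (IH (fun k => f (S k))), scal_Cmult. symmetry; exact (scal_distr_l c _ _).
Qed.

Lemma lincomb_ext {E : CSpace} (env : list E) f g :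
  (forall k, (k < length env)%nat -> f k = g k) -> lincomb env f = lincomb env g.
Proof.
revert f g; induction env as [|x l IH]; intros f g H; simpl; trivial.
rewrite (H 0%nat) by (simpl; lia). f_equal. apply IH. intros k Hk. apply H. simpl; lia.
Qed.

Lemma lincomb_opp {E : CSpace} (env : list E) f :
  lincomb env (fun k => Copp (f k)) = opp (lincomb env f).
Proof.
rewrite (lincomb_ext _ _ (fun k => Cmult (Copp (RtoC 1)) (f k))).
- now rewrite lincomb_scal, scal_Copp, scal_C1.
- intros k _. ring.
Qed.

Lemma lincomb_var {E : CSpace} (env : list E) n :
  lincomb env (fun k => if Nat.eqb n k then RtoC 1 else RtoC 0) = nth n env zero.
Proof.
revert n; induction env as [|x l IH]; intros [|n]; simpl; trivial.
- now rewrite lincomb_zero, scal_C1, plus_zero_r.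
- now rewrite IH, scal_C0, plus_zero_l.
Qed.

Lemma leval_lincomb {E : CSpace} (env : list E) e :
  leval env e = lincomb env (lcoef e).
Proof.
induction e as [n| |a IHa b IHb|a IHa|a IHa b IHb|c a IHa]; simpl.
- symmetry; apply lincomb_var.
- symmetry; apply lincomb_zero.
- rewrite IHa, IHb; symmetry; apply lincomb_plus.
- rewrite IHa; symmetry; apply lincomb_opp.
- rewrite IHa, IHb. unfold minus. rewrite <- lincomb_opp. symmetry; apply lincomb_plus.
- rewrite IHa; symmetry; apply lincomb_scal.
Qed.

(** A bounded quantifier written by recursion, so that [cbv] on a concrete length leaves a plain
    conjunction of scalar equations. *)
Fixpoint coef_agree (e1 e2 : lexpr) (n : nat) : Prop :=
  match n with
  | O => True
  | S n => lcoef e1 n = lcoef e2 n /\ coef_agree e1 e2 n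
  end.

Lemma leval_eq {E : CSpace} (env : list E) e1 e2 :
  coef_agree e1 e2 (length env) -> leval env e1 = leval env e2.
Proof.
intros H. rewrite !leval_lincomb. apply lincomb_ext. revert H. generalize (length env).
induction n as [|n IH]; simpl; intros H k Hk; [lia|].
destruct (Nat.eq_dec k n) as [->|Hn]; [apply H|apply IH; [apply H|lia]].
Qed.

Ltac lin_in x l :=
  match l with
  | nil => constr:(false)
  | x :: _ => constr:(true)
  | _ :: ?l' => lin_in x l'
  end.

Ltac lin_index x l :=
  match l with
  | x :: _ => constr:(O)
  | _ :: ?l' => let n := lin_index x l' in constr:(S n)
  end.

Ltac lin_atoms env t :=
  lazymatch t with
  | zero => env
  | plus ?a ?b => let e := lin_atoms env a in lin_atoms e b
  | minus ?a ?b => let e := lin_atoms env a in lin_atoms e b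
  | opp ?a => lin_atoms env a
  | scal ?c ?a => lin_atoms env a
  | _ => lazymatch lin_in t env with
         | true => env
         | false => constr:(t :: env)
         end
  end.

Ltac lin_reify env t :=
  lazymatch t with
  | zero => constr:(LZero)
  | plus ?a ?b => let x := lin_reify env a in let y := lin_reify env b in constr:(LPlus x y)
  | minus ?a ?b => let x := lin_reify env a in let y := lin_reify env b in constr:(LMinus x y)
  | opp ?a => let x := lin_reify env a in constr:(LOpp x)
  | scal ?c ?a => let x := lin_reify env a in constr:(LScal c x)
  | _ => let n := lin_index t env in constr:(LVar n)
  end.

Ltac lin_reduce E :=
  lazymatch goal with
  | |- ?t1 = ?t2 =>
      let env0 := lin_atoms (@nil E) t1 in
      let env := lin_atoms env0 t2 in
      let e1 := lin_reify env t1 in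
      let e2 := lin_reify env t2 in
      refine (@leval_eq _ env e1 e2 _);
      cbv [coef_agree length lcoef Nat.eqb]; repeat split
  end.

(** Coefficient equations that [ring] does not prove, typically those with [RtoC] of an inverse or
    of a difference, stay as goals for the caller. *)
Ltac lin E := lin_reduce E; try ring.

(** Displays the decomposition that the triangle inequality then splits; unsolved coefficient
    equations appear as further goals. *)
Ltac norm_as E v :=
  match goal with
  | |- norm ?x <= _ => replace x with v; [|lin E]
  | |- norm ?x < _ => replace x with v; [|lin E]
  end.

Tactic Notation "via_le" uconstr(t) := eapply Rle_trans; [apply t|].
Tactic Notation "via_lt" uconstr(t) := eapply Rle_lt_trans; [apply t|].

Ltac pose_rmin a b :=
  lazymatch goal with
  | _ : Rmin a b <= a |- _ => fail
  | _ => let Hl := fresh "Hminl" in let Hr := fresh "Hminr" in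
         pose proof (Rmin_l a b) as Hl; pose proof (Rmin_r a b) as Hr
  end.

(** Radii of neighbourhoods are combined by [Rmin], and [lra] needs the two inequalities of each
    minimum; the [fail] in [pose_rmin] ends the repetition. *)
Ltac rmins :=
  repeat match goal with
  | H : context [Rmin ?a ?b] |- _ => pose_rmin a b
  | d := context [Rmin ?a ?b] |- _ => pose_rmin a b
  end.

(** * Norm inequalities and limits in epsilon form *)

Section NormedBasics.

Context {E F : CSpace}.

Lemma norm_scal_RtoC (r : R) (x : E) : norm (scal (RtoC r) x) <= Rabs r * norm x.
Proof.
rewrite <- Cmod_R. exact (norm_scal (K := C_AbsRing) (RtoC r) x).
Qed.

Lemma norm_scal_C (k : C) (x : E) : norm (scal k x) <= Cmod k * norm x.
Proof. exact (norm_scal (K := C_AbsRing) k x). Qed.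

Lemma norm_minus_sym (x y : E) : norm (minus x y) = norm (minus y x).
Proof. rewrite <- norm_opp. f_equal. lin E. Qed.

Lemma norm_minus_triangle (x y z : E) :
  norm (minus x z) <= norm (minus x y) + norm (minus y z).
Proof.
replace (minus x z) with (plus (minus x y) (minus y z)) by lin E. apply norm_triangle.
Qed.

Lemma norm_minus_le (x y : E) : norm (minus x y) <= norm x + norm y.
Proof.
unfold minus. via_le norm_triangle. rewrite norm_opp. lra.
Qed.

Lemma norm_le_minus (x y : E) : norm x <= norm y + norm (minus x y).
Proof.
replace x with (plus y (minus x y)) at 1 by lin E. apply norm_triangle.
Qed.

Lemma eq_of_norm_minus (x y : E) :
  (forall eps, 0 < eps -> norm (minus x y) <= eps) -> x = y.
Proof.
intros H.
assert (H0 : norm (minus x y) = 0).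
{ apply Rle_antisym; [|apply norm_ge_0]. apply le_epsilon. intros e He. rewrite Rplus_0_l. auto. }
apply norm_eq_zero in H0.
replace x with (plus (minus x y) y) by lin E. rewrite H0. apply plus_zero_l.
Qed.

Lemma minus_zero_eq (x y : E) : minus x y = zero -> x = y.
Proof.
intros H. replace x with (plus (minus x y) y) by lin E. rewrite H. apply plus_zero_l.
Qed.

Lemma filterlim_eps {T : Type} (G : (T -> Prop) -> Prop) {FG : Filter G} (f : T -> E) (l : E) :
  filterlim f G (locally l) <->
  (forall eps, 0 < eps -> G (fun s => norm (minus (f s) l) < eps)).
Proof.
rewrite filterlim_locally_ball_norm. split.
- intros H e He. exact (H (mkposreal e He)).
- intros H e. exact (H e (cond_pos e)).
Qed.

End NormedBasics.

Lemma locally_R_eps (t : R) (P : R -> Prop) :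
  locally t P <-> exists d, 0 < d /\ forall s, Rabs (s - t) < d -> P s.
Proof.
split.
- intros [d H]. exists d. split; [apply cond_pos|exact H].
- intros [d [Hd H]]. exists (mkposreal d Hd). exact H.
Qed.

Lemma locally_C_eps (z : C) (P : C -> Prop) :
  locally z P <-> exists d, 0 < d /\ forall w, Cmod (Cminus w z) < d -> P w.
Proof.
split.
- intros H. destruct (locally_norm_le_locally (V := C_NormedModule) z P H) as [d H']. exists d. split; [apply cond_pos|exact H'].
- intros [d [Hd H]]. apply (locally_le_locally_norm (V := C_NormedModule) z P).
  exists (mkposreal d Hd). exact H.
Qed.

(** * Continuity and derivatives of curves *)

Section Derivatives.

Context {E : CSpace}.

Definition cont_on (P : R -> Prop) (u : R -> E) : Prop :=
  forall t, P t -> forall eps, 0 < eps ->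
  exists d, 0 < d /\ forall s, P s -> Rabs (s - t) < d -> norm (minus (u s) (u t)) < eps.

Lemma continuous_eps (u : R -> E) (t : R) :
  continuous u t <-> forall eps, 0 < eps ->
  exists d, 0 < d /\ forall s, Rabs (s - t) < d -> norm (minus (u s) (u t)) < eps.
Proof.
split.
- intros H e He. apply locally_R_eps. exact (proj1 (filterlim_eps (locally t) u (u t)) H e He).
- intros H. apply (filterlim_eps (locally t) u (u t)). intros e He. apply locally_R_eps, H, He.
Qed.

Lemma cont_on_iff (P : R -> Prop) (u : R -> E) : cont_on P u <-> continuous_on P u.
Proof.
split; intros H t Pt.
- apply (filterlim_eps (within P (locally t))). intros e He. apply locally_R_eps.
  destruct (H t Pt e He) as [d [Hd K]]. exists d. split; auto.
- intros e He.
  pose proof (proj1 (filterlim_eps (within P (locally t)) u (u t)) (H t Pt) e He) as H'.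
  destruct (proj1 (locally_R_eps _ _) H') as [d [Hd K]]. exists d. split; auto.
Qed.

Lemma continuous_cont_on (P : R -> Prop) (u : R -> E) :
  (forall t, P t -> continuous u t) -> cont_on P u.
Proof.
intros H t Pt e He. destruct (proj1 (continuous_eps u t) (H t Pt) e He) as [d [Hd K]].
exists d. split; auto.
Qed.

(** The difference quotient is multiplied out: no division occurs, the point [s = t] is harmless,
    and linear maps and the triangle inequality apply directly to the remainder. *)
Definition hasd (u : R -> E) (t : R) (l : E) : Prop :=
  forall eps, 0 < eps -> exists d, 0 < d /\
  forall s, Rabs (s - t) < d ->
  norm (minus (minus (u s) (u t)) (scal (RtoC (s - t)) l)) <= eps * Rabs (s - t).

Definition hasd_on (P : R -> Prop) (u : R -> E) (t : R) (l : E) : Prop :=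
  forall eps, 0 < eps -> exists d, 0 < d /\
  forall s, P s -> Rabs (s - t) < d ->
  norm (minus (minus (u s) (u t)) (scal (RtoC (s - t)) l)) <= eps * Rabs (s - t).

Lemma hasd_on_hasd (P : R -> Prop) (u : R -> E) (t : R) (l : E) :
  hasd u t l -> hasd_on P u t l.
Proof. intros H e He. destruct (H e He) as [d [Hd K]]. exists d. split; auto. Qed.

Lemma hasd_on_open (P : R -> Prop) (u : R -> E) (t : R) (l : E) :
  locally t P -> hasd_on P u t l -> hasd u t l.
Proof.
intros HP H e He. destruct (H e He) as [d [Hd K]].
apply locally_R_eps in HP. destruct HP as [d' [Hd' K']].
exists (Rmin d d'). split; [now apply Rmin_pos|].
intros s Hs. apply K; [apply K'|]; eapply Rlt_le_trans; try apply Hs;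
  [apply Rmin_r|apply Rmin_l].
Qed.

Lemma quotient_remainder (h : R) (x l : E) : h <> 0 ->
  minus x (scal (RtoC h) l) = scal (RtoC h) (minus (scal (RtoC (/ h)) x) l).
Proof.
intros H. rewrite RtoC_inv by trivial. lin E. field. intros K. now apply H, RtoC_inj.
Qed.

Lemma quotient_remainder_inv (h : R) (x l : E) : h <> 0 ->
  @minus (NormedModule.AbelianGroup C_AbsRing E) (scal (RtoC (/ h)) x) l =
  scal (RtoC (/ h)) (minus x (scal (RtoC h) l)).
Proof.
intros H. rewrite quotient_remainder by trivial. rewrite <- scal_Cmult, <- RtoC_mult.
rewrite Rinv_l by trivial. symmetry. apply scal_C1.
Qed.

Lemma deriv_on_hasd_on (P : R -> Prop) (u : R -> E) (t : R) (l : E) :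
  deriv_on P u t l <-> hasd_on P u t l.
Proof.
assert (FF : Filter (within P (locally' t))) by apply within_filter, within_filter, locally_filter.
unfold deriv_on. split; intros H; [|apply (filterlim_eps (within P (locally' t)))];
  intros e He.
- pose proof (proj1 (filterlim_eps (within P (locally' t)) _ l) H e He) as H'.
  destruct (proj1 (locally_R_eps _ _) H') as [d [Hd K]]. exists d. split; trivial.
  intros s Ps Hs. destruct (Req_dec s t) as [->|Hst].
  + rewrite Rminus_diag, Rabs_R0, Rmult_0_r.
    norm_as E (zero : E). rewrite norm_zero; lra.
  + rewrite quotient_remainder by lra.
    via_le norm_scal_RtoC. rewrite Rmult_comm.
    apply Rmult_le_compat_r; [apply Rabs_pos|]. left. apply K; trivial.
(* Halving turns the weak inequality of [hasd_on] into the strict one that the filter requires. *)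
- destruct (H (e / 2)) as [d [Hd K]]; [lra|].
  apply locally_R_eps. exists d. split; trivial. intros s Hs Hst Ps.
  rewrite quotient_remainder_inv by lra.
  via_lt norm_scal_RtoC.
  eapply Rle_lt_trans; [apply Rmult_le_compat_l; [apply Rabs_pos|apply K; trivial]|].
  assert (0 < Rabs (s - t)) by (apply Rabs_pos_lt; lra).
  rewrite Rabs_inv. field_simplify; lra.
Qed.

Lemma hasd_continuous (u : R -> E) (t : R) (l : E) : hasd u t l -> continuous u t.
Proof.
intros H. apply continuous_eps. intros e He.
destruct (H 1 Rlt_0_1) as [d [Hd K]].
set (M := 1 + norm l). assert (HM : 0 < M) by (pose proof (norm_ge_0 l); unfold M; lra).
exists (Rmin d (e / M)). split; [apply Rmin_pos; trivial; now apply Rdiv_lt_0_compat|].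
intros s Hs.
rmins. assert (H1 : Rabs (s - t) < d) by lra.
assert (H2 : Rabs (s - t) < e / M) by lra.
apply Rle_lt_trans with (M * Rabs (s - t)).
- via_le (norm_le_minus _ (scal (RtoC (s - t)) l)).
  pose proof (K s H1). pose proof (norm_scal_RtoC (s - t) l). unfold M. lra.
- apply Rlt_le_trans with (M * (e / M)); [now apply Rmult_lt_compat_l|]. right; field; lra.
Qed.

Lemma hasd_plus (u v : R -> E) (t : R) (l m : E) :
  hasd u t l -> hasd v t m -> hasd (fun s => plus (u s) (v s)) t (plus l m).
Proof.
intros Hu Hv e He. destruct (Hu (e / 2)) as [d [Hd K]]; [lra|].
destruct (Hv (e / 2)) as [d' [Hd' K']]; [lra|].
exists (Rmin d d'). split; [now apply Rmin_pos|]. intros s Hs.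
norm_as E (plus (minus (minus (u s) (u t)) (scal (RtoC (s - t)) l))
  (minus (minus (v s) (v t)) (scal (RtoC (s - t)) m))).
via_le norm_triangle.
rmins. assert (H1 : Rabs (s - t) < d) by lra.
assert (H2 : Rabs (s - t) < d') by lra.
specialize (K s H1). specialize (K' s H2). lra.
Qed.

Lemma hasd_ext_loc (u v : R -> E) (t : R) (l : E) :
  locally t (fun s => u s = v s) -> hasd u t l -> hasd v t l.
Proof.
intros HP H e He. destruct (H e He) as [d [Hd K]].
apply locally_R_eps in HP. destruct HP as [d' [Hd' K']].
exists (Rmin d d'). split; [now apply Rmin_pos|].
intros s Hs. rewrite <- (K' t), <- (K' s).
- apply K. eapply Rlt_le_trans; [apply Hs|apply Rmin_l].
- eapply Rlt_le_trans; [apply Hs|apply Rmin_r].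
- rewrite Rminus_diag, Rabs_R0; trivial.
Qed.

Lemma hasd_ext (u v : R -> E) (t : R) (l : E) :
  (forall s, u s = v s) -> hasd u t l -> hasd v t l.
Proof. intros H. apply hasd_ext_loc. apply filter_forall, H. Qed.

Lemma hasd_const (x : E) (t : R) : hasd (fun _ => x) t zero.
Proof.
intros e He. exists 1. split; [lra|]. intros s _.
norm_as E (zero : E). rewrite norm_zero.
apply Rmult_le_pos; [lra|apply Rabs_pos].
Qed.

Lemma hasd_shift (u : R -> E) (c t : R) (l : E) :
  hasd u (t + c) l -> hasd (fun s => u (s + c)) t l.
Proof.
intros H e He. destruct (H e He) as [d [Hd K]]. exists d. split; trivial.
intros s Hs. replace (s - t) with (s + c - (t + c)) in * by ring. now apply K.
Qed.

Lemma hasd_uniq (u : R -> E) (t : R) (l m : E) : hasd u t l -> hasd u t m -> l = m.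
Proof.
intros Hl Hm. apply eq_of_norm_minus. intros e He.
destruct (Hl (e / 2)) as [d [Hd K]]; [lra|]. destruct (Hm (e / 2)) as [d' [Hd' K']]; [lra|].
set (h := Rmin d d' / 2).
assert (0 < Rmin d d') by (now apply Rmin_pos).
assert (Hh : 0 < h) by (unfold h; lra).
rmins.
specialize (K (t + h)). specialize (K' (t + h)).
replace (t + h - t) with h in * by ring. rewrite Rabs_pos_eq in * by lra.
specialize (K ltac:(unfold h in *; lra)). specialize (K' ltac:(unfold h in *; lra)).
replace (minus l m) with (scal (RtoC (/ h)) (minus
  (minus (minus (u (t + h)) (u t)) (scal (RtoC h) m))
  (minus (minus (u (t + h)) (u t)) (scal (RtoC h) l)))).
- via_le norm_scal_RtoC. rewrite Rabs_pos_eq by (left; now apply Rinv_0_lt_compat).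
  apply Rle_trans with (/ h * (e * h)); [|right; field; lra].
  apply Rmult_le_compat_l; [left; now apply Rinv_0_lt_compat|].
  via_le norm_minus_le. lra.
- rewrite RtoC_inv by lra. lin E; field; intros Hc; apply RtoC_inj in Hc; lra.
Qed.

End Derivatives.

Section BoundedLinear.

Context {E F : CSpace} (f : E -> F) (Hf : is_linear f).

Lemma map_plus (x y : E) : f (plus x y) = plus (f x) (f y).
Proof. exact (linear_plus f Hf x y). Qed.

Lemma map_scal (c : C) (x : E) : f (scal c x) = scal c (f x).
Proof. exact (linear_scal f Hf c x). Qed.

Lemma map_minus (x y : E) : f (minus x y) = minus (f x) (f y).
Proof. exact (linear_minus f x y Hf). Qed.

Lemma map_zero : f zero = zero.
Proof. exact (linear_zero f Hf). Qed.

Lemma map_bound : exists M, 0 < M /\ forall x, norm (f x) <= M * norm x.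
Proof. exact (linear_norm f Hf). Qed.

End BoundedLinear.

Lemma hasd_linear {E F : CSpace} (f : E -> F) (u : R -> E) (t : R) (l : E) :
  is_linear f -> hasd u t l -> hasd (fun s => f (u s)) t (f l).
Proof.
intros Hf H e He. destruct (map_bound _ Hf) as [M [HM KM]].
destruct (H (e / M)) as [d [Hd K]]; [now apply Rdiv_lt_0_compat|].
exists d. split; trivial. intros s Hs.
rewrite <- (map_scal _ Hf), <- !(map_minus _ Hf).
via_le KM.
eapply Rle_trans; [apply Rmult_le_compat_l; [lra|apply K; trivial]|].
right; field; lra.
Qed.

(** * The mean value inequality *)

Lemma is_derive_eps (g : R -> R) (t l : R) : is_derive g t l ->
  forall eps, 0 < eps -> exists d, 0 < d /\ forall s, Rabs (s - t) < d ->
  Rabs (g s - g t - (s - t) * l) <= eps * Rabs (s - t).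
Proof.
intros [_ H] e He. specialize (H t (fun P HP => HP) (mkposreal e He)).
apply locally_R_eps in H. destruct H as [d [Hd K]]. exists d. split; trivial.
Qed.

(** Continuous induction along [[a, b]] for the inequality relaxed by [eta * (t - a) + eta]. At an
    interior point the surplus slope [eta] absorbs the errors of both derivatives; at [a], where [u]
    is only continuous, the surplus constant does it. *)
Lemma mean_value_ineq {E : CSpace} (u u' : R -> E) (g g' : R -> R) (a b : R) :
  a <= b ->
  cont_on (fun t => a <= t <= b) u ->
  (forall t, a < t < b -> hasd u t (u' t)) ->
  (forall t, a <= t <= b -> is_derive g t (g' t)) ->
  (forall t, a < t < b -> norm (u' t) <= g' t) ->
  norm (minus (u b) (u a)) <= g b - g a.
Proof.
intros Hab Hu Hd Hg Hle.
assert (gcont : forall t, a <= t <= b -> forall e, 0 < e ->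
  exists d, 0 < d /\ forall s, Rabs (s - t) < d -> Rabs (g s - g t) < e).
{ intros t Ht. intros e He.
  assert (Hc : continuous g t) by (apply (@ex_derive_continuous R_AbsRing); exists (g' t); auto).
  pose proof (proj1 (filterlim_locally (F := locally t) g (g t)) Hc (mkposreal e He)) as Hc'.
  apply locally_R_eps in Hc'. exact Hc'. }
apply le_epsilon. intros e0 He0.
(* Chosen so that the total surplus [eta * (b - a) + eta] at [b] equals [e0]. *)
set (eta := e0 / (b - a + 1)).
assert (Heta : 0 < eta) by (apply Rdiv_lt_0_compat; lra).
set (B := fun t => g t - g a + eta * (t - a) + eta).
assert (Bcont : forall t, a <= t <= b -> forall e, 0 < e ->
  exists d, 0 < d /\ forall s, Rabs (s - t) < d -> Rabs (B s - B t) < e).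
{ intros t Ht e He. destruct (gcont t Ht (e / 2)) as [d [Hd' K]]; [lra|].
  exists (Rmin d (e / 2 / eta)). split.
  { apply Rmin_pos; trivial. apply Rdiv_lt_0_compat; lra. }
  intros s Hs. unfold B.
  replace (_ - _) with ((g s - g t) + eta * (s - t)) by ring.
  via_lt Rabs_triang. rewrite Rabs_mult, (Rabs_pos_eq eta) by lra.
  rmins. assert (H1 : Rabs (s - t) < d) by lra.
  assert (H2 : Rabs (s - t) < e / 2 / eta) by lra.
  apply (Rmult_lt_compat_l eta) in H2; trivial.
  replace (eta * (e / 2 / eta)) with (e / 2) in H2 by (field; lra).
  specialize (K s H1). lra. }
set (A := fun t => norm (minus (u t) (u a)) <= B t).
assert (Goal : A b).
2:{ unfold A, B in Goal. replace e0 with (eta * (b - a) + eta) by (unfold eta; field; lra). lra. }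
set (S := fun t => a <= t <= b /\ forall s, a <= s <= t -> A s).
assert (Aa : A a).
{ unfold A, B. replace (minus (u a) (u a)) with (zero : E) by lin E. rewrite norm_zero. lra. }
assert (Sa : S a) by (split; [lra|]; intros s Hs; replace s with a by lra; trivial).
destruct (completeness S) as [c [Hc1 Hc2]].
{ exists b. intros t [Ht _]. lra. }
{ now exists a. }
assert (Hac : a <= c) by (apply Hc1, Sa).
assert (Hcb : c <= b) by (apply Hc2; intros t [Ht _]; lra).
assert (Abelow : forall s, a <= s < c -> A s).
{ intros s Hs. destruct (classic (exists t, S t /\ s < t)) as [[t [[Ht1 Ht2] Hst]]|N].
  - apply Ht2; lra.
  - exfalso. assert (c <= s); [|lra]. apply Hc2. intros t Ht.
    destruct (Rle_lt_dec t s); trivial. exfalso; apply N; exists t; auto. }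
(* A strict failure at the supremum [c] would persist slightly to the left by continuity, where the
   inequality is already known. *)
assert (Ac : A c).
{ destruct (Rle_lt_dec (norm (minus (u c) (u a))) (B c)) as [H|H]; [exact H|exfalso].
  set (e := (norm (minus (u c) (u a)) - B c) / 2).
  assert (He : 0 < e) by (unfold e; lra).
  destruct (Hu c (conj Hac Hcb) e He) as [d1 [Hd1 K1]].
  destruct (Bcont c (conj Hac Hcb) e He) as [d2 [Hd2 K2]].
  assert (Hlt : a < c).
  { destruct (Req_dec a c) as [Heq|]; [|lra]. rewrite <- Heq in H. unfold A in Aa. lra. }
  set (s := Rmax a (c - Rmin d1 d2 / 2)).
  assert (0 < Rmin d1 d2) by (now apply Rmin_pos).
  rmins.
  assert (Hs : a <= s < c) by (split; [apply Rmax_l|apply Rmax_lub_lt; lra]).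
  assert (Hs' : c - Rmin d1 d2 / 2 <= s) by apply Rmax_r.
  assert (Hsc : Rabs (s - c) <= Rmin d1 d2 / 2) by (rewrite Rabs_left by lra; lra).
  specialize (K1 s ltac:(lra) ltac:(lra)). specialize (K2 s ltac:(lra)).
  specialize (Abelow s Hs). unfold A in Abelow.
  apply Rabs_def2 in K2. pose proof (norm_minus_triangle (u c) (u s) (u a)) as Htr.
  rewrite (norm_minus_sym (u c) (u s)) in Htr. unfold e in *. lra. }
assert (Abelow' : forall s, a <= s <= c -> A s).
{ intros s Hs. destruct (Req_dec s c) as [->|]; trivial. apply Abelow; lra. }
destruct (Req_dec c b) as [<-|Hne]; trivial. exfalso.
assert (Hcb' : c < b) by lra.
assert (exists d, 0 < d /\ forall s, c <= s < c + d -> s <= b -> A s) as [d [Hd0 K]].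
{ destruct (Req_dec a c) as [<-|Hneq].
  - destruct (Hu a ltac:(lra) (eta / 2)) as [d1 [Hd1 K1]]; [lra|].
    destruct (Bcont a ltac:(lra) (eta / 2)) as [d2 [Hd2 K2]]; [lra|].
    exists (Rmin d1 d2). split; [now apply Rmin_pos|]. intros s Hs Hsb.
    rmins.
    assert (Habs : Rabs (s - a) = s - a) by (apply Rabs_pos_eq; lra).
    specialize (K1 s ltac:(lra) ltac:(lra)). specialize (K2 s ltac:(lra)).
    apply Rabs_def2 in K2. destruct K2.
    assert (B a = eta) by (unfold B; ring). unfold A. lra.
  - destruct (Hd c ltac:(lra) (eta / 2)) as [d1 [Hd1 K1]]; [lra|].
    destruct (is_derive_eps g c (g' c) (Hg c ltac:(lra)) (eta / 2)) as [d2 [Hd2 K2]]; [lra|].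
    exists (Rmin d1 d2). split; [now apply Rmin_pos|]. intros s Hs Hsb.
    rmins.
    assert (Habs : Rabs (s - c) = s - c) by (apply Rabs_pos_eq; lra).
    specialize (K1 s ltac:(lra)). specialize (K2 s ltac:(lra)).
    rewrite Habs in K1, K2.
    pose proof (norm_le_minus (minus (u s) (u c)) (scal (RtoC (s - c)) (u' c))) as N1.
    pose proof (norm_scal_RtoC (s - c) (u' c)) as N2. rewrite Habs in N2.
    assert (N3 : (s - c) * norm (u' c) <= (s - c) * g' c)
      by (apply Rmult_le_compat_l; [lra|apply Hle; lra]).
    pose proof (norm_minus_triangle (u s) (u c) (u a)) as N4.
    unfold A, B in *. apply Rabs_le_between in K2. lra. }
assert (S (Rmin b (c + d / 2))).
{ assert (c < Rmin b (c + d / 2)) by (apply Rmin_glb_lt; lra).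
  split; [split; [lra|apply Rmin_l]|]. intros s Hs.
  destruct (Rle_lt_dec s c); [apply Abelow'; lra|].
  rmins.
  apply K; lra. }
assert (Rmin b (c + d / 2) <= c) by (apply Hc1; trivial).
assert (c < Rmin b (c + d / 2)) by (apply Rmin_glb_lt; lra). lra.
Qed.

Lemma mean_value_const {E : CSpace} (u u' : R -> E) (M a b : R) :
  a <= b ->
  cont_on (fun t => a <= t <= b) u ->
  (forall t, a < t < b -> hasd u t (u' t)) ->
  (forall t, a < t < b -> norm (u' t) <= M) ->
  norm (minus (u b) (u a)) <= M * (b - a).
Proof.
intros Hab Hu Hd Hle.
replace (M * (b - a)) with (M * b - M * a) by ring.
apply (mean_value_ineq u u' (fun t => M * t) (fun _ => M)); trivial.
intros t _. auto_derive; trivial; ring.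
Qed.

Lemma constant_of_zero_deriv {E : CSpace} (u : R -> E) (a b : R) :
  a <= b ->
  cont_on (fun t => a <= t <= b) u ->
  (forall t, a < t < b -> hasd u t zero) -> u b = u a.
Proof.
intros Hab Hu Hd. apply eq_of_norm_minus. intros e He.
eapply Rle_trans; [apply (mean_value_const u (fun _ => zero) 0 a b)|]; trivial.
- intros t _. rewrite norm_zero; lra.
- lra.
Qed.

(** * Integration of functions with values in a complex Banach space *)

(** Completeness as a proposition on a given normed module, so that products and [C] inherit it by
    instance search while their norm stays the one of the statement; [inhabited] hides the limit
    operation of the mixin. *)
Class Banach (E : CSpace) : Prop :=
  banach : inhabited (CompleteSpace.mixin_of E).

Global Instance Banach_complete (E : CompleteNormedModule C_AbsRing) : Banach E.
Proof. constructor. exact (CompleteSpace.mixin E (CompleteSpace.class E)). Qed.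

Definition banach_space (E : CSpace) (m : CompleteSpace.mixin_of E) :
  CompleteNormedModule C_AbsRing :=
  CompleteNormedModule.Pack C_AbsRing E
    (CompleteNormedModule.Class C_AbsRing E (NormedModule.class C_AbsRing E) m) E.

Global Instance Banach_prod (E F : CSpace) `{Banach E} `{Banach F} :
  Banach (prod_NormedModule _ E F).
Proof.
destruct (banach (E := E)) as [mE]. destruct (banach (E := F)) as [mF]. constructor.
pose (E' := CompleteSpace.Pack E (CompleteSpace.Class E _ mE) E).
pose (F' := CompleteSpace.Pack F (CompleteSpace.Class F _ mF) F).
assert (H1 : forall G : (E * F -> Prop) -> Prop, ProperFilter G ->
  cauchy G -> cauchy (T := E') (filtermap fst G)).
{ intros G FG HG e. destruct (HG e) as [x Hx]. exists (fst x).
  refine (filter_imp (ball x e) (fun y => ball (M := E') (fst x) e (fst y)) _ Hx).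
  intros y Hy. apply Hy. }
assert (H2 : forall G : (E * F -> Prop) -> Prop, ProperFilter G ->
  cauchy G -> cauchy (T := F') (filtermap snd G)).
{ intros G FG HG e. destruct (HG e) as [x Hx]. exists (snd x).
  refine (filter_imp (ball x e) (fun y => ball (M := F') (snd x) e (snd y)) _ Hx).
  intros y Hy. apply Hy. }
refine (CompleteSpace.Mixin (prod_UniformSpace E F)
  (fun G => (lim (T := E') (filtermap fst G), lim (T := F') (filtermap snd G))) _ _).
- intros G FG HG e.
  pose proof (complete_cauchy (T := E') _ (filtermap_proper_filter _ _ fst G FG) (H1 G FG HG) e) as K1.
  pose proof (complete_cauchy (T := F') _ (filtermap_proper_filter _ _ snd G FG) (H2 G FG HG) e) as K2.
  refine (filter_imp _ _ _ (filter_and (F := G) _ _ K1 K2)). intros y Hy. exact Hy.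
- intros G1 G2 H12 H21 e. split.
  + apply (close_lim (T := E') (filtermap fst G1) (filtermap fst G2)); intros P HP;
      [apply H12|apply H21]; exact HP.
  + apply (close_lim (T := F') (filtermap snd G1) (filtermap snd G2)); intros P HP;
      [apply H12|apply H21]; exact HP.
Qed.

(** Coquelicot's [is_RInt] takes values in normed modules over the reals, so the
    scalars are restricted. *)
Section RestrictScalars.

Variable E : CSpace.

Definition real_scal (r : R) (x : E) : E := scal (RtoC r) x.

Lemma real_scal_assoc (x y : R) (u : E) :
  real_scal x (real_scal y u) = real_scal (mult x y) u.
Proof.
unfold real_scal. change (mult x y) with (x * y). rewrite RtoC_mult. symmetry. apply scal_Cmult.
Qed.

Lemma real_scal_one (u : E) : real_scal one u = u.
Proof. apply scal_C1. Qed.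

Lemma real_scal_distr_l (x : R) (u v : E) :
  real_scal x (plus u v) = plus (real_scal x u) (real_scal x v).
Proof. unfold real_scal. lin E. Qed.

Lemma real_scal_distr_r (x y : R) (u : E) :
  real_scal (plus x y) u = plus (real_scal x u) (real_scal y u).
Proof. unfold real_scal. change (plus x y) with (x + y). rewrite RtoC_plus. apply scal_Cplus. Qed.

Definition real_ModuleSpace_mixin :
  ModuleSpace.mixin_of R_Ring (NormedModule.AbelianGroup C_AbsRing E) :=
  ModuleSpace.Mixin R_Ring (NormedModule.AbelianGroup C_AbsRing E) real_scal
    real_scal_assoc real_scal_one real_scal_distr_l real_scal_distr_r.

Definition real_ModuleSpace_class : ModuleSpace.class_of R_Ring E :=
  ModuleSpace.Class R_Ring E _ real_ModuleSpace_mixin.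

Definition real_NormedModuleAux : NormedModuleAux R_AbsRing :=
  NormedModuleAux.Pack R_AbsRing E
    (NormedModuleAux.Class R_AbsRing E real_ModuleSpace_class
       (UniformSpace.class (NormedModule.UniformSpace C_AbsRing E))) E.

Definition real_NormedModule_mixin : NormedModule.mixin_of R_AbsRing real_NormedModuleAux :=
  NormedModule.Mixin R_AbsRing real_NormedModuleAux (@norm C_AbsRing E)
    (@norm_factor C_AbsRing E) norm_triangle norm_scal_RtoC norm_compat1 norm_compat2 norm_eq_zero.

Definition real_restriction : NormedModule R_AbsRing :=
  NormedModule.Pack R_AbsRing E (NormedModule.Class R_AbsRing E _ real_NormedModule_mixin) E.

Definition real_complete (m : CompleteSpace.mixin_of E) : CompleteNormedModule R_AbsRing :=
  CompleteNormedModule.Pack R_AbsRing E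
    (CompleteNormedModule.Class R_AbsRing E
      (NormedModule.Class R_AbsRing E _ real_NormedModule_mixin) m) E.

End RestrictScalars.

Lemma seq_lim_exists {E : CSpace} `{BE : Banach E} (u : nat -> E) :
  (forall eps, 0 < eps -> exists N, forall m n, (N <= m)%nat -> (N <= n)%nat ->
     norm (minus (u m) (u n)) < eps) ->
  exists y, forall eps, 0 < eps -> exists N, forall n, (N <= n)%nat -> norm (minus (u n) y) < eps.
Proof.
intros H. destruct BE as [mE].
destruct (proj1 (filterlim_locally_cauchy (F := eventually) (U := banach_space E mE) u)) as [y Hy].
- intros e. destruct (H e (cond_pos e)) as [N K].
  exists (fun n => (N <= n)%nat). split; [now exists N|].
  intros m n Hm Hn. apply (norm_compat1 (V := E)). now apply K.
- exists y. intros e He.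
  exact (proj1 (filterlim_eps eventually u y) Hy e He).
Qed.

Lemma is_linear_scal_C {E : CSpace} (c : C) : is_linear (fun x : E => scal c x).
Proof. apply (is_linear_scal_r (K := C_AbsRing)). exact Cmult_comm. Qed.

Section Primitive.

Context {E : CSpace} `{BE : Banach E}.

(** The integral of [f] over [[0, t]]; arbitrary when [f] is not integrable. *)
Definition prim (f : R -> E) (t : R) : E :=
  epsilon (inhabits zero) (@is_RInt (real_restriction E) f 0 t).

Lemma prim_spec (f : R -> E) (t : R) : (forall s, continuous f s) ->
  @is_RInt (real_restriction E) f 0 t (prim f t).
Proof.
intros Hf. unfold prim. apply epsilon_spec. destruct BE as [m].
apply (@ex_RInt_continuous (real_complete E m)). intros z _. apply Hf.
Qed.

Lemma prim_0 (f : R -> E) : (forall s, continuous f s) -> prim f 0 = zero.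
Proof.
intros Hf. apply (filterlim_locally_unique (K := R_AbsRing) (V := real_restriction E)
  (F := Riemann_fine 0 0)
  (fun ptd => scal (sign (0 - 0)) (@Riemann_sum (real_restriction E) f ptd))).
- exact (prim_spec f 0 Hf).
- exact (@is_RInt_point (real_restriction E) f 0).
Qed.

Lemma prim_hasd (f : R -> E) (t : R) : (forall s, continuous f s) -> hasd (prim f) t (f t).
Proof.
intros Hf.
assert (H : @is_derive R_AbsRing (real_restriction E) (prim f) t (f t)).
{ apply (@is_derive_RInt (real_restriction E) f (prim f) 0 t); [|apply Hf].
  apply filter_forall. intros s. now apply prim_spec. }
destruct H as [_ H]. specialize (H t (fun P HP => HP)).
intros e He. specialize (H (mkposreal e He)). apply locally_R_eps in H. exact H.
Qed.

Lemma prim_continuous (f : R -> E) (t : R) : (forall s, continuous f s) -> continuous (prim f) t.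
Proof. intros Hf. eapply hasd_continuous, prim_hasd, Hf. Qed.

(** [prim f - u] has derivative zero. Later identities between integrals, such as linearity, shifts
    and splitting, are obtained by exhibiting an antiderivative; [u] is differentiated only inside
    the interval, since at the endpoint [0] many curves are merely continuous. *)
Lemma prim_eq (u f : R -> E) (t : R) : 0 <= t ->
  (forall s, continuous f s) -> cont_on (fun s => 0 <= s <= t) u ->
  (forall s, 0 < s < t -> hasd u s (f s)) -> prim f t = minus (u t) (u 0).
Proof.
intros Ht Hf Hu Hd.
assert (H : minus (prim f t) (u t) = minus (prim f 0) (u 0)).
{ apply (constant_of_zero_deriv (fun s => minus (prim f s) (u s)) 0 t Ht).
  - intros s Hs e He.
    destruct (Hu s Hs (e / 2)) as [d [Hd1 K]]; [lra|].
    destruct (proj1 (continuous_eps _ s) (prim_continuous f s Hf) (e / 2)) as [d' [Hd' K']]; [lra|].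
    exists (Rmin d d'). split; [now apply Rmin_pos|]. intros r Hr1 Hr.
    rmins.
    specialize (K r Hr1 ltac:(lra)). specialize (K' r ltac:(lra)).
    norm_as E (minus (minus (prim f r) (prim f s)) (minus (u r) (u s))).
    eapply Rle_lt_trans; [apply norm_minus_le|lra].
  - intros s Hs.
    replace (zero : E) with (plus (f s) (scal (Copp (RtoC 1)) (f s))) by lin E.
    apply (hasd_ext (fun s => plus (prim f s) (scal (Copp (RtoC 1)) (u s)))); [intros r; lin E|].
    apply hasd_plus; [now apply prim_hasd|].
    apply (hasd_linear (fun x : E => scal (Copp (RtoC 1)) x)); [apply is_linear_scal_C|now apply Hd]. }
rewrite (prim_0 f Hf) in H.
replace (prim f t) with (plus (minus (prim f t) (u t)) (u t)) by lin E. rewrite H. lin E.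
Qed.

Lemma prim_ext (f g : R -> E) (t : R) : 0 <= t ->
  (forall s, continuous f s) -> (forall s, continuous g s) ->
  (forall s, 0 < s < t -> f s = g s) -> prim f t = prim g t.
Proof.
intros Ht Hf Hg H. rewrite (prim_eq (prim g) f t Ht Hf), (prim_0 g Hg).
- lin E.
- apply continuous_cont_on. intros s _. now apply prim_continuous.
- intros s Hs. rewrite H by trivial. now apply prim_hasd.
Qed.

Lemma prim_plus (f g : R -> E) (t : R) : 0 <= t ->
  (forall s, continuous f s) -> (forall s, continuous g s) ->
  prim (fun s => plus (f s) (g s)) t = plus (prim f t) (prim g t).
Proof.
intros Ht Hf Hg. rewrite (prim_eq (fun s => plus (prim f s) (prim g s))); trivial.
- rewrite !prim_0 by trivial. lin E.
- intros s. apply (continuous_plus (V := E)); [apply Hf|apply Hg].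
- apply continuous_cont_on. intros s _. apply (continuous_plus (V := E)); now apply prim_continuous.
- intros s _. apply hasd_plus; now apply prim_hasd.
Qed.

(** Riemann sums remain in a set stable under sums and real multiples, and closedness passes to
    their limit. With the graph of a closed operator as [P], this takes the operator under the
    integral. *)
Lemma prim_closed (P : E -> Prop) (f : R -> E) (t : R) : 0 <= t ->
  closed P -> P zero -> (forall x y, P x -> P y -> P (plus x y)) ->
  (forall (r : R) x, P x -> P (scal (RtoC r) x)) ->
  (forall s, continuous f s) -> (forall s, P (f s)) -> P (prim f t).
Proof.
intros Ht Hc H0 Hp Hs Hf HP.
pose proof (prim_spec f t Hf) as HI.
unfold is_RInt in HI.
refine (closed_filterlim (U := E) _ P _ HI _ Hc).
(* The sign is the orientation factor in the definition of [is_RInt]. *)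
intros ptd. apply (Hs (sign (t - 0))).
pattern ptd. apply SF_cons_ind.
- intros x. exact H0.
- intros h s IH. rewrite Riemann_sum_cons. apply Hp; [|exact IH].
  apply (Hs (SF_h s - fst h)), HP.
Qed.

End Primitive.

Lemma prim_linear {E F : CSpace} `{BE : Banach E} `{BF : Banach F}
  (l : E -> F) (f : R -> E) (t : R) :
  0 <= t -> is_linear l -> (forall s, continuous f s) ->
  l (prim f t) = prim (fun s => l (f s)) t.
Proof.
intros Ht Hl Hf. symmetry. rewrite (prim_eq (fun s => l (prim f s))); trivial.
- rewrite (prim_0 f Hf), (map_zero _ Hl). lin F.
- intros s. apply (continuous_comp f l); [apply Hf|now apply (linear_cont (V := F))].
- apply continuous_cont_on. intros s _.
  apply (continuous_comp (prim f) l); [now apply prim_continuous|now apply (linear_cont (V := F))].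
- intros s _. apply hasd_linear; trivial. now apply prim_hasd.
Qed.

(** * Integrals over the half-line of exponentially decaying functions *)

Section HalfLine.

Context {E : CSpace} `{BE : Banach E}.

(** Continuity on all of [R] rather than on the half-line matches the facts on [prim], which concern
    functions continuous everywhere. *)
Definition decays (f : R -> E) : Prop :=
  (forall s, continuous f s) /\
  exists K mu, 0 <= K /\ 0 < mu /\ forall s, 0 <= s -> norm (f s) <= K * exp (- mu * s).

(** The integral of [f] over the half-line; arbitrary when it does not converge
    along integer endpoints. *)
Definition iint (f : R -> E) : E :=
  epsilon (inhabits zero) (fun y => forall eps, 0 < eps ->
    exists N, forall n, (N <= n)%nat -> norm (minus (prim f (INR n)) y) < eps).

Lemma exp_decay_small (K mu eps : R) : 0 <= K -> 0 < mu -> 0 < eps ->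
  exists N, forall t, INR N <= t -> K * exp (- mu * t) < eps.
Proof.
intros HK Hmu He.
(* [mu * t < exp (mu * t)], so it is enough that [mu * t] exceeds [K / eps]. *)
destruct (INR_unbounded (K / (eps * mu))) as [N HN].
exists N. intros t Ht.
assert (H0 : K / (eps * mu) < t) by lra.
assert (0 <= t) by (pose proof (pos_INR N); lra).
assert (H1 : K < eps * (mu * t)).
{ apply (Rmult_lt_compat_l (eps * mu)) in H0; [|now apply Rmult_lt_0_compat].
  replace (eps * mu * (K / (eps * mu))) with K in H0 by (field; split; lra). lra. }
replace (- mu * t) with (- (mu * t)) by ring. rewrite exp_Ropp.
assert (H2 : mu * t < exp (mu * t)).
{ pose proof (exp_ineq1_le (mu * t)). lra. }
pose proof (exp_pos (mu * t)).
apply Rmult_lt_reg_r with (exp (mu * t)); trivial.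
replace (K * / exp (mu * t) * exp (mu * t)) with K by (field; lra). nra.
Qed.

(** Comparison with [- K / mu * exp (- mu * s)], an antiderivative of the majorant; it yields both
    the Cauchy property and the bound [K / mu] of the integral. *)
Lemma prim_tail (f : R -> E) (K mu a b : R) : 0 < mu -> 0 <= a <= b ->
  (forall s, continuous f s) -> (forall s, 0 <= s -> norm (f s) <= K * exp (- mu * s)) ->
  norm (minus (prim f b) (prim f a)) <= K / mu * exp (- mu * a) - K / mu * exp (- mu * b).
Proof.
intros Hmu Hab Hf Hb.
replace (K / mu * exp (- mu * a) - K / mu * exp (- mu * b)) with
  (- K / mu * exp (- mu * b) - - K / mu * exp (- mu * a)) by (field; lra).
apply (mean_value_ineq (prim f) f (fun s => - K / mu * exp (- mu * s)) (fun s => K * exp (- mu * s)));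
  [lra| | | |].
- apply continuous_cont_on. intros s _. now apply prim_continuous.
- intros s _. now apply prim_hasd.
- intros s _. auto_derive; trivial. field. lra.
- intros s Hs. apply Hb. lra.
Qed.

Lemma iint_spec (f : R -> E) : decays f -> forall eps, 0 < eps ->
    exists N, forall n, (N <= n)%nat -> norm (minus (prim f (INR n)) (iint f)) < eps.
Proof.
intros [Hf [K [mu [HK [Hmu Hb]]]]].
unfold iint. apply epsilon_spec. apply seq_lim_exists.
intros e He.
destruct (exp_decay_small (K / mu) mu e) as [N HN]; trivial.
{ apply Rdiv_le_0_compat; lra. }
assert (Haux : forall m n, (N <= m)%nat -> (m <= n)%nat ->
  norm (minus (prim f (INR n)) (prim f (INR m))) < e).
{ intros m n Hm Hn. eapply Rle_lt_trans.
  - apply (prim_tail f K mu); trivial. split; [apply pos_INR|now apply le_INR].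
  - assert (0 <= K / mu) by (apply Rdiv_le_0_compat; lra).
    pose proof (HN (INR m) ltac:(now apply le_INR)). pose proof (exp_pos (- mu * INR n)). nra. }
exists N. intros m n Hm Hn. destruct (Nat.le_ge_cases m n).
- rewrite norm_minus_sym. now apply Haux.
- now apply Haux.
Qed.

Lemma iint_unique (f : R -> E) (y : E) : decays f ->
  (forall eps, 0 < eps -> exists N, forall n, (N <= n)%nat -> norm (minus (prim f (INR n)) y) < eps) ->
  iint f = y.
Proof.
intros Hf Hy. apply eq_of_norm_minus. intros e He.
destruct (iint_spec f Hf (e / 2)) as [N1 H1]; [lra|].
destruct (Hy (e / 2)) as [N2 H2]; [lra|].
specialize (H1 (max N1 N2) ltac:(lia)). specialize (H2 (max N1 N2) ltac:(lia)).
via_le (norm_minus_triangle _ (prim f (INR (max N1 N2)))).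
rewrite norm_minus_sym. lra.
Qed.

Lemma iint_bound (f : R -> E) (K mu : R) : 0 < mu -> (forall s, continuous f s) ->
  (forall s, 0 <= s -> norm (f s) <= K * exp (- mu * s)) -> norm (iint f) <= K / mu.
Proof.
intros Hmu Hf Hb.
assert (HK : 0 <= K).
{ pose proof (Hb 0 (Rle_refl 0)) as H. rewrite Rmult_0_r, exp_0 in H. pose proof (norm_ge_0 (f 0)). lra. }
assert (Hd : decays f) by (split; trivial; exists K, mu; auto).
apply le_epsilon. intros e He.
destruct (iint_spec f Hd e He) as [N HN]. specialize (HN N (Nat.le_refl N)).
pose proof (prim_tail f K mu 0 (INR N) Hmu (conj (Rle_refl 0) (pos_INR N)) Hf Hb) as H.
assert (Hz : minus (prim f (INR N)) (prim f 0) = prim f (INR N)) by (rewrite (prim_0 f Hf); lin E).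
rewrite Rmult_0_r, exp_0, Hz in H.
assert (0 <= K / mu) by (apply Rdiv_le_0_compat; lra).
pose proof (exp_pos (- mu * INR N)).
pose proof (norm_le_minus (iint f) (prim f (INR N))) as H2.
rewrite norm_minus_sym in H2. set (q := K / mu) in *. clearbody q.
assert (0 <= q * exp (- mu * INR N)) by (apply Rmult_le_pos; lra). lra.
Qed.

(** The boundary term at infinity vanishes by the decay of [u]; this is the form in which
    integrations by parts on the half-line are carried out. *)
Lemma iint_ftc (u f : R -> E) : decays f -> cont_on (fun s => 0 <= s) u ->
  (forall s, 0 < s -> hasd u s (f s)) ->
  (exists K mu, 0 <= K /\ 0 < mu /\ forall s, 0 <= s -> norm (u s) <= K * exp (- mu * s)) ->
  iint f = opp (u 0).
Proof.
intros Hf Hu Hd [K [mu [HK [Hmu Hb]]]]. apply iint_unique; trivial.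
intros e He. destruct (exp_decay_small K mu e HK Hmu He) as [N HN].
exists N. intros n Hn. rewrite (prim_eq u f).
- norm_as E (u (INR n)). eapply Rle_lt_trans; [apply Hb, pos_INR|]. apply HN. now apply le_INR.
- apply pos_INR.
- apply Hf.
- intros s Hs e' He'. destruct (Hu s ltac:(lra) e' He') as [d [Hd' K']].
  exists d. split; trivial. intros r Hr. apply K'. lra.
- intros s Hs. apply Hd. lra.
Qed.

Lemma decays_plus (f g : R -> E) : decays f -> decays g -> decays (fun s => plus (f s) (g s)).
Proof.
intros [Hf [K [mu [HK [Hmu Hb]]]]] [Hg [K' [mu' [HK' [Hmu' Hb']]]]]. split.
- intros s. apply (continuous_plus (V := E)); [apply Hf|apply Hg].
- exists (K + K'), (Rmin mu mu'). split; [lra|]. split; [now apply Rmin_pos|].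
  intros s Hs. via_le norm_triangle. rewrite Rmult_plus_distr_r.
  assert (Haux : forall nu, Rmin mu mu' <= nu -> exp (- nu * s) <= exp (- Rmin mu mu' * s)).
  { intros nu Hnu. destruct (Req_dec (- nu * s) (- Rmin mu mu' * s)) as [->|Hne]; [lra|].
    left. apply exp_increasing. nra. }
  pose proof (Haux mu (Rmin_l _ _)). pose proof (Haux mu' (Rmin_r _ _)).
  specialize (Hb s Hs). specialize (Hb' s Hs). nra.
Qed.

Lemma iint_plus (f g : R -> E) : decays f -> decays g ->
  iint (fun s => plus (f s) (g s)) = plus (iint f) (iint g).
Proof.
intros Hf Hg. apply iint_unique; [now apply decays_plus|].
intros e He. destruct (iint_spec f Hf (e / 2)) as [N1 H1]; [lra|].
destruct (iint_spec g Hg (e / 2)) as [N2 H2]; [lra|].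
exists (max N1 N2). intros n Hn. specialize (H1 n ltac:(lia)). specialize (H2 n ltac:(lia)).
rewrite prim_plus; [|apply pos_INR|apply Hf|apply Hg].
norm_as E (plus (minus (prim f (INR n)) (iint f)) (minus (prim g (INR n)) (iint g))).
via_lt norm_triangle. lra.
Qed.

Lemma iint_ext (f g : R -> E) : (forall s, f s = g s) -> iint f = iint g.
Proof. intros H. replace g with f; trivial. apply functional_extensionality, H. Qed.

Lemma iint_closed (P : E -> Prop) (f : R -> E) :
  closed P -> P zero -> (forall x y, P x -> P y -> P (plus x y)) ->
  (forall (r : R) x, P x -> P (scal (RtoC r) x)) ->
  decays f -> (forall s, P (f s)) -> P (iint f).
Proof.
intros Hc H0 Hp Hs Hf HP.
refine (closed_filterlim (U := E) (F := eventually) (fun n => prim f (INR n)) P _ _ _ Hc).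
- apply (filterlim_eps eventually). intros e He. exact (iint_spec f Hf e He).
- intros n. apply prim_closed; trivial; [apply pos_INR|apply Hf].
Qed.

End HalfLine.

Lemma decays_linear {E F : CSpace} `{BE : Banach E} `{BF : Banach F}
  (l : E -> F) (f : R -> E) :
  is_linear l -> decays f -> decays (fun s => l (f s)).
Proof.
intros Hl [Hf [K [mu [HK [Hmu Hb]]]]]. split.
- intros s. apply (continuous_comp f l); [apply Hf|now apply (linear_cont (V := F))].
- destruct (map_bound _ Hl) as [M [HM KM]]. exists (M * K), mu.
  split; [nra|]. split; trivial. intros s Hs. via_le KM.
  rewrite Rmult_assoc. apply Rmult_le_compat_l; [lra|]. now apply Hb.
Qed.

Lemma iint_linear {E F : CSpace} `{BE : Banach E} `{BF : Banach F}
  (l : E -> F) (f : R -> E) :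
  is_linear l -> decays f -> l (iint f) = iint (fun s => l (f s)).
Proof.
intros Hl Hf. symmetry. apply iint_unique; [now apply decays_linear|].
destruct (map_bound _ Hl) as [M [HM KM]].
intros e He. destruct (iint_spec f Hf (e / M)) as [N HN]; [now apply Rdiv_lt_0_compat|].
exists N. intros n Hn. rewrite <- (prim_linear l f); [|apply pos_INR|trivial|apply Hf].
rewrite <- (map_minus _ Hl). via_lt KM.
specialize (HN n Hn). apply (Rmult_lt_compat_l M) in HN; trivial.
replace (M * (e / M)) with e in HN by (field; lra). exact HN.
Qed.

Lemma iint_scal {E : CSpace} `{BE : Banach E} (c : C) (f : R -> E) :
  decays f -> iint (fun s => scal c (f s)) = scal c (iint f).
Proof. intros Hf. symmetry. exact (iint_linear (fun x : E => scal c x) f (is_linear_scal_C c) Hf). Qed.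

(** * Uniform boundedness *)

(** One step of a gliding hump: unboundedness provides [h'] of norm at most [r / 2] with [T n h']
    large, and [T n] is large at one of [x + h'], [x - h'] because half their difference is [h'].
    Continuity of [T n] keeps the lower bound on a small ball. *)
Lemma unbounded_on_ball {E F : CSpace} (T : nat -> E -> F) :
  (forall n, is_linear (T n)) ->
  ~ (exists K, forall n x, norm (T n x) <= K * norm x) ->
  forall (x : E) (r k : R), 0 < r -> 0 <= k ->
  exists y r', 0 < r' /\ r' <= r / 2 /\ norm (minus y x) <= r / 2 /\
  exists n, forall z, norm (minus z y) <= r' -> k <= norm (T n z).
Proof.
intros HT HN x r k Hr Hk.
(* After scaling [h] to norm [r / 2] this ratio yields [k + 1]; the extra [1] is given up on the
   ball of radius [/ M]. *)
set (K := 2 * (k + 1) / r).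
assert (HK : 0 < K) by (apply Rdiv_lt_0_compat; lra).
assert (exists n h, K * norm h < norm (T n h)) as [n [h Hh]].
{ apply NNPP. intros H. apply HN. exists K. intros n y.
  destruct (Rle_lt_dec (norm (T n y)) (K * norm y)); trivial. exfalso; apply H; eauto. }
assert (Hh0 : 0 < norm h).
{ destruct (norm_ge_0 h) as [|H0]; trivial. symmetry in H0. apply norm_eq_zero in H0. subst h.
  rewrite (map_zero _ (HT n)), norm_zero, norm_zero in Hh. lra. }
set (c := r / (2 * norm h)).
assert (Hc : 0 < c) by (apply Rdiv_lt_0_compat; lra).
set (h' := scal (RtoC c) h : E).
assert (Hh' : norm h' <= r / 2).
{ via_le norm_scal_RtoC. rewrite Rabs_pos_eq by lra.
  right. unfold c. field. lra. }
assert (Th' : k + 1 <= norm (T n h')).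
{ assert (H1 : norm (T n h) <= / c * norm (T n h')).
  { unfold h'. rewrite (map_scal _ (HT n)).
    replace (T n h) with (scal (RtoC (/ c)) (scal (RtoC c) (T n h))) at 1.
    - via_le norm_scal_RtoC. rewrite Rabs_pos_eq.
      apply Rle_refl. left; now apply Rinv_0_lt_compat.
    - rewrite RtoC_inv by lra. lin F. field. intros H. apply RtoC_inj in H. lra. }
  apply Rmult_le_reg_l with (/ c); [now apply Rinv_0_lt_compat|].
  replace (/ c * (k + 1)) with (K * norm h) by (unfold c, K; field; lra). lra. }
destruct (map_bound _ (HT n)) as [M [HM KM]].
assert (exists y, norm (minus y x) <= r / 2 /\ k + 1 <= norm (T n y)) as [y [Hy Ty]].
{ assert (Hs : norm (T n h') <= / 2 * norm (T n (plus x h')) + / 2 * norm (T n (minus x h'))).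
  { replace (T n h') with (scal (RtoC (/ 2)) (minus (T n (plus x h')) (T n (minus x h')))).
    - via_le norm_scal_RtoC. rewrite Rabs_pos_eq by lra.
      pose proof (norm_minus_le (T n (plus x h')) (T n (minus x h'))). lra.
    - rewrite (map_plus _ (HT n)), (map_minus _ (HT n)).
      rewrite RtoC_inv by lra. lin F; field; intros H; apply RtoC_inj in H; lra. }
  destruct (Rle_lt_dec (k + 1) (norm (T n (plus x h')))) as [H|H].
  - exists (plus x h'). split; trivial. norm_as E h'. trivial.
  - exists (minus x h'). split; [|lra]. norm_as E (opp h'). rewrite norm_opp. trivial. }
exists y, (Rmin (r / 2) (/ M)). split; [apply Rmin_pos; [lra|now apply Rinv_0_lt_compat]|].
split; [apply Rmin_l|]. split; trivial. exists n. intros z Hz.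
assert (H1 : norm (minus z y) <= / M) by (eapply Rle_trans; [apply Hz|apply Rmin_r]).
assert (H2 : norm (minus (T n z) (T n y)) <= 1).
{ rewrite <- (map_minus _ (HT n)). via_le KM.
  apply (Rmult_le_compat_l M) in H1; [|lra]. rewrite Rinv_r in H1; lra. }
pose proof (norm_le_minus (T n y) (T n z)) as H3. rewrite norm_minus_sym in H3. lra.
Qed.

(** Since [r (S k) <= r k / 2], each step [r k / 2] is at most [r k - r (S k)], so the distances
    telescope and the limit stays within [r k] of the centre [x k]. *)
Lemma nested_balls_limit {E : CSpace} `{BE : Banach E} (x : nat -> E) (r : nat -> R) :
  (forall k, 0 < r k) -> (forall k, r (S k) <= r k / 2) ->
  (forall k, norm (minus (x (S k)) (x k)) <= r k / 2) ->
  exists y, forall k, norm (minus y (x k)) <= r k.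
Proof.
intros Hr Hr' Hx.
assert (Hmn : forall k m, norm (minus (x (k + m)%nat) (x k)) <= r k - r (k + m)%nat).
{ intros k m. induction m as [|m IH].
  - rewrite Nat.add_0_r. norm_as E (zero : E). rewrite norm_zero. lra.
  - rewrite Nat.add_succ_r. pose proof (Hx (k + m)%nat). pose proof (Hr' (k + m)%nat).
    pose proof (norm_minus_triangle (x (S (k + m))) (x (k + m)%nat) (x k)). lra. }
assert (Hsmall : forall k, r k <= r 0%nat / (INR k + 1)).
{ induction k as [|k IH]; [simpl; pose proof (Hr 0%nat); right; field|].
  pose proof (pos_INR k). pose proof (Hr 0%nat). pose proof (Hr' k).
  rewrite S_INR. apply Rle_trans with (r 0%nat / (INR k + 1) / 2); [lra|].
  unfold Rdiv. rewrite Rmult_assoc, <- Rinv_mult. apply Rmult_le_compat_l; [lra|].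
  apply Rinv_le_contravar; lra. }
destruct (seq_lim_exists x) as [y Hy].
- intros e He. destruct (INR_unbounded (r 0%nat / e)) as [N HN].
  assert (HrN : r N < e).
  { via_lt Hsmall. pose proof (pos_INR N). pose proof (Hr 0%nat).
    apply Rmult_lt_reg_r with (INR N + 1); [lra|].
    apply (Rmult_lt_compat_l e) in HN; trivial.
    replace (e * (r 0%nat / e)) with (r 0%nat) in HN by (field; lra).
    replace (r 0%nat / (INR N + 1) * (INR N + 1)) with (r 0%nat) by (field; lra). lra. }
  assert (Haux : forall k m, (N <= k)%nat -> (k <= m)%nat -> norm (minus (x m) (x k)) < e).
  { assert (Hdec : forall m, r (N + m)%nat <= r N).
    { induction m as [|m IH]; [rewrite Nat.add_0_r; lra|]. rewrite Nat.add_succ_r.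
      pose proof (Hr' (N + m)%nat). pose proof (Hr (N + m)%nat). lra. }
    intros k m Hk Hm. pose proof (Hmn k (m - k)%nat) as H.
    replace (k + (m - k))%nat with m in H by lia. pose proof (Hr m).
    specialize (Hdec (k - N)%nat). replace (N + (k - N))%nat with k in Hdec by lia. lra. }
  exists N. intros m n Hm Hn. destruct (Nat.le_ge_cases m n).
  + rewrite norm_minus_sym. now apply Haux.
  + now apply Haux.
- exists y. intros k. apply le_epsilon. intros e He. destruct (Hy e He) as [N HN].
  specialize (HN (k + N)%nat ltac:(lia)).
  pose proof (norm_minus_triangle y (x (k + N)%nat) (x k)) as H.
  rewrite (norm_minus_sym y (x (k + N)%nat)) in H. pose proof (Hmn k N). pose proof (Hr (k + N)%nat). lra.
Qed.

(** Iterating [unbounded_on_ball] produces nested balls; at their common point, for every [k], some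
    [T n] has norm at least [k], against pointwise boundedness. *)
Lemma banach_steinhaus {E F : CSpace} `{BE : Banach E} (T : nat -> E -> F) :
  (forall n, is_linear (T n)) ->
  (forall x, exists K, forall n, norm (T n x) <= K) ->
  exists K, forall n x, norm (T n x) <= K * norm x.
Proof.
intros HT Hb. apply NNPP. intros HN.
pose proof (unbounded_on_ball T HT HN) as Hstep.
assert (exists next : nat -> E * R -> E * R, forall k p, 0 < snd p ->
  0 < snd (next k p) /\ snd (next k p) <= snd p / 2 /\
  norm (minus (fst (next k p)) (fst p)) <= snd p / 2 /\
  exists n, forall z, norm (minus z (fst (next k p))) <= snd (next k p) -> INR k <= norm (T n z))
  as [next Hnext].
{ exists (fun k p => epsilon (inhabits p) (fun q => 0 < snd q /\ snd q <= snd p / 2 /\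
    norm (minus (fst q) (fst p)) <= snd p / 2 /\
    exists n, forall z, norm (minus z (fst q)) <= snd q -> INR k <= norm (T n z))).
  intros k p Hp. apply epsilon_spec.
  destruct (Hstep (fst p) (snd p) (INR k) Hp (pos_INR k)) as [y [r' H]]. exists (y, r'). exact H. }
set (s := nat_rect (fun _ => (E * R)%type) (zero, 1) next).
assert (Hs : forall k, 0 < snd (s k)).
{ induction k as [|k IH]; simpl; [lra|]. now apply Hnext. }
destruct (nested_balls_limit (fun k => fst (s k)) (fun k => snd (s k))) as [y Hy]; trivial.
{ intros k. now apply (Hnext k (s k)). }
{ intros k. now apply (Hnext k (s k)). }
destruct (Hb y) as [K HK]. destruct (INR_unbounded K) as [k Hk].
destruct (Hnext k (s k) (Hs k)) as [_ [_ [_ [n Hn]]]].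
specialize (Hn y (Hy (S k))). specialize (HK n). lra.
Qed.

(** * Families of operators applied to functions *)

Definition locally_bounded {E F : CSpace} (S : R -> E -> F) (t : R) : Prop :=
  exists K d, 0 < K /\ 0 < d /\ forall s x, Rabs (s - t) < d -> norm (S s x) <= K * norm x.

Lemma family_continuous {E F : CSpace} (S : R -> E -> F) (P : R -> Prop) (v : R -> E) (t : R) :
  P t -> (forall s, P s -> is_linear (S s)) ->
  (exists K d, 0 < K /\ 0 < d /\ forall s x, P s -> Rabs (s - t) < d -> norm (S s x) <= K * norm x) ->
  (forall eps, 0 < eps -> exists d, 0 < d /\ forall s, P s -> Rabs (s - t) < d ->
     norm (minus (S s (v t)) (S t (v t))) < eps) ->
  (forall eps, 0 < eps -> exists d, 0 < d /\ forall s, P s -> Rabs (s - t) < d ->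
     norm (minus (v s) (v t)) < eps) ->
  forall eps, 0 < eps -> exists d, 0 < d /\ forall s, P s -> Rabs (s - t) < d ->
     norm (minus (S s (v s)) (S t (v t))) < eps.
Proof.
intros Pt HS [K [d0 [HK [Hd0 Hb]]]] HSc Hv e He.
destruct (HSc (e / 2)) as [d1 [Hd1 K1]]; [lra|].
destruct (Hv (e / 2 / K)) as [d2 [Hd2 K2]]; [apply Rdiv_lt_0_compat; lra|].
exists (Rmin d0 (Rmin d1 d2)). split; [repeat apply Rmin_pos; trivial|].
intros s Ps Hs. rmins.
specialize (K1 s Ps ltac:(lra)). specialize (K2 s Ps ltac:(lra)).
specialize (Hb s (minus (v s) (v t)) Ps ltac:(lra)).
rewrite (map_minus _ (HS s Ps)) in Hb.
apply (Rmult_lt_compat_l K) in K2; trivial.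
replace (K * (e / 2 / K)) with (e / 2) in K2 by (field; lra).
pose proof (norm_minus_triangle (S s (v s)) (S s (v t)) (S t (v t))). lra.
Qed.

Lemma family_hasd {E F : CSpace} (S : R -> E -> F) (v : R -> E) (t : R) (l : F) (m : E) :
  locally t (fun s => is_linear (S s)) -> locally_bounded S t ->
  hasd (fun s => S s (v t)) t l -> continuous (fun s => S s m) t ->
  hasd v t m -> hasd (fun s => S s (v s)) t (plus l (S t m)).
Proof.
intros HS [K [d0 [HK [Hd0 Hb]]]] Hl Hc Hv e He.
apply locally_R_eps in HS. destruct HS as [d4 [Hd4 HS]].
destruct (Hl (e / 3)) as [d1 [Hd1 K1]]; [lra|].
destruct (proj1 (continuous_eps _ t) Hc (e / 3)) as [d2 [Hd2 K2]]; [lra|].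
destruct (Hv (e / 3 / K)) as [d3 [Hd3 K3]]; [apply Rdiv_lt_0_compat; lra|].
set (d := Rmin (Rmin d0 d4) (Rmin d1 (Rmin d2 d3))).
exists d. split; [unfold d; repeat apply Rmin_pos; trivial|].
intros s Hs.
pose proof (Rmin_l (Rmin d0 d4) (Rmin d1 (Rmin d2 d3))) as A1.
pose proof (Rmin_r (Rmin d0 d4) (Rmin d1 (Rmin d2 d3))) as A2.
rmins. fold d in A1, A2.
assert (Ls : is_linear (S s)) by (apply HS; lra).
specialize (K1 s ltac:(lra)). specialize (K2 s ltac:(lra)). specialize (K3 s ltac:(lra)).
specialize (Hb s (minus (minus (v s) (v t)) (scal (RtoC (s - t)) m)) ltac:(lra)).
apply (Rmult_le_compat_l K) in K3; [|lra].
replace (K * (e / 3 / K * Rabs (s - t))) with (e / 3 * Rabs (s - t)) in K3 by (field; lra).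
rewrite !(map_minus _ Ls), (map_scal _ Ls) in Hb.
norm_as F (plus (plus (minus (minus (S s (v t)) (S t (v t))) (scal (RtoC (s - t)) l))
  (minus (minus (S s (v s)) (S s (v t))) (scal (RtoC (s - t)) (S s m))))
  (scal (RtoC (s - t)) (minus (S s m) (S t m)))).
via_le norm_triangle.
eapply Rle_trans; [apply Rplus_le_compat_r, norm_triangle|].
pose proof (norm_scal_RtoC (s - t) (minus (S s m) (S t m))) as A3.
assert (A4 : Rabs (s - t) * norm (minus (S s m) (S t m)) <= Rabs (s - t) * (e / 3))
  by (apply Rmult_le_compat_l; [apply Rabs_pos|lra]).
lra.
Qed.

(** Orbits make sense for nonnegative times, whereas [prim] integrates functions continuous on [R];
    composition with [Rabs] bridges the two throughout. *)
Lemma continuous_even_extension {E : CSpace} (u : R -> E) :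
  cont_on (fun t => 0 <= t) u -> forall t, continuous (fun s => u (Rabs s)) t.
Proof.
intros H t. apply continuous_eps. intros e He.
destruct (H (Rabs t) (Rabs_pos t) e He) as [d [Hd K]].
exists d. split; trivial. intros s Hs. apply K; [apply Rabs_pos|].
eapply Rle_lt_trans; [apply Rabs_triang_inv2|exact Hs].
Qed.

(** * Strongly continuous semigroups *)

Lemma generator_eps {E : CSpace} (T : R -> E -> E) (x y : E) :
  semigroup_generator T x y <-> forall eps, 0 < eps -> exists d, 0 < d /\
  forall h, 0 < h < d -> norm (minus (minus (T h x) x) (scal (RtoC h) y)) <= eps * h.
Proof.
unfold semigroup_generator.
assert (FF : Filter (at_right 0)) by apply at_right_proper_filter.
split; intros H.
- intros e He. pose proof (proj1 (filterlim_eps (at_right 0) _ y) H e He) as H'.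
  destruct (proj1 (locally_R_eps _ _) H') as [d [Hd K]]. exists d. split; trivial.
  intros h Hh. rewrite quotient_remainder by lra.
  via_le norm_scal_RtoC. rewrite Rabs_pos_eq by lra.
  rewrite Rmult_comm. apply Rmult_le_compat_r; [lra|]. left. apply K; [|lra].
  rewrite Rminus_0_r, Rabs_pos_eq; lra.
- apply (filterlim_eps (at_right 0)). intros e He.
  destruct (H (e / 2)) as [d [Hd K]]; [lra|]. apply locally_R_eps. exists d. split; trivial.
  intros h Hh Hh0. rewrite Rminus_0_r, Rabs_pos_eq in Hh by lra.
  rewrite quotient_remainder_inv by lra.
  via_lt norm_scal_RtoC.
  assert (0 < / h) by (now apply Rinv_0_lt_compat). rewrite Rabs_pos_eq by lra.
  eapply Rle_lt_trans; [apply Rmult_le_compat_l; [lra|apply K; lra]|].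
  replace (/ h * (e / 2 * h)) with (e / 2) by (field; lra). lra.
Qed.

Section Semigroup.

Context {E : CSpace} `{BE : Banach E} (T : R -> E -> E) (HT : C0_semigroup T).

Lemma semigroup_cont_on (x : E) : cont_on (fun t => 0 <= t) (fun t => T t x).
Proof. apply (proj2 (cont_on_iff _ _)). exact (c0_continuous T HT x). Qed.

(** Otherwise there are times [tn n <= / (INR n + 1)] at which the operator norm exceeds
    [INR n + 1]; strong continuity at [0] bounds every orbit along this sequence, which contradicts
    uniform boundedness. *)
Lemma semigroup_bounded_near_0 :
  exists d M, 0 < d /\ 1 <= M /\ forall t x, 0 <= t <= d -> norm (T t x) <= M * norm x.
Proof.
apply NNPP. intros HN.
assert (H : forall n : nat, exists t, 0 <= t <= / (INR n + 1) /\
  exists x, (INR n + 1) * norm x < norm (T t x)).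
{ intros n. apply NNPP. intros H. apply HN.
  pose proof (pos_INR n). exists (/ (INR n + 1)), (INR n + 1).
  split; [apply Rinv_0_lt_compat; lra|]. split; [lra|]. intros t x Ht.
  destruct (Rle_lt_dec (norm (T t x)) ((INR n + 1) * norm x)); trivial.
  exfalso. apply H. exists t. split; trivial. now exists x. }
destruct (choice _ H) as [tn Htn].
destruct (banach_steinhaus (fun n => T (tn n))) as [K HK].
- intros n. apply (c0_linear T HT), Htn.
- intros x. destruct (filterlim_bounded (fun n => T (tn n) x)) as [K HK]; [|now exists K].
  exists x. apply (filterlim_eps eventually). intros e He.
  destruct (semigroup_cont_on x 0 (Rle_refl 0) e He) as [d [Hd K]].
  destruct (INR_unbounded (/ d)) as [N HN']. exists N. intros n Hn.
  replace x with (T 0 x) at 2 by apply (c0_zero T HT).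
  destruct (Htn n) as [[H1 H2] _]. apply K; trivial. rewrite Rminus_0_r, Rabs_pos_eq by trivial.
  apply le_INR in Hn. pose proof (Rinv_0_lt_compat d Hd).
  apply Rle_lt_trans with (/ (INR n + 1)); trivial.
  rewrite <- (Rinv_inv d). apply Rinv_lt_contravar; [apply Rmult_lt_0_compat; lra|lra].
- destruct (INR_unbounded K) as [n Hn]. destruct (Htn n) as [_ [x Hx]].
  specialize (HK n x). pose proof (norm_ge_0 x). nra.
Qed.

(** Every step of length [d] costs a factor [M = exp (w * d)] with [w = ln M / d]; the prefactor [M]
    covers the last incomplete step. *)
Lemma semigroup_exp_bound : exists M w, 1 <= M /\ 0 <= w /\
  forall t x, 0 <= t -> norm (T t x) <= M * exp (w * t) * norm x.
Proof.
destruct semigroup_bounded_near_0 as [d [M [Hd [HM Hb]]]].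
assert (Hln : 0 <= ln M).
{ destruct (Req_dec M 1) as [->|]; [rewrite ln_1; lra|]. left. rewrite <- ln_1. apply ln_increasing; lra. }
assert (Hw : 0 <= ln M / d) by (apply Rdiv_le_0_compat; lra).
exists M, (ln M / d). split; trivial. split; trivial.
assert (H : forall (n : nat) t x, 0 <= t <= (INR n + 1) * d ->
  norm (T t x) <= M * exp (ln M / d * t) * norm x).
{ induction n as [|n IH]; intros t x Ht.
  - simpl in Ht. eapply Rle_trans; [apply Hb; lra|].
    apply Rmult_le_compat_r; [apply norm_ge_0|].
    assert (1 <= exp (ln M / d * t)).
    { pose proof (exp_ineq1_le (ln M / d * t)). assert (0 <= ln M / d * t) by (apply Rmult_le_pos; lra). lra. }
    nra.
  - rewrite S_INR in Ht. destruct (Rle_lt_dec t d) as [Htd|Htd].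
    + apply IH. pose proof (pos_INR n). nra.
    + replace t with (d + (t - d)) at 1 by ring. rewrite (c0_plus T HT) by lra.
      eapply Rle_trans; [apply Hb; lra|].
      eapply Rle_trans; [apply Rmult_le_compat_l; [lra|apply IH; lra]|].
      replace (ln M / d * t) with (ln M + ln M / d * (t - d)) by (field; lra).
      rewrite exp_plus, exp_ln by lra. right. ring. }
intros t x Ht. destruct (INR_unbounded (t / d)) as [n Hn]. apply (H n). split; trivial.
apply (Rmult_lt_compat_r d) in Hn; trivial. replace (t / d * d) with t in Hn by (field; lra). lra.
Qed.

Lemma semigroup_even_continuous (x : E) (t : R) : continuous (fun s => T (Rabs s) x) t.
Proof. apply (continuous_even_extension (fun s => T s x)), semigroup_cont_on. Qed.

Lemma semigroup_even_linear (t : R) : is_linear (T (Rabs t)).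
Proof. apply (c0_linear T HT), Rabs_pos. Qed.

Lemma semigroup_even_bounded (t : R) : locally_bounded (fun s => T (Rabs s)) t.
Proof.
destruct semigroup_exp_bound as [M [w [HM [Hw Hb]]]].
exists (M * exp (w * (Rabs t + 1))), 1. pose proof (exp_pos (w * (Rabs t + 1))).
split; [nra|]. split; [lra|]. intros s x Hs. eapply Rle_trans; [apply Hb, Rabs_pos|].
apply Rmult_le_compat_r; [apply norm_ge_0|]. apply Rmult_le_compat_l; [lra|].
pose proof (Rabs_triang_inv s t).
assert (Hle : w * Rabs s <= w * (Rabs t + 1)) by (apply Rmult_le_compat_l; lra).
destruct Hle as [Hlt| ->]; [left; now apply exp_increasing|lra].
Qed.

Lemma semigroup_even_apply (v : R -> E) (t : R) :
  continuous v t -> continuous (fun s => T (Rabs s) (v s)) t.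
Proof.
intros Hv. apply continuous_eps. intros e He.
destruct (family_continuous (fun s => T (Rabs s)) (fun _ => True) v t) with (eps := e) as [d [Hd K]]; trivial.
- intros s _. apply semigroup_even_linear.
- destruct (semigroup_even_bounded t) as [K [d [HK [Hd Hb]]]]. exists K, d. auto.
- intros e' He'. destruct (proj1 (continuous_eps _ t) (semigroup_even_continuous (v t) t) e' He') as [d [Hd K]].
  exists d. auto.
- intros e' He'. destruct (proj1 (continuous_eps _ t) Hv e' He') as [d [Hd K]]. exists d. auto.
- exists d. auto.
Qed.

Lemma generator_invariant (t : R) (x y : E) : 0 <= t ->
  semigroup_generator T x y -> semigroup_generator T (T t x) (T t y).
Proof.
intros Ht H. apply generator_eps. intros e He.
destruct (map_bound _ (c0_linear T HT t Ht)) as [M [HM KM]].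
destruct (proj1 (generator_eps T x y) H (e / M)) as [d [Hd K]]; [now apply Rdiv_lt_0_compat|].
exists d. split; trivial. intros h Hh. specialize (K h Hh).
rewrite <- (c0_plus T HT) by lra. rewrite Rplus_comm, (c0_plus T HT) by lra.
pose proof (c0_linear T HT t Ht) as L.
rewrite <- (map_scal _ L), <- !(map_minus _ L).
via_le KM. apply (Rmult_le_compat_l M) in K; [|lra].
replace (M * (e / M * h)) with (e * h) in K by (field; lra). exact K.
Qed.

(** The generator provides a right derivative at [0]. For [s < t] the semigroup law is used from [s]
    upwards with an operator bound uniform near [t], and strong continuity replaces [T s y] by
    [T t y]; this gives the left derivative. *)
Lemma semigroup_hasd (t : R) (x y : E) : 0 < t ->
  semigroup_generator T x y -> hasd (fun s => T (Rabs s) x) t (T t y).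
Proof.
intros Ht H. pose proof (proj1 (generator_eps T x y) H) as HG. intros e He.
destruct (semigroup_even_bounded t) as [M [d0 [HM [Hd0 HB]]]].
destruct (HG (e / 2 / M)) as [d1 [Hd1 K1]]; [apply Rdiv_lt_0_compat; lra|].
destruct (proj1 (continuous_eps _ t) (semigroup_even_continuous y t) (e / 2)) as [d2 [Hd2 K2]]; [lra|].
set (d := Rmin (Rmin t d0) (Rmin d1 d2)). exists d.
split; [unfold d; repeat apply Rmin_pos; trivial|]. intros s Hs.
pose proof (Rmin_l (Rmin t d0) (Rmin d1 d2)) as A1. pose proof (Rmin_r (Rmin t d0) (Rmin d1 d2)) as A2.
fold d in A1, A2. rmins.
assert (Hs0 : 0 < s).
{ destruct (Rle_lt_dec s 0); trivial. rewrite Rabs_left1 in Hs by lra. lra. }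
rewrite !(Rabs_pos_eq s), !(Rabs_pos_eq t) by lra.
assert (Hstep : forall r h, 0 <= r -> 0 < h -> h < d1 -> Rabs (r - t) < d0 ->
  norm (minus (minus (T (r + h) x) (T r x)) (scal (RtoC h) (T r y))) <= e / 2 * h).
{ intros r h Hr Hh Hh' Hrt. pose proof (c0_linear T HT r Hr) as L.
  rewrite (c0_plus T HT) by lra. rewrite <- (map_scal _ L), <- !(map_minus _ L).
  specialize (HB r (minus (minus (T h x) x) (scal (RtoC h) y)) Hrt).
  rewrite (Rabs_pos_eq r) in HB by lra. specialize (K1 h (conj Hh Hh')).
  apply (Rmult_le_compat_l M) in K1; [|lra].
  replace (M * (e / 2 / M * h)) with (e / 2 * h) in K1 by (field; lra). lra. }
destruct (Rtotal_order s t) as [Hlt|[->|Hgt]].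
- rewrite Rabs_left in * by lra.
  specialize (Hstep s (t - s) ltac:(lra) ltac:(lra) ltac:(lra)).
  replace (s + (t - s)) with t in Hstep by ring.
  specialize (Hstep ltac:(rewrite Rabs_left; lra)).
  specialize (K2 s ltac:(rewrite Rabs_left; lra)).
  rewrite (Rabs_pos_eq s), (Rabs_pos_eq t) in K2 by lra.
  norm_as E (opp (plus (minus (minus (T t x) (T s x)) (scal (RtoC (t - s)) (T s y)))
    (scal (RtoC (t - s)) (minus (T s y) (T t y))))).
  2:{ rewrite !RtoC_minus. ring. }
  rewrite norm_opp. via_le norm_triangle.
  pose proof (norm_scal_RtoC (t - s) (minus (T s y) (T t y))) as A3.
  rewrite Rabs_pos_eq in A3 by lra. nra.
- rewrite Rminus_diag, Rabs_R0. norm_as E (zero : E). rewrite norm_zero. lra.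
- rewrite (Rabs_pos_eq (s - t)) in * by lra.
  specialize (Hstep t (s - t) ltac:(lra) ltac:(lra) ltac:(lra)).
  rewrite Rminus_diag, Rabs_R0 in Hstep. specialize (Hstep Hd0).
  replace (t + (s - t)) with s in Hstep by ring. nra.
Qed.

(** The averages [/ h * P h] of the orbit tend to [x], and they lie in the domain because shifting
    the integral over [[0, h]] by [r] changes it only near the two endpoints. *)
Lemma generator_dense (x : E) (eps : R) : 0 < eps ->
  exists x' y', semigroup_generator T x' y' /\ norm (minus x' x) < eps.
Proof.
intros He.
set (P := prim (fun s => T (Rabs s) x)).
assert (HP : forall t, hasd P t (T (Rabs t) x)).
{ intros t. apply (prim_hasd (fun s => T (Rabs s) x)). intros s. apply semigroup_even_continuous. }
assert (P0 : P 0 = zero) by (apply prim_0; intros s; apply semigroup_even_continuous).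
assert (T0 : T (Rabs 0) x = x) by (rewrite Rabs_R0; apply (c0_zero T HT)).
assert (HG : forall h, 0 <= h -> semigroup_generator T (P h) (minus (T h x) x)).
{ intros h Hh. apply generator_eps. intros e Hep.
  assert (Hshift : forall r, 0 <= r -> T r (P h) = minus (P (r + h)) (P r)).
  { intros r Hr. unfold P at 1.
    rewrite (prim_linear (T r)); [|trivial|now apply (c0_linear T HT)|intros s; apply semigroup_even_continuous].
    rewrite (prim_eq (fun s => P (s + r))).
    - rewrite Rplus_0_l, (Rplus_comm h). trivial.
    - trivial.
    - intros s. apply (continuous_comp (fun s => T (Rabs s) x) (T r)); [apply semigroup_even_continuous|].
      apply (linear_cont (V := E)). now apply (c0_linear T HT).
    - apply continuous_cont_on. intros s _. apply (hasd_continuous _ s (T (Rabs (s + r)) x)).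
      apply (hasd_shift P), HP.
    - intros s Hs. apply (hasd_shift P). replace (T r (T (Rabs s) x)) with (T (Rabs (s + r)) x); [apply HP|].
      rewrite !Rabs_pos_eq by lra. rewrite Rplus_comm. apply (c0_plus T HT); lra. }
  destruct (HP h (e / 2)) as [d1 [Hd1 K1]]; [lra|].
  destruct (HP 0 (e / 2)) as [d2 [Hd2 K2]]; [lra|].
  exists (Rmin d1 d2). split; [now apply Rmin_pos|]. intros r Hr.
  rmins.
  rewrite Hshift by lra.
  specialize (K1 (h + r)). replace (h + r - h) with r in K1 by ring.
  specialize (K2 r). rewrite Rminus_0_r in K2. rewrite Rabs_pos_eq in K1, K2 by lra.
  specialize (K1 ltac:(lra)). specialize (K2 ltac:(lra)).
  rewrite T0, P0 in K2. rewrite (Rabs_pos_eq h), (Rplus_comm h) in K1 by lra.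
  norm_as E (minus (minus (minus (P (r + h)) (P h)) (scal (RtoC r) (T h x)))
    (minus (minus (P r) (zero : E)) (scal (RtoC r) x))).
  via_le norm_minus_le. lra. }
destruct (HP 0 (eps / 2)) as [d [Hd K]]; [lra|].
set (h := d / 2). assert (Hh : 0 < h) by (unfold h; lra).
exists (scal (RtoC (/ h)) (P h)), (scal (RtoC (/ h)) (minus (T h x) x)). split.
- pose proof (proj1 (generator_eps _ _ _) (HG h ltac:(lra))) as HG'.
  apply generator_eps. intros e Hep.
  destruct (HG' (e * h)) as [d' [Hd' K']]; [nra|]. exists d'. split; trivial.
  intros r Hr. specialize (K' r Hr).
  rewrite (map_scal _ (c0_linear T HT r ltac:(lra))).
  norm_as E (scal (RtoC (/ h)) (minus (minus (T r (P h)) (P h)) (scal (RtoC r) (minus (T h x) x)))).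
  via_le norm_scal_RtoC.
  assert (0 < / h) by (now apply Rinv_0_lt_compat). rewrite Rabs_pos_eq by lra.
  apply (Rmult_le_compat_l (/ h)) in K'; [|lra].
  replace (/ h * (e * h * r)) with (e * r) in K' by (field; lra). exact K'.
- specialize (K h). rewrite Rminus_0_r, Rabs_pos_eq in K by lra. specialize (K ltac:(unfold h; lra)).
  rewrite T0, P0 in K.
  norm_as E (scal (RtoC (/ h)) (minus (minus (P h) (zero : E)) (scal (RtoC h) x))).
  2: rewrite RtoC_inv by lra; field; intros Hc; apply RtoC_inj in Hc; lra.
  via_lt norm_scal_RtoC.
  assert (0 < / h) by (now apply Rinv_0_lt_compat). rewrite Rabs_pos_eq by lra.
  apply (Rmult_le_compat_l (/ h)) in K; [|lra].
  replace (/ h * (eps / 2 * h)) with (eps / 2) in K by (field; lra). lra.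
Qed.

End Semigroup.

(** * Bounded perturbation of semigroups *)

Section PrimitiveComparison.

Context {E : CSpace} `{BE : Banach E}.

Lemma prim_diff_bound (f g : R -> E) (c c' : R -> R) (t : R) : 0 <= t ->
  (forall s, continuous f s) -> (forall s, continuous g s) ->
  (forall s, 0 <= s <= t -> is_derive c s (c' s)) ->
  (forall s, 0 < s < t -> norm (minus (f s) (g s)) <= c' s) ->
  norm (minus (prim f t) (prim g t)) <= c t - c 0.
Proof.
intros Ht Hf Hg Hc H.
replace (minus (prim f t) (prim g t)) with
  (minus (plus (prim f t) (scal (Copp (RtoC 1)) (prim g t)))
         (plus (prim f 0) (scal (Copp (RtoC 1)) (prim g 0)))).
2:{ rewrite !prim_0 by trivial. lin E. }
assert (HD : forall s, hasd (fun s => plus (prim f s) (scal (Copp (RtoC 1)) (prim g s))) s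
  (plus (f s) (scal (Copp (RtoC 1)) (g s)))).
{ intros s. apply hasd_plus; [now apply prim_hasd|].
  apply (hasd_linear (fun x : E => scal (Copp (RtoC 1)) x)); [apply is_linear_scal_C|now apply prim_hasd]. }
apply (mean_value_ineq (fun s => plus (prim f s) (scal (Copp (RtoC 1)) (prim g s)))
  (fun s => plus (f s) (scal (Copp (RtoC 1)) (g s))) c c'); trivial.
- apply continuous_cont_on. intros s _. eapply hasd_continuous, HD.
- intros s Hs. norm_as E (minus (f s) (g s)). now apply H.
Qed.

Lemma prim_const (x : E) (t : R) : 0 <= t -> prim (fun _ => x) t = scal (RtoC t) x.
Proof.
assert (HD : forall s, hasd (fun s => scal (RtoC s) x) s x).
{ intros s e He. exists 1. split; [lra|]. intros r _.
  norm_as E (zero : E). 2:{ rewrite RtoC_minus. ring. }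
  rewrite norm_zero. apply Rmult_le_pos; [lra|apply Rabs_pos]. }
intros Ht. rewrite (prim_eq (fun s => scal (RtoC s) x)); trivial.
- lin E.
- intros s. apply continuous_const.
- apply continuous_cont_on. intros s _. eapply hasd_continuous, HD.
Qed.

End PrimitiveComparison.

Section Perturbation.

Context {E : CSpace} `{BE : Banach E} (T : R -> E -> E) (HT : C0_semigroup T).
Context (B : E -> E) (HB : is_linear B).

(** The variation of constants term, with the integration variable placed on the semigroup instead
    of on [u]: inside the integrand only the argument of [u] then depends on [t]. *)
Definition duhamel (u : R -> E) (t : R) : E :=
  prim (fun s => T (Rabs s) (B (u (t - s)))) t.

Lemma duhamel_integrand_continuous (u : R -> E) (t : R) : (forall s, continuous u s) ->
  forall s, continuous (fun s => T (Rabs s) (B (u (t - s)))) s.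
Proof.
intros Hu s. apply (semigroup_even_apply T HT (fun s => B (u (t - s)))).
apply (continuous_comp (fun s => u (t - s)) B); [|now apply (linear_cont (V := E))].
apply (continuous_comp (fun s : R => t - s) u); [|apply Hu].
apply (continuous_minus (V := R_NormedModule)); [apply continuous_const|apply continuous_id].
Qed.

Lemma duhamel_plus (u v : R -> E) (t : R) : 0 <= t ->
  (forall s, continuous u s) -> (forall s, continuous v s) ->
  duhamel (fun s => plus (u s) (v s)) t = plus (duhamel u t) (duhamel v t).
Proof.
intros Ht Hu Hv. unfold duhamel.
rewrite <- prim_plus; [|trivial|now apply duhamel_integrand_continuous|now apply duhamel_integrand_continuous].
f_equal. apply functional_extensionality. intros s.
now rewrite (map_plus _ HB), (map_plus _ (semigroup_even_linear T HT s)).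
Qed.

Lemma duhamel_scal (c : C) (u : R -> E) (t : R) : 0 <= t ->
  (forall s, continuous u s) -> duhamel (fun s => scal c (u s)) t = scal c (duhamel u t).
Proof.
intros Ht Hu. unfold duhamel.
rewrite (prim_linear (fun x : E => scal c x)); trivial;
  [|apply is_linear_scal_C|now apply duhamel_integrand_continuous].
f_equal. apply functional_extensionality. intros s.
now rewrite (map_scal _ HB), (map_scal _ (semigroup_even_linear T HT s)).
Qed.

Context (M w b : R) (HM : 1 <= M) (Hw : 0 <= w) (Hb : 0 < b)
  (HTb : forall t x, 0 <= t -> norm (T t x) <= M * exp (w * t) * norm x)
  (HBb : forall x, norm (B x) <= b * norm x).

(** With this weight [duhamel] contracts [sup (exp (- lam t) * norm (u t))] by [1/2]. *)
Let lam := w + 2 * M * b.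

Lemma exp_w_le_exp_lam (s : R) : 0 <= s -> exp (w * s) <= exp (lam * s).
Proof.
intros Hs. assert (H0 : 0 <= M * b) by nra.
assert (H : w * s <= lam * s) by (apply Rmult_le_compat_r; unfold lam; lra).
destruct H as [H| ->]; [left; now apply exp_increasing|lra].
Qed.

(** Since [lam - w = 2 * M * b], the integrands differ by at most [M * b * K * exp (lam * t) * exp
    (- (2 * M * b) * s)], and integrating this gives the factor [1 / 2]. *)
Lemma duhamel_diff_bound (u v : R -> E) (K t : R) : 0 <= t -> 0 <= K ->
  (forall s, continuous u s) -> (forall s, continuous v s) ->
  (forall s, 0 <= s -> norm (minus (u s) (v s)) <= K * exp (lam * s)) ->
  norm (minus (duhamel u t) (duhamel v t)) <= K / 2 * exp (lam * t).
Proof.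
intros Ht HK Hu Hv H.
assert (HMb : 0 < 2 * M * b) by nra.
apply Rle_trans with (- (K / 2) * exp (lam * t) * exp (- (2 * M * b) * t)
  - - (K / 2) * exp (lam * t) * exp (- (2 * M * b) * 0)).
- apply (prim_diff_bound (fun s => T (Rabs s) (B (u (t - s)))) (fun s => T (Rabs s) (B (v (t - s))))
    (fun s => - (K / 2) * exp (lam * t) * exp (- (2 * M * b) * s))
    (fun s => M * b * K * exp (lam * t) * exp (- (2 * M * b) * s)) t Ht).
  + now apply duhamel_integrand_continuous.
  + now apply duhamel_integrand_continuous.
  + intros s _. auto_derive; trivial. field.
  + intros s Hs. rewrite <- (map_minus _ (semigroup_even_linear T HT s)), <- (map_minus _ HB).
    rewrite Rabs_pos_eq by lra.
    eapply Rle_trans; [apply HTb; lra|].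
    pose proof (exp_pos (w * s)).
    apply Rle_trans with (M * exp (w * s) * (b * (K * exp (lam * (t - s))))).
    * apply Rmult_le_compat_l; [nra|]. via_le HBb.
      apply Rmult_le_compat_l; [lra|]. apply H. lra.
    * right. replace (- (2 * M * b) * s) with (w * s + - lam * s) by (unfold lam; ring).
      replace (lam * (t - s)) with (lam * t + - lam * s) by ring. rewrite !exp_plus. ring.
- rewrite Rmult_0_r, exp_0. pose proof (exp_pos (lam * t)). pose proof (exp_pos (- (2 * M * b) * t)).
  assert (0 <= K / 2 * exp (lam * t)) by nra. nra.
Qed.

Lemma duhamel_0 (u : R -> E) : (forall s, continuous u s) -> duhamel u 0 = zero.
Proof. intros Hu. unfold duhamel. exact (prim_0 _ (duhamel_integrand_continuous u 0 Hu)). Qed.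

(** Moving the upper limit costs a bounded integrand times [Rabs (s - t)]; moving the parameter
    inside [u] is handled by uniform continuity of [u] on a compact interval. *)
Lemma duhamel_continuous (u : R -> E) : (forall s, continuous u s) ->
  cont_on (fun t => 0 <= t) (duhamel u).
Proof.
intros Hu t Ht e He. set (a := t + 1).
destruct (bounded_continuity u (- a) a) as [U HU].
{ intros s _. apply Hu. }
assert (HU0 : 0 <= U).
{ pose proof (HU 0 ltac:(unfold a; lra)). pose proof (norm_ge_0 (u 0)). lra. }
set (L := M * exp (w * a) * b).
assert (HL : 0 < L) by (unfold L; pose proof (exp_pos (w * a)); repeat apply Rmult_lt_0_compat; lra).
assert (HTB : forall s x, 0 <= s <= a -> norm (T (Rabs s) (B x)) <= L * norm x).
{ intros s x Hs. rewrite Rabs_pos_eq by lra. eapply Rle_trans; [apply HTb; lra|].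
  unfold L. rewrite (Rmult_assoc _ b). pose proof (exp_pos (w * s)).
  assert (exp (w * s) <= exp (w * a)).
  { destruct (Req_dec (w * s) (w * a)) as [->|]; [lra|]. left; apply exp_increasing. nra. }
  apply Rmult_le_compat; [nra|apply norm_ge_0|nra|apply HBb]. }
destruct (unifcont_normed_1d u (- a) a (fun s _ => Hu s) (mkposreal (e / 2 / (L * (a + 1)))
  ltac:(apply Rdiv_lt_0_compat; [lra|]; apply Rmult_lt_0_compat; unfold a in *; lra))) as [d1 Hd1].
set (d2 := e / 2 / (L * (U + 1))).
assert (Hd2 : 0 < d2) by (apply Rdiv_lt_0_compat; [lra|]; nra).
exists (Rmin 1 (Rmin d1 d2)). split; [repeat apply Rmin_pos; [lra|apply cond_pos|trivial]|].
intros s Hs Hst.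
rmins.
assert (Hsa : 0 <= s <= a).
{ assert (H' : Rabs (s - t) < 1) by lra. apply Rabs_def2 in H'. unfold a. lra. }
set (f := fun p r => T (Rabs r) (B (u (p - r)))).
assert (Hf : forall p r, continuous (f p) r) by (intros p r; now apply duhamel_integrand_continuous).
assert (N1 : forall p q1 q2, 0 <= q1 <= q2 -> q2 <= a -> 0 <= p <= a ->
  norm (minus (prim (f p) q2) (prim (f p) q1)) <= L * U * (q2 - q1)).
{ intros p q1 q2 Hq Hq2 Hp.
  apply (mean_value_const (prim (f p)) (f p) (L * U)); [lra| | |].
  - apply continuous_cont_on. intros r _. now apply prim_continuous.
  - intros r _. now apply prim_hasd.
  - intros r Hr. eapply Rle_trans; [apply HTB; lra|]. apply Rmult_le_compat_l; [lra|].
    left. apply HU. lra. }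
assert (N2 : norm (minus (prim (f s) s) (prim (f s) t)) <= L * U * Rabs (s - t)).
{ destruct (Rle_lt_dec s t).
  - rewrite norm_minus_sym, Rabs_minus_sym, Rabs_pos_eq by lra. apply N1; unfold a in *; lra.
  - rewrite Rabs_pos_eq by lra. apply N1; unfold a in *; lra. }
assert (N3 : norm (minus (prim (f s) t) (prim (f t) t)) <=
  L * (e / 2 / (L * (a + 1))) * t - L * (e / 2 / (L * (a + 1))) * 0).
{ apply (prim_diff_bound (f s) (f t) (fun r => L * (e / 2 / (L * (a + 1))) * r)
    (fun _ => L * (e / 2 / (L * (a + 1)))) t Ht (Hf s) (Hf t)).
  - intros r _. auto_derive; trivial. ring.
  - intros r Hr. unfold f.
    rewrite <- (map_minus _ (semigroup_even_linear T HT r)), <- (map_minus _ HB).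
    eapply Rle_trans; [apply HTB; unfold a; lra|]. apply Rmult_le_compat_l; [lra|]. left.
    apply (Hd1 (t - r) (s - r)); [unfold a; lra|unfold a in *; lra|].
    change (Rabs (minus (s - r) (t - r)) < d1). unfold minus, plus, opp; simpl.
    replace (s - r + - (t - r)) with (s - t) by ring. lra. }
change (norm (minus (prim (f s) s) (prim (f t) t)) < e).
via_lt (norm_minus_triangle _ (prim (f s) t)).
assert (N4 : L * (e / 2 / (L * (a + 1))) * t - L * (e / 2 / (L * (a + 1))) * 0 < e / 2).
{ replace (L * (e / 2 / (L * (a + 1))) * t - L * (e / 2 / (L * (a + 1))) * 0)
    with (e / 2 * (t / (a + 1))) by (field; unfold a; lra).
  assert (t / (a + 1) < 1). { apply Rmult_lt_reg_r with (a + 1); [unfold a; lra|].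
    unfold Rdiv. rewrite Rmult_assoc, Rinv_l by (unfold a; lra). unfold a; lra. }
  nra. }
assert (N5 : L * U * Rabs (s - t) <= e / 2).
{ apply Rle_trans with (L * (U + 1) * d2).
  - apply Rmult_le_compat; [nra|apply Rabs_pos|nra|lra].
  - right. unfold d2. field. lra. }
lra.
Qed.

(** The growth bound belongs to the definition because it selects the weighted space in which
    [duhamel] is a contraction; uniqueness is proved in that class. *)
Definition mild_solution (x : E) (u : R -> E) : Prop :=
  (forall t, continuous u t) /\
  (exists K, 0 <= K /\ forall t, 0 <= t -> norm (u t) <= K * exp (lam * t)) /\
  (forall t, 0 <= t -> u t = plus (T t x) (duhamel u t)).

Lemma mild_solution_unique (x : E) (u v : R -> E) :
  mild_solution x u -> mild_solution x v -> forall t, 0 <= t -> u t = v t.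
Proof.
intros [Hu [[K [HK Ku]] Eu]] [Hv [[K' [HK' Kv]] Ev]] t Ht.
assert (H : forall n t, 0 <= t -> norm (minus (u t) (v t)) <= (K + K') * (/ 2) ^ n * exp (lam * t)).
{ induction n as [|n IH]; intros s Hs.
  - simpl. via_le norm_minus_le. specialize (Ku s Hs). specialize (Kv s Hs). lra.
  - rewrite Eu, Ev by trivial. norm_as E (minus (duhamel u s) (duhamel v s)).
    eapply Rle_trans; [apply (duhamel_diff_bound u v ((K + K') * (/ 2) ^ n)); trivial|].
    + apply Rmult_le_pos; [lra|apply pow_le; lra].
    + right. simpl. field. }
apply eq_of_norm_minus. intros e He.
destruct (pow_lt_1_zero (/ 2) ltac:(rewrite Rabs_pos_eq; lra) (e / ((K + K' + 1) * exp (lam * t)))) as [N HN].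
{ pose proof (exp_pos (lam * t)). apply Rdiv_lt_0_compat; nra. }
specialize (HN N (Nat.le_refl N)). rewrite Rabs_pos_eq in HN by (apply pow_le; lra).
via_le (H N t Ht). pose proof (exp_pos (lam * t)).
assert (0 <= (/ 2) ^ N) by (apply pow_le; lra).
apply (Rmult_lt_compat_l ((K + K' + 1) * exp (lam * t))) in HN; [|nra].
replace ((K + K' + 1) * exp (lam * t) * (e / ((K + K' + 1) * exp (lam * t)))) with e in HN
  by (field; split; lra).
nra.
Qed.

Fixpoint picard (x : E) (n : nat) : R -> E :=
  match n with
  | O => fun t => T (Rabs t) x
  | S n => fun t => plus (T (Rabs t) x) (duhamel (picard x n) (Rabs t))
  end.

Lemma picard_continuous (x : E) (n : nat) : forall t, continuous (picard x n) t.
Proof.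
induction n as [|n IH]; intros t; simpl.
- apply (semigroup_even_continuous T HT).
- apply (continuous_plus (V := E)).
  + apply (semigroup_even_continuous T HT).
  + now apply (continuous_even_extension (duhamel (picard x n))), duhamel_continuous.
Qed.

Lemma picard_step (x : E) (n : nat) (t : R) :
  norm (minus (picard x (S n) t) (picard x n t)) <= M * norm x * (/ 2) ^ (S n) * exp (lam * Rabs t).
Proof.
assert (HMx : 0 <= M * norm x) by (pose proof (norm_ge_0 x); nra).
revert t; induction n as [|n IH]; intros t.
- change (picard x 1 t) with (plus (T (Rabs t) x) (duhamel (picard x 0) (Rabs t))).
  change (picard x 0 t) with (T (Rabs t) x).
  norm_as E (minus (duhamel (picard x 0) (Rabs t)) (zero : E)).
  replace (zero : E) with (duhamel (fun _ : R => zero) (Rabs t)).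
  + via_le (duhamel_diff_bound (picard x 0) (fun _ => zero) (M * norm x)).
    * apply Rabs_pos.
    * trivial.
    * apply picard_continuous.
    * intros s; apply continuous_const.
    * intros s Hs. simpl. norm_as E (T (Rabs s) x). eapply Rle_trans; [apply HTb, Rabs_pos|].
      rewrite Rabs_pos_eq by trivial.
      pose proof (exp_w_le_exp_lam s Hs).
      pose proof (norm_ge_0 x). apply Rle_trans with (M * exp (lam * s) * norm x); [|right; ring].
      apply Rmult_le_compat_r; nra.
    * right. simpl. field.
  + pose proof (duhamel_scal (RtoC 0) (fun _ => (zero : E)) (Rabs t) (Rabs_pos t)
      (fun s => continuous_const (zero : E) s)) as Hz.
    rewrite scal_C0 in Hz. refine (eq_trans _ Hz). f_equal.
    apply functional_extensionality. intros s. symmetry; apply scal_C0.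
- change (picard x (S (S n)) t) with (plus (T (Rabs t) x) (duhamel (picard x (S n)) (Rabs t))).
  change (picard x (S n) t) with (plus (T (Rabs t) x) (duhamel (picard x n) (Rabs t))).
  norm_as E (minus (duhamel (picard x (S n)) (Rabs t)) (duhamel (picard x n) (Rabs t))).
  via_le (duhamel_diff_bound _ _ (M * norm x * (/ 2) ^ S n)).
  + apply Rabs_pos.
  + apply Rmult_le_pos; trivial. apply pow_le; lra.
  + apply picard_continuous.
  + apply picard_continuous.
  + intros s Hs. rewrite <- (Rabs_pos_eq s Hs) at 3. apply IH.
  + right. simpl. field.
Qed.

Lemma geometric_limit {F : CSpace} `{BF : Banach F} (u : nat -> F) (c : R) : 0 <= c ->
  (forall n, norm (minus (u (S n)) (u n)) <= c * (/ 2) ^ (S n)) ->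
  exists y, forall n, norm (minus y (u n)) <= c * (/ 2) ^ n.
Proof.
intros Hc H.
assert (Hp : forall n, 0 < (/ 2) ^ n) by (intros n; apply pow_lt; lra).
(* [nested_balls_limit] asks for positive radii, hence [c + 1]; the constant [c] itself is recovered
   afterwards by comparing with a far index. *)
destruct (nested_balls_limit u (fun n => (c + 1) * (/ 2) ^ n)) as [y Hy].
- intros k. pose proof (Hp k). nra.
- intros k. simpl. right. field.
- intros k. via_le H. pose proof (Hp k). simpl. nra.
- exists y. intros n. apply le_epsilon. intros e He.
  assert (Hm : forall m, norm (minus (u (n + m)%nat) (u n)) <= c * (/ 2) ^ n - c * (/ 2) ^ (n + m)).
  { induction m as [|m IH].
    - rewrite Nat.add_0_r. norm_as F (zero : F). rewrite norm_zero. lra.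
    - rewrite Nat.add_succ_r. pose proof (H (n + m)%nat) as H1. simpl in H1. simpl.
      pose proof (norm_minus_triangle (u (S (n + m))) (u (n + m)%nat) (u n)). lra. }
  destruct (pow_lt_1_zero (/ 2) ltac:(rewrite Rabs_pos_eq; lra) (e / (c + 1))) as [N HN].
  { apply Rdiv_lt_0_compat; lra. }
  specialize (HN (n + N)%nat ltac:(lia)). rewrite Rabs_pos_eq in HN by (apply pow_le; lra).
  apply (Rmult_lt_compat_l (c + 1)) in HN; [|lra].
  replace ((c + 1) * (e / (c + 1))) with e in HN by (field; lra).
  pose proof (Hy (n + N)%nat). pose proof (Hm N). pose proof (Hp (n + N)%nat).
  pose proof (norm_minus_triangle y (u (n + N)%nat) (u n)). nra.
Qed.

(** Limit of the Picard iterates: their geometric error bound is uniform on bounded times, which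
    gives continuity, and [duhamel_diff_bound] passes to the limit in the integral equation. The
    factor [2] adds the norm of [T t x] and its distance to [u t]. *)
Lemma mild_solution_exists (x : E) :
  exists u, mild_solution x u /\ forall t, 0 <= t -> norm (u t) <= 2 * M * norm x * exp (lam * t).
Proof.
assert (HMx : 0 <= M * norm x) by (pose proof (norm_ge_0 x); nra).
assert (H : forall t, exists y, forall n, norm (minus y (picard x n t)) <=
  M * norm x * exp (lam * Rabs t) * (/ 2) ^ n).
{ intros t. apply (geometric_limit (fun n => picard x n t)).
  - pose proof (exp_pos (lam * Rabs t)). nra.
  - intros n. via_le picard_step. right; ring. }
destruct (choice _ H) as [u Hu].
assert (Hlam : 0 <= lam) by (unfold lam; assert (0 <= M * b) by nra; nra).
assert (Hcont : forall t, continuous u t).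
{ intros t. apply continuous_eps. intros e He.
  set (c := M * norm x * exp (lam * (Rabs t + 1))).
  assert (Hc : 0 <= c) by (unfold c; pose proof (exp_pos (lam * (Rabs t + 1))); nra).
  destruct (pow_lt_1_zero (/ 2) ltac:(rewrite Rabs_pos_eq; lra) (e / 3 / (c + 1))) as [N HN].
  { apply Rdiv_lt_0_compat; lra. }
  specialize (HN N (Nat.le_refl N)). rewrite Rabs_pos_eq in HN by (apply pow_le; lra).
  apply (Rmult_lt_compat_l (c + 1)) in HN; [|lra].
  replace ((c + 1) * (e / 3 / (c + 1))) with (e / 3) in HN by (field; lra).
  assert (Hp : 0 < (/ 2) ^ N) by (apply pow_lt; lra).
  destruct (proj1 (continuous_eps _ t) (picard_continuous x N t) (e / 3)) as [d [Hd K]]; [lra|].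
  assert (Hun : forall s, Rabs (s - t) < 1 -> norm (minus (u s) (picard x N s)) < e / 3).
  { intros s Hs. via_lt Hu. apply Rle_lt_trans with (c * (/ 2) ^ N); [|nra].
    apply Rmult_le_compat_r; [lra|]. apply Rmult_le_compat_l; trivial.
    pose proof (Rabs_triang_inv s t).
    assert (Hle : lam * Rabs s <= lam * (Rabs t + 1)) by (apply Rmult_le_compat_l; lra).
    destruct Hle as [Hlt| ->]; [left; now apply exp_increasing|lra]. }
  exists (Rmin d 1). split; [apply Rmin_pos; lra|]. intros s Hs.
  rmins.
  specialize (K s ltac:(lra)). pose proof (Hun s ltac:(lra)) as U1.
  pose proof (Hun t ltac:(rewrite Rminus_diag, Rabs_R0; lra)) as U2.
  rewrite norm_minus_sym in U2.
  pose proof (norm_minus_triangle (u s) (picard x N s) (u t)).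
  pose proof (norm_minus_triangle (picard x N s) (picard x N t) (u t)). lra. }
assert (Hbound : forall t, 0 <= t -> norm (u t) <= 2 * M * norm x * exp (lam * t)).
{ intros t Ht. pose proof (Hu t 0%nat) as H0. simpl in H0. rewrite Rabs_pos_eq in H0 by trivial.
  pose proof (HTb t x Ht) as H1.
  pose proof (norm_le_minus (u t) (T t x)) as H2.
  pose proof (exp_w_le_exp_lam t Ht).
  assert (M * norm x * exp (w * t) <= M * norm x * exp (lam * t)) by (apply Rmult_le_compat_l; trivial).
  lra. }
exists u. split; trivial. split; trivial. split.
{ exists (2 * M * norm x). split; [lra|trivial]. }
intros t Ht. apply eq_of_norm_minus. intros e He.
set (c := M * norm x * exp (lam * t)).
assert (Hc : 0 <= c) by (unfold c; pose proof (exp_pos (lam * t)); nra).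
destruct (pow_lt_1_zero (/ 2) ltac:(rewrite Rabs_pos_eq; lra) (e / 2 / (c + 1))) as [N HN].
{ apply Rdiv_lt_0_compat; lra. }
specialize (HN N (Nat.le_refl N)). rewrite Rabs_pos_eq in HN by (apply pow_le; lra).
apply (Rmult_lt_compat_l (c + 1)) in HN; [|lra].
replace ((c + 1) * (e / 2 / (c + 1))) with (e / 2) in HN by (field; lra).
assert (Hp : 0 < (/ 2) ^ N) by (apply pow_lt; lra).
assert (H1 : norm (minus (u t) (picard x (S N) t)) <= c * (/ 2) ^ N).
{ via_le Hu. rewrite (Rabs_pos_eq t) by trivial. simpl. fold c. nra. }
assert (H2 : norm (minus (duhamel (picard x N) t) (duhamel u t)) <= c * (/ 2) ^ N).
{ eapply Rle_trans; [apply (duhamel_diff_bound _ _ (M * norm x * (/ 2) ^ N)); trivial|].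
  - apply Rmult_le_pos; lra.
  - apply picard_continuous.
  - intros s Hs. rewrite norm_minus_sym. via_le Hu.
    rewrite Rabs_pos_eq by trivial. right; ring.
  - assert (0 <= c * (/ 2) ^ N) by (apply Rmult_le_pos; lra). unfold c in *. lra. }
change (picard x (S N) t) with (plus (T (Rabs t) x) (duhamel (picard x N) (Rabs t))) in H1.
rewrite Rabs_pos_eq in H1 by trivial.
norm_as E (plus (minus (u t) (plus (T t x) (duhamel (picard x N) t)))
  (minus (duhamel (picard x N) t) (duhamel u t))).
via_le norm_triangle. nra.
Qed.

(** The integral in the equation at time [t + r] is split at [t]; the part over [[t, t + r]] is
    [T t] applied to the integral for time [r]. Together with uniqueness this yields the semigroup
    law. *)
Lemma mild_solution_shift (x : E) (u : R -> E) (r : R) : 0 <= r ->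
  mild_solution x u -> mild_solution (u r) (fun t => u (Rabs t + r)).
Proof.
intros Hr [Hu [[K [HK Ku]] Eu]].
assert (Hc : forall t, continuous (fun t => u (Rabs t + r)) t).
{ intros t. apply (continuous_comp (fun t : R => Rabs t + r) u); [|apply Hu].
  apply (continuous_plus (V := R_NormedModule)); [apply continuous_Rabs|apply continuous_const]. }
split; trivial. split.
{ exists (K * exp (lam * r)). pose proof (exp_pos (lam * r)). split; [nra|]. intros t Ht.
  rewrite Rabs_pos_eq by trivial. eapply Rle_trans; [apply Ku; lra|].
  rewrite Rmult_plus_distr_l, exp_plus. right; ring. }
intros t Ht. rewrite Rabs_pos_eq by trivial. rewrite (Eu (t + r)), (Eu r) by lra.
assert (L : is_linear (T t)) by now apply (c0_linear T HT).
rewrite (map_plus _ L), (c0_plus T HT) by trivial.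
rewrite <- plus_assoc. f_equal. unfold duhamel.
set (f := fun s => T (Rabs s) (B (u (t + r - s)))).
assert (Hf : forall s, continuous f s) by now apply duhamel_integrand_continuous.
set (g := fun s => T (Rabs s) (B (u (r - s)))).
assert (Hg : forall s, continuous g s) by now apply duhamel_integrand_continuous.
rewrite (prim_ext (fun s => T (Rabs s) (B (u (Rabs (t - s) + r)))) f); trivial.
- rewrite (prim_linear (T t)) by trivial.
  rewrite (prim_eq (fun s => prim f (s + t)) (fun s => T t (g s))); trivial.
  + rewrite Rplus_0_l, (Rplus_comm t r). lin E.
  + intros s. apply (continuous_comp g (T t)); [apply Hg|now apply (linear_cont (V := E))].
  + apply continuous_cont_on. intros s _. eapply hasd_continuous.
    apply (hasd_shift (prim f)), prim_hasd, Hf.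
  + intros s Hs. apply (hasd_shift (prim f)).
    replace (T t (g s)) with (f (s + t)); [now apply prim_hasd|]. unfold f, g.
    replace (t + r - (s + t)) with (r - s) by ring.
    rewrite !Rabs_pos_eq by lra. rewrite Rplus_comm. apply (c0_plus T HT); lra.
- exact (duhamel_integrand_continuous (fun s => u (Rabs s + r)) t Hc).
- intros s Hs. unfold f. rewrite (Rabs_pos_eq (t - s)) by lra. replace (t - s + r) with (t + r - s) by ring. trivial.
Qed.

(** [duhamel u h] divided by [h] tends to [B x], so [T] and the perturbed orbit have a right
    derivative at [0] for the same [x], and the two derivatives differ by [B x]. *)
Lemma mild_solution_derivative (x y : E) (u : R -> E) : mild_solution x u ->
  semigroup_generator T x y <->
  (forall eps, 0 < eps -> exists d, 0 < d /\
   forall h, 0 < h < d -> norm (minus (minus (u h) x) (scal (RtoC h) (plus y (B x)))) <= eps * h).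
Proof.
intros [Hu [_ Eu]].
assert (u0 : u 0 = x).
{ rewrite Eu by lra. rewrite (c0_zero T HT), duhamel_0 by trivial. lin E. }
assert (HD : forall eps, 0 < eps -> exists d, 0 < d /\
   forall h, 0 < h < d -> norm (minus (duhamel u h) (scal (RtoC h) (B x))) <= eps * h).
{ intros e He. set (L := M * exp w * b).
  assert (HL : 0 < L) by (unfold L; pose proof (exp_pos w); repeat apply Rmult_lt_0_compat; lra).
  destruct (proj1 (continuous_eps u 0) (Hu 0) (e / 2 / L)) as [d1 [Hd1 K1]];
    [apply Rdiv_lt_0_compat; lra|].
  destruct (proj1 (continuous_eps _ 0) (semigroup_even_continuous T HT (B x) 0) (e / 2)) as [d2 [Hd2 K2]]; [lra|].
  rewrite u0 in K1.
  exists (Rmin 1 (Rmin d1 d2)). split; [repeat apply Rmin_pos; lra|]. intros h Hh.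
  rmins.
  rewrite <- prim_const by lra. replace (e * h) with (e * h - e * 0) by ring.
  apply (prim_diff_bound (fun s => T (Rabs s) (B (u (h - s)))) (fun _ => B x)
    (fun s => e * s) (fun _ => e)); [lra| | | |].
  - now apply duhamel_integrand_continuous.
  - intros s; apply continuous_const.
  - intros s _. auto_derive; trivial. ring.
  - intros s Hs.
    specialize (K1 (h - s)). specialize (K2 s). rewrite Rminus_0_r in K1, K2.
    rewrite (Rabs_pos_eq (h - s)) in K1 by lra. rewrite Rabs_pos_eq in K2 by lra.
    specialize (K1 ltac:(lra)). specialize (K2 ltac:(lra)).
    rewrite Rabs_R0, (c0_zero T HT) in K2. rewrite Rabs_pos_eq by lra.
    via_le (norm_minus_triangle _ (T s (B x))).
    rewrite <- (map_minus _ (c0_linear T HT s ltac:(lra))), <- (map_minus _ HB).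
    assert (norm (T s (B (minus (u (h - s)) x))) <= e / 2); [|lra].
    eapply Rle_trans; [apply HTb; lra|].
    apply Rle_trans with (M * exp w * (b * (e / 2 / L))); [|right; unfold L; field; repeat split; try lra; apply Rgt_not_eq, exp_pos].
    assert (exp (w * s) <= exp w).
    { destruct (Req_dec (w * s) w) as [->|]; [lra|]. left; apply exp_increasing. nra. }
    pose proof (exp_pos (w * s)).
    apply Rmult_le_compat; [nra|apply norm_ge_0|nra|].
    via_le HBb. apply Rmult_le_compat_l; lra. }
rewrite generator_eps. split; intros H e He.
- destruct (H (e / 2)) as [d1 [Hd1 K1]]; [lra|]. destruct (HD (e / 2)) as [d2 [Hd2 K2]]; [lra|].
  exists (Rmin d1 d2). split; [now apply Rmin_pos|]. intros h Hh.
  rmins.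
  specialize (K1 h ltac:(lra)). specialize (K2 h ltac:(lra)). rewrite Eu by lra.
  norm_as E (plus (minus (minus (T h x) x) (scal (RtoC h) y)) (minus (duhamel u h) (scal (RtoC h) (B x)))).
  via_le norm_triangle. lra.
- destruct (H (e / 2)) as [d1 [Hd1 K1]]; [lra|]. destruct (HD (e / 2)) as [d2 [Hd2 K2]]; [lra|].
  exists (Rmin d1 d2). split; [now apply Rmin_pos|]. intros h Hh.
  rmins.
  specialize (K1 h ltac:(lra)). specialize (K2 h ltac:(lra)). rewrite Eu in K1 by lra.
  norm_as E (minus (minus (minus (plus (T h x) (duhamel u h)) x) (scal (RtoC h) (plus y (B x))))
    (minus (duhamel u h) (scal (RtoC h) (B x)))).
  via_le norm_minus_le. lra.
Qed.

End Perturbation.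

(** Linearity in the initial value and the semigroup law are both read off from uniqueness: sums,
    multiples and time shifts of mild solutions are mild solutions. *)
Lemma bounded_perturbation {E : CSpace} `{BE : Banach E} (T : R -> E -> E) (B : E -> E) :
  C0_semigroup T -> is_linear B ->
  exists U, C0_semigroup U /\ forall x y,
    semigroup_generator T x y <-> semigroup_generator U x (plus y (B x)).
Proof.
intros HT HB.
destruct (semigroup_exp_bound T HT) as [M [w [HM [Hw HTb]]]].
destruct (map_bound _ HB) as [b [Hb HBb]].
destruct (choice _ (mild_solution_exists T HT B HB M w b HM Hw Hb HTb HBb)) as [u Hu].
pose proof (fun x => proj1 (Hu x)) as Hs.
pose proof (fun x u' H => mild_solution_unique T HT B HB M w b HM Hb HTb HBb x (u x) u' (Hs x) H) as Huniq.
assert (u0 : forall x, u x 0 = x).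
{ intros x. rewrite (proj2 (proj2 (Hs x))) by lra.
  rewrite (c0_zero T HT), (duhamel_0 T HT B HB) by apply Hs. lin E. }
exists (fun t x => u x t). split.
- split.
  + intros t Ht. split.
    * intros x y. apply (Huniq (plus x y) (fun s => plus (u x s) (u y s))); trivial.
      destruct (Hs x) as [Hx1 [[K [HK Hx2]] Hx3]]. destruct (Hs y) as [Hy1 [[K' [HK' Hy2]] Hy3]].
      split; [|split].
      -- intros s. apply (continuous_plus (V := E)); [apply Hx1|apply Hy1].
      -- exists (K + K'). split; [lra|]. intros s Hs0. via_le norm_triangle.
         specialize (Hx2 s Hs0). specialize (Hy2 s Hs0). lra.
      -- intros s Hs0. rewrite (duhamel_plus T HT B HB) by trivial. rewrite Hx3, Hy3 by trivial.
         rewrite (map_plus _ (c0_linear T HT s Hs0)). rewrite <- Hx3, <- Hy3 by trivial.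
         rewrite Hx3, Hy3 at 1 by trivial. lin E.
    * intros c x. apply (Huniq (scal c x) (fun s => scal c (u x s))); trivial.
      destruct (Hs x) as [Hx1 [[K [HK Hx2]] Hx3]].
      split; [|split].
      -- intros s. apply (continuous_comp (u x) (fun x : E => scal c x)); [apply Hx1|].
         apply (linear_cont (V := E)), is_linear_scal_C.
      -- exists (Cmod c * K). split; [apply Rmult_le_pos; [apply Cmod_ge_0|trivial]|].
         intros s Hs0. via_le norm_scal_C. rewrite Rmult_assoc.
         apply Rmult_le_compat_l; [apply Cmod_ge_0|now apply Hx2].
      -- intros s Hs0. rewrite (duhamel_scal T HT B HB) by trivial. rewrite (Hx3 s Hs0) at 1.
         rewrite (map_scal _ (c0_linear T HT s Hs0)). lin E.
    * exists (2 * M * exp ((w + 2 * M * b) * t)). pose proof (exp_pos ((w + 2 * M * b) * t)).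
      split; [nra|]. intros x. eapply Rle_trans; [now apply Hu|]. right; ring.
  + exact u0.
  + intros s t x Hs0 Ht.
    pose proof (mild_solution_shift T HT B HB M w b x (u x) t Ht (Hs x)) as Hsh.
    rewrite (Huniq _ _ Hsh s Hs0). now rewrite Rabs_pos_eq.
  + intros x. apply (proj1 (cont_on_iff _ _)), continuous_cont_on. intros t _. apply Hs.
- intros x y. rewrite (generator_eps (fun t x => u x t)).
  apply (mild_solution_derivative T HT B HB M w b HM Hw Hb HTb HBb x y (u x) (Hs x)).
Qed.

(** * The cosine family of the reduction matrix *)

Section Pairs.

Context {E F : CSpace}.

Lemma norm_fst_le (p : E * F) : norm (fst p) <= norm p.
Proof. destruct p as [x y]. via_le Rmax_l. apply (proj1 (norm_prod x y)). Qed.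

Lemma norm_snd_le (p : E * F) : norm (snd p) <= norm p.
Proof. destruct p as [x y]. via_le Rmax_r. apply (proj1 (norm_prod x y)). Qed.

Lemma norm_pair_le (x : E) (y : F) : norm (x, y) <= norm x + norm y.
Proof.
change (sqrt (norm x ^ 2 + norm y ^ 2) <= norm x + norm y).
pose proof (norm_ge_0 x). pose proof (norm_ge_0 y).
rewrite <- (sqrt_pow2 (norm x + norm y)) by lra. apply sqrt_le_1_alt. nra.
Qed.

End Pairs.

(** The interface between the two halves of the argument: what the Gaussian means use of a cosine
    family. The derivative relations concern [s > 0]; negative [s] occur because [iint] takes
    functions continuous on [R], and an extension through [Rabs] fills them. *)
Record half_cosine {E : CSpace} (K : operator E E) (Z : R -> E -> E) (M w : R) : Prop := {
  hc_M : 0 <= M;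
  hc_w : 0 <= w;
  hc_linear : forall s, is_linear (Z s);
  hc_bound : forall s x, norm (Z s x) <= M * exp (w * Rabs s) * norm x;
  hc_continuous : forall x s, continuous (fun s => Z s x) s;
  hc_zero : forall x, Z 0 x = x;
  hc_invariant : forall s x y, K x y -> K (Z s x) (Z s y);
  hc_deriv : forall x y, K x y -> exists Z1 : R -> E,
    (forall s, 0 < s -> hasd (fun s => Z s x) s (Z1 s)) /\
    (forall s, 0 < s -> hasd Z1 s (Z s y)) /\
    (forall s, continuous Z1 s) /\ Z1 0 = zero }.

Arguments hc_M {E K Z M w} _.
Arguments hc_w {E K Z M w} _.
Arguments hc_linear {E K Z M w} _.
Arguments hc_bound {E K Z M w} _.
Arguments hc_continuous {E K Z M w} _.
Arguments hc_zero {E K Z M w} _.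
Arguments hc_invariant {E K Z M w} _.
Arguments hc_deriv {E K Z M w} _.

(** * Direct sum with the identity semigroup *)

Section TrivialSum.

Context {E F : CSpace} `{BE : Banach E} `{BF : Banach F}.

Lemma trivial_sum_semigroup (T : R -> F -> F) : C0_semigroup T ->
  C0_semigroup (fun t (p : E * F) => (fst p, T t (snd p))).
Proof.
intros HT. split.
- intros t Ht. apply (is_linear_prod (fun p : E * F => fst p) (fun p : E * F => T t (snd p))).
  + apply is_linear_fst.
  + apply (is_linear_comp (fun p : E * F => snd p) (T t)); [apply is_linear_snd|now apply (c0_linear T HT)].
- intros [x y]. simpl. now rewrite (c0_zero T HT).
- intros s t [x y] Hs Ht. simpl. now rewrite (c0_plus T HT).
- intros [x y]. apply (proj1 (cont_on_iff _ _)). intros t Ht e He.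
  destruct (semigroup_cont_on T HT y t Ht e He) as [d [Hd K]]. exists d. split; trivial.
  intros s Hs Hst. eapply Rle_lt_trans; [|apply (K s Hs Hst)].
  via_le (norm_pair_le (minus x x) (minus (T s y) (T t y))).
  replace (minus x x) with (zero : E) by lin E. rewrite norm_zero. lra.
Qed.

Lemma trivial_sum_generator (T : R -> F -> F) (p q : E * F) :
  semigroup_generator (fun t (p : E * F) => (fst p, T t (snd p))) p q <->
  fst q = zero /\ semigroup_generator T (snd p) (snd q).
Proof.
rewrite (generator_eps (E := prod_NormedModule _ E F)), (generator_eps T).
destruct p as [x y], q as [x' y']; simpl.
assert (Heq : forall h, minus (minus ((x, T h y) : E * F) (x, y)) (scal (RtoC h) ((x', y') : E * F)) =
  (minus (minus x x) (scal (RtoC h) x') , minus (minus (T h y) y) (scal (RtoC h) y'))) by reflexivity.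
split.
- intros H. split.
  + apply eq_of_norm_minus. intros e He. destruct (H e He) as [d [Hd K]].
    specialize (K (d / 2) ltac:(lra)). rewrite Heq in K.
    pose proof (norm_fst_le (minus (minus x x) (scal (RtoC (d / 2)) x') ,
      minus (minus (T (d / 2) y) y) (scal (RtoC (d / 2)) y'))) as K'. simpl in K'.
    norm_as E (scal (RtoC (- / (d / 2))) (minus (minus x x) (scal (RtoC (d / 2)) x')) : E).
    2:{ rewrite RtoC_opp, RtoC_inv by lra. field. intros Hc. apply RtoC_inj in Hc. lra. }
    via_le norm_scal_RtoC.
    assert (0 < / (d / 2)) by (apply Rinv_0_lt_compat; lra).
    rewrite Rabs_Ropp, Rabs_pos_eq by lra.
    apply Rle_trans with (/ (d / 2) * (e * (d / 2))); [|right; field; lra].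
    apply Rmult_le_compat_l; [lra|]. eapply Rle_trans; [apply K'|exact K].
  + intros e He. destruct (H e He) as [d [Hd K]]. exists d. split; trivial.
    intros h Hh. eapply Rle_trans; [|apply (K h Hh)]. rewrite Heq.
    apply (norm_snd_le (minus (minus x x) (scal (RtoC h) x') ,
      minus (minus (T h y) y) (scal (RtoC h) y'))).
- intros [-> H] e He. destruct (H e He) as [d [Hd K]]. exists d. split; trivial.
  intros h Hh. rewrite Heq. via_le norm_pair_le.
  replace (minus (minus x x) (scal (RtoC h) (zero : E))) with (zero : E) by lin E.
  rewrite norm_zero, Rplus_0_l. now apply K.
Qed.

End TrivialSum.

(** * The coupled first order system and the reduction matrix *)

Section ReductionMatrix.

Context {V X : CSpace} `{BV : Banach V} `{BX : Banach X}.
Context (j : V -> X) (G : operator X X) (A : V -> X).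
Context (Hj : embedding j) (HG : closed_operator G) (HA : is_linear A).
Context (T : R -> V * X -> V * X).
Context (HT : C0_semigroup T) (Hgen : op_eq (phase_matrix j G) (semigroup_generator T)).

(** A state is [((u1, v1), (u2, v2))] with [u = (u1, u2)] and [v = u']; the
    equation is [u1'' = u2], [u2'' = G u2 + A u1], that is [u'' = K u] for the
    reduction matrix [K]. *)
Definition coupling (p : (V * V) * (V * X)) : (V * V) * (V * X) :=
  ((snd (fst p), fst (snd p)), (zero, A (fst (fst p)))).

Lemma coupling_linear : is_linear coupling.
Proof.
pose proof (@is_linear_fst C_AbsRing (prod_NormedModule _ V V) (prod_NormedModule _ V X)) as L1.
pose proof (@is_linear_snd C_AbsRing (prod_NormedModule _ V V) (prod_NormedModule _ V X)) as L2.
pose proof (@is_linear_fst C_AbsRing V V) as L3. pose proof (@is_linear_snd C_AbsRing V V) as L4.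
pose proof (@is_linear_fst C_AbsRing V X) as L5.
apply (is_linear_prod (fun p : (V * V) * (V * X) => (snd (fst p), fst (snd p)))
  (fun p : (V * V) * (V * X) => ((zero : V), A (fst (fst p))))).
- apply (is_linear_prod (fun p : (V * V) * (V * X) => snd (fst p))
    (fun p : (V * V) * (V * X) => fst (snd p))).
  + exact (is_linear_comp _ _ L1 L4).
  + exact (is_linear_comp _ _ L2 L5).
- apply (is_linear_prod (fun p : (V * V) * (V * X) => (zero : V))
    (fun p : (V * V) * (V * X) => A (fst (fst p)))).
  + apply is_linear_zero.
  + exact (is_linear_comp _ _ (is_linear_comp _ _ L1 L3) HA).
Qed.

Definition inject (x : V * X) : (V * V) * (V * X) := ((zero, fst x), (zero, snd x)).

Definition velocity (p : (V * V) * (V * X)) : V * X := (snd (fst p), snd (snd p)).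

Lemma inject_linear : is_linear inject.
Proof.
apply (is_linear_prod (fun x : V * X => ((zero : V), fst x)) (fun x : V * X => ((zero : V), snd x))).
- apply (is_linear_prod (fun x : V * X => (zero : V)) (fun x : V * X => fst x));
    [apply is_linear_zero|apply is_linear_fst].
- apply (is_linear_prod (fun x : V * X => (zero : V)) (fun x : V * X => snd x));
    [apply is_linear_zero|apply is_linear_snd].
Qed.

Lemma velocity_linear : is_linear velocity.
Proof.
pose proof (@is_linear_fst C_AbsRing (prod_NormedModule _ V V) (prod_NormedModule _ V X)) as L1.
pose proof (@is_linear_snd C_AbsRing (prod_NormedModule _ V V) (prod_NormedModule _ V X)) as L2.
apply (is_linear_prod (fun p : (V * V) * (V * X) => snd (fst p))
    (fun p : (V * V) * (V * X) => snd (snd p))).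
- exact (is_linear_comp _ _ L1 (@is_linear_snd C_AbsRing V V)).
- exact (is_linear_comp _ _ L2 (@is_linear_snd C_AbsRing V X)).
Qed.

Lemma coupled_semigroup : exists U : R -> (V * V) * (V * X) -> (V * V) * (V * X),
  C0_semigroup U /\ forall u1 v1 u2 v2 q,
  semigroup_generator U ((u1, v1), (u2, v2)) q <->
  fst q = (v1, u2) /\ j (fst (snd q)) = v2 /\
  exists y, G (j u2) y /\ snd (snd q) = plus y (A u1).
Proof.
destruct (bounded_perturbation (fun t (p : (V * V) * (V * X)) => (fst p, T t (snd p))) coupling
  (trivial_sum_semigroup T HT) coupling_linear) as [U [HU HUgen]].
exists U. split; trivial. intros u1 v1 u2 v2 q.
set (p := ((u1, v1), (u2, v2)) : (V * V) * (V * X)).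
(* Splitting off [coupling p] writes [q] as a candidate image under the unperturbed generator plus
   the perturbation, the form in which [HUgen] applies. *)
assert (Hq : q = plus (minus q (coupling p)) (coupling p)) by lin ((V * V) * (V * X))%type.
rewrite Hq at 1. rewrite <- HUgen, trivial_sum_generator, <- (Hgen _ _).
destruct q as [[q1 q2] [q3 q4]]. unfold phase_matrix.
change (fst (minus (q1, q2, (q3, q4)) (coupling p))) with (minus q1 v1, minus q2 u2).
change (snd (minus (q1, q2, (q3, q4)) (coupling p))) with (minus q3 (zero : V), minus q4 (A u1)).
simpl. split.
- intros [H1 [H2 H3]].
  assert (H1' : minus q1 v1 = zero /\ minus q2 u2 = zero).
  { split; [exact (f_equal fst H1)|exact (f_equal snd H1)]. }
  destruct H1' as [E1 E2]. split; [|split].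
  + now rewrite (minus_zero_eq _ _ E1), (minus_zero_eq _ _ E2).
  + rewrite <- H2. f_equal. lin V.
  + exists (minus q4 (A u1)). split; trivial. lin X.
- intros [H1 [H2 [y [H3 ->]]]]. injection H1 as -> ->. split; [|split].
  + assert (E1 : minus v1 v1 = zero) by lin V. assert (E2 : minus u2 u2 = zero) by lin V.
    rewrite E1, E2. reflexivity.
  + rewrite <- H2. f_equal. lin V.
  + replace (minus (plus y (A u1)) (A u1)) with y by lin X. exact H3.
Qed.

(** For [K x y], the vector [inject x] lies in the domain of the square of the generator of [U],
    with value [inject y]. Two derivatives of its orbit therefore give [Z'' x = Z y], and the
    intermediate vector [m] has velocity zero, which is [Z'(0) x = 0]. *)
Lemma reduction_half_cosine : exists Z M w, half_cosine (reduction_matrix j A G) Z M w.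
Proof.
destruct coupled_semigroup as [U [HU HUgen]].
destruct (semigroup_exp_bound U HU) as [M [w [HM [Hw HUb]]]].
destruct (map_bound _ inject_linear) as [Mi [HMi Ki]].
destruct (map_bound _ velocity_linear) as [Mv [HMv Kv]].
assert (Hstart : forall x y, reduction_matrix j A G x y ->
  exists m, velocity m = zero /\ semigroup_generator U (inject x) m /\
  semigroup_generator U m (inject y)).
(* With [g = j g1], the generator sends [((0, f), (0, g))] to [((f, 0), (g1, 0))], and this to
   [((0, g1), (0, h))]. *)
{ intros [f g] [g1 h] [H1 [y [H2 H3]]]. simpl in *. subst g h.
  exists ((f, zero), (g1, zero)). split; [reflexivity|]. unfold inject; simpl. split.
  - apply HUgen. simpl. split; trivial. split; trivial. exists zero.
    rewrite (map_zero _ (proj1 Hj)), (map_zero _ HA). split; [apply (co_zero G HG)|lin X].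
  - apply HUgen. simpl. split; trivial. split; [apply (map_zero _ (proj1 Hj))|].
    exists y. split; trivial. lin X. }
exists (fun s x => velocity (U (Rabs s) (inject x))), (Mv * (M * Mi)), w.
split.
- repeat apply Rmult_le_pos; lra.
- trivial.
- intros s. exact (is_linear_comp _ _
    (is_linear_comp _ _ inject_linear (semigroup_even_linear U HU s)) velocity_linear).
- intros s x. via_le Kv. rewrite !Rmult_assoc. apply Rmult_le_compat_l; [lra|].
  eapply Rle_trans; [apply HUb, Rabs_pos|]. rewrite Rmult_assoc. apply Rmult_le_compat_l; [lra|].
  rewrite Rmult_comm, (Rmult_comm (exp _)), <- Rmult_assoc. apply Rmult_le_compat_r; [left; apply exp_pos|apply Ki].
- intros x s. apply (continuous_comp (fun s => U (Rabs s) (inject x)) velocity).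
  + apply (semigroup_even_continuous U HU).
  + exact (linear_cont velocity _ velocity_linear).
- intros [f g]. rewrite Rabs_R0, (c0_zero U HU). reflexivity.
- intros s x y Hxy. destruct (Hstart x y Hxy) as [m [_ [H1 H2]]].
  pose proof (generator_invariant U HU (Rabs s) _ _ (Rabs_pos s) H1) as G1.
  pose proof (generator_invariant U HU (Rabs s) _ _ (Rabs_pos s) H2) as G2.
  revert G1 G2. generalize (U (Rabs s) (inject x)), (U (Rabs s) m), (U (Rabs s) (inject y)).
  intros [[u1 v1] [u2 v2]] [[u1' v1'] [u2' v2']] [[u1'' v1''] [u2'' v2'']] G1 G2.
  (* Read componentwise, the two generator relations say that the reduction matrix maps [(v1, v2)]
     to [(v1'', v2'')]; the domain condition is supplied by [j u2' = v2]. *)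
  apply HUgen in G1. apply HUgen in G2. simpl in G1, G2.
  destruct G1 as [E1 [E2 [y1 [E3 E4]]]]. destruct G2 as [F1 [F2 [y2 [F3 F4]]]].
  injection E1 as -> ->. injection F1 as -> ->.
  unfold velocity, reduction_matrix; simpl. split; trivial.
  exists y2. rewrite <- E2. split; trivial. rewrite F4. lin X.
- intros x y Hxy. destruct (Hstart x y Hxy) as [m [H0 [H1 H2]]].
  exists (fun s => velocity (U (Rabs s) m)). split; [|split; [|split]].
  + intros s Hs. rewrite (Rabs_pos_eq s) by lra.
    apply (hasd_linear velocity (fun s => U (Rabs s) (inject x)) s (U s m) velocity_linear).
    now apply (semigroup_hasd U HU).
  + intros s Hs. rewrite (Rabs_pos_eq s) by lra.
    apply (hasd_linear velocity (fun s => U (Rabs s) m) s (U s (inject y)) velocity_linear).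
    now apply (semigroup_hasd U HU).
  + intros s. apply (continuous_comp (fun s => U (Rabs s) m) velocity).
    * apply (semigroup_even_continuous U HU).
    * exact (linear_cont velocity _ velocity_linear).
  + now rewrite Rabs_R0, (c0_zero U HU).
Qed.

(** The domain is [V * D(G)], and density of [D(G)] in [X] is taken from the phase space in two
    moves: the second slot of the generator domain makes the range of [j] dense in [X], the first
    slot makes [D(G)] dense in [V]. *)
Lemma reduction_dense (x : V * X) (eps : R) : 0 < eps ->
  exists x' y', reduction_matrix j A G x' y' /\ norm (minus x' x) < eps.
Proof.
intros He. destruct x as [f g].
destruct (generator_dense T HT (zero, g) (eps / 2)) as [[a b] [[v z] [H1 H2]]]; [lra|].
apply Hgen in H1. destruct H1 as [H1 _]. simpl in H1. subst b.
destruct (map_bound _ (proj1 Hj)) as [M [HM KM]].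
destruct (generator_dense T HT (v, zero) (eps / 2 / M)) as [[a' b'] [[v' y'] [H3 H4]]].
{ apply Rdiv_lt_0_compat; lra. }
apply Hgen in H3. destruct H3 as [_ H3]. simpl in H3.
exists (f, j a'), (a', plus (A f) y'). split.
- split; simpl; trivial. now exists y'.
- apply Rle_lt_trans with (norm (minus (j a') g)).
  { via_le (norm_pair_le (minus f f) (minus (j a') g)).
    replace (minus f f) with (zero : V) by lin V. rewrite norm_zero. lra. }
  pose proof (norm_snd_le (minus ((a, j v) : V * X) (zero, g))) as N1.
  change (snd (minus ((a, j v) : V * X) (zero, g))) with (minus (j v) g) in N1.
  pose proof (norm_fst_le (minus ((a', b') : V * X) (v, zero))) as N2.
  change (fst (minus ((a', b') : V * X) (v, zero))) with (minus a' v) in N2.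
  pose proof (KM (minus a' v)) as N3. rewrite (map_minus _ (proj1 Hj)) in N3.
  pose proof (norm_minus_triangle (j a') (j v) g) as N4.
  apply (Rmult_lt_compat_l M) in H4; trivial.
  replace (M * (eps / 2 / M)) with (eps / 2) in H4 by (field; lra).
  assert (M * norm (minus a' v) < eps / 2).
  { eapply Rle_lt_trans; [|apply H4]. apply Rmult_le_compat_l; [lra|exact N2]. }
  assert (norm (minus (j v) g) < eps / 2) by (eapply Rle_lt_trans; [apply N1|exact H2]).
  lra.
Qed.

Lemma closed_zero {E : CSpace} : closed (fun x : E => x = zero).
Proof.
intros x H. apply norm_eq_zero. apply NNPP. intros Hn. apply H.
apply (locally_le_locally_norm (V := E) x (fun y => y <> zero)). pose proof (norm_ge_0 x).
exists (mkposreal (norm x) ltac:(lra)). intros y Hy ->. unfold ball_norm in Hy. simpl in Hy.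
assert (N : norm (minus (zero : E) x) = norm x) by (rewrite norm_minus_sym; f_equal; lin E).
rewrite N in Hy. lra.
Qed.

(** For closedness, the graph is an intersection of preimages of closed sets under the bounded maps
    [f1] and [f2]: one encodes [j (fst q) = snd p], the other subtracts the bounded term [A] and
    leaves the closed graph of [G]. *)
Lemma reduction_closed : closed_operator (reduction_matrix j A G).
Proof.
split.
- intros x y z [H1 [y1 [H2 H3]]] [H4 [z1 [H5 H6]]].
  apply injective_projections.
  + apply (proj2 Hj). now rewrite H1, H4.
  + rewrite H3, H6. f_equal. now apply (co_fun G HG (snd x)).
- split; [apply (map_zero _ (proj1 Hj))|]. exists zero. split; [apply (co_zero G HG)|].
  change (zero = plus (A (zero : V)) zero). rewrite (map_zero _ HA). lin X.
- intros x x' y y' [H1 [z [H2 H3]]] [H1' [z' [H2' H3']]]. split.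
  + change (j (plus (fst y) (fst y')) = plus (snd x) (snd x')).
    now rewrite (map_plus _ (proj1 Hj)), H1, H1'.
  + exists (plus z z'). split; [now apply (co_plus G HG)|].
    change (plus (snd y) (snd y') = plus (A (plus (fst x) (fst x'))) (plus z z')).
    rewrite (map_plus _ HA), H3, H3'. lin X.
- intros k x y [H1 [z [H2 H3]]]. split.
  + change (j (scal k (fst y)) = scal k (snd x)). now rewrite (map_scal _ (proj1 Hj)), H1.
  + exists (scal k z). split; [now apply (co_scal G HG)|].
    change (scal k (snd y) = plus (A (scal k (fst x))) (scal k z)).
    rewrite (map_scal _ HA), H3. lin X.
- set (E := prod_NormedModule _ V X).
  set (f1 := fun p : E * E => minus (j (fst (snd p))) (snd (fst p))).
  set (f2 := fun p : E * E => (snd (fst p), minus (snd (snd p)) (A (fst (fst p))))).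
  pose proof (@is_linear_fst C_AbsRing E E) as L1. pose proof (@is_linear_snd C_AbsRing E E) as L2.
  pose proof (@is_linear_fst C_AbsRing V X) as L3. pose proof (@is_linear_snd C_AbsRing V X) as L4.
  assert (Lm : forall (a b : E * E -> X), is_linear a -> is_linear b ->
    is_linear (fun p => minus (a p) (b p))).
  { intros a b La Lb. unfold minus.
    apply (is_linear_comp (fun p => (a p, opp (b p))) (fun q : X * X => plus (fst q) (snd q)));
      [|apply is_linear_plus].
    apply (is_linear_prod a (fun p => opp (b p))); trivial.
    apply (is_linear_comp b opp); [trivial|apply is_linear_opp]. }
  assert (Hf1 : is_linear f1).
  { apply Lm; [|exact (is_linear_comp _ _ L1 L4)].
    apply (is_linear_comp (fun p : E * E => fst (snd p)) j); [exact (is_linear_comp _ _ L2 L3)|apply Hj]. }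
  assert (Hf2 : is_linear f2).
  { apply (is_linear_prod (fun p : E * E => snd (fst p))
      (fun p : E * E => minus (snd (snd p)) (A (fst (fst p))))); [exact (is_linear_comp _ _ L1 L4)|].
    apply Lm; [exact (is_linear_comp _ _ L2 L4)|].
    apply (is_linear_comp (fun p : E * E => fst (fst p)) A); [exact (is_linear_comp _ _ L1 L3)|trivial]. }
  assert (C1 : closed (fun p : E * E => f1 p = zero)).
  { apply (closed_comp f1 (fun x : X => x = zero)); [|apply closed_zero].
    intros p. exact (linear_cont f1 p Hf1). }
  assert (C2 : closed (fun p : E * E => G (fst (f2 p)) (snd (f2 p)))).
  { apply (closed_comp f2 (fun q : X * X => G (fst q) (snd q))); [|apply (co_closed G HG)].
    intros p. exact (linear_cont (V := prod_NormedModule _ X X) f2 p Hf2). }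
  apply (closed_ext (fun p : E * E => f1 p = zero /\ G (fst (f2 p)) (snd (f2 p)))).
  + intros [[f g] [f' g']]. unfold f1, f2, reduction_matrix; simpl. split.
    * intros [H1 H2]. split; [now apply minus_zero_eq|].
      exists (minus g' (A f)). split; trivial. lin X.
    * intros [H1 [y [H2 ->]]]. split; [rewrite H1; lin X|].
      replace (minus (plus (A f) y) (A f)) with y by lin X. trivial.
  + apply closed_and; trivial.
Qed.

End ReductionMatrix.

(** * Complex Gaussians *)

Notation CN := C_NormedModule (only parsing).

Global Instance Banach_C : Banach CN.
Proof. exact (Banach_complete C_CompleteNormedModule). Qed.

Lemma exp_mono (x y : R) : x <= y -> exp x <= exp y.
Proof. intros [H| ->]; [left; now apply exp_increasing|lra]. Qed.

Lemma scal_continuous {E : CSpace} (c : R -> CN) (f : R -> E) (t : R) :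
  continuous c t -> continuous f t -> continuous (fun s => scal (c s : C) (f s)) t.
Proof.
intros Hc Hf. apply continuous_eps. intros e He.
destruct (family_continuous (fun s (x : E) => scal (c s : C) x) (fun _ => True) f t) with (eps := e)
  as [d [Hd K]]; trivial.
- intros s _. apply is_linear_scal_C.
- destruct (proj1 (continuous_eps c t) Hc 1 Rlt_0_1) as [d [Hd K]].
  exists (Cmod (c t) + 1), d. pose proof (Cmod_ge_0 (c t)). split; [lra|]. split; trivial.
  intros s x _ Hs. via_le norm_scal_C. apply Rmult_le_compat_r; [apply norm_ge_0|].
  specialize (K s Hs). pose proof (norm_le_minus (c s) (c t)) as H1.
  change (norm (c s)) with (Cmod (c s)) in H1. change (norm (c t)) with (Cmod (c t)) in H1. lra.
- intros e' He'. set (q := norm (f t) + 1).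
  assert (Hq : 0 < q) by (pose proof (norm_ge_0 (f t)); unfold q; lra).
  destruct (proj1 (continuous_eps c t) Hc (e' / q)) as [d [Hd K]]; [now apply Rdiv_lt_0_compat|].
  exists d. split; trivial. intros s _ Hs. specialize (K s Hs).
  norm_as E (scal (Cminus (c s) (c t)) (f t) : E).
  via_lt norm_scal_C.
  change (norm (minus (c s) (c t))) with (Cmod (Cminus (c s) (c t))) in K.
  apply Rle_lt_trans with (Cmod (Cminus (c s) (c t)) * q).
  + apply Rmult_le_compat_l; [apply Cmod_ge_0|unfold q; lra].
  + apply (Rmult_lt_compat_r q) in K; trivial. replace (e' / q * q) with e' in K by (field; lra). exact K.
- intros e' He'. destruct (proj1 (continuous_eps f t) Hf e' He') as [d [Hd K]]. exists d. auto.
- exists d. auto.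
Qed.

Lemma scal_hasd {E : CSpace} (c : R -> CN) (f : R -> E) (t : R) (c' : CN) (f' : E) :
  hasd c t c' -> hasd f t f' ->
  hasd (fun s => scal (c s : C) (f s)) t (plus (scal (c' : C) (f t)) (scal (c t : C) f')).
Proof.
intros Hc Hf. pose proof (hasd_continuous _ _ _ Hc) as Hcc.
apply (family_hasd (fun s (x : E) => scal (c s : C) x) f t (scal (c' : C) (f t)) f'); trivial.
- apply filter_forall. intros s. apply is_linear_scal_C.
- destruct (proj1 (continuous_eps c t) Hcc 1 Rlt_0_1) as [d [Hd K]].
  exists (Cmod (c t) + 1), d. pose proof (Cmod_ge_0 (c t)). split; [lra|]. split; trivial.
  intros s x Hs. via_le norm_scal_C. apply Rmult_le_compat_r; [apply norm_ge_0|].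
  specialize (K s Hs). pose proof (norm_le_minus (c s) (c t)) as H1.
  change (norm (c s)) with (Cmod (c s)) in H1. change (norm (c t)) with (Cmod (c t)) in H1. lra.
- intros e He. set (q := norm (f t) + 1).
  assert (Hq : 0 < q) by (pose proof (norm_ge_0 (f t)); unfold q; lra).
  destruct (Hc (e / q)) as [d [Hd K]]; [now apply Rdiv_lt_0_compat|].
  exists d. split; trivial. intros s Hs. specialize (K s Hs).
  norm_as E (scal (Cminus (Cminus (c s) (c t)) (Cmult (RtoC (s - t)) c')) (f t) : E).
  via_le norm_scal_C.
  change (norm (minus (minus (c s) (c t)) (scal (RtoC (s - t)) c'))) with
    (Cmod (Cminus (Cminus (c s) (c t)) (Cmult (RtoC (s - t)) c'))) in K.
  apply Rle_trans with (e / q * Rabs (s - t) * q).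
  + apply Rmult_le_compat; [apply Cmod_ge_0|apply norm_ge_0|exact K|unfold q; lra].
  + right. field. lra.
- apply scal_continuous; trivial. apply continuous_const.
Qed.

(** The mean value inequality is applied twice, first to [v], then to [u] minus its linear part;
    hence the constant [M] instead of [M / 2]. *)
Lemma taylor2 {E : CSpace} (u v v' : R -> E) (M : R) :
  (forall t, hasd u t (v t)) -> (forall t, hasd v t (v' t)) ->
  (forall t, 0 <= t <= 1 -> norm (v' t) <= M) ->
  norm (minus (minus (u 1) (u 0)) (v 0)) <= M.
Proof.
intros Hu Hv HM.
assert (M0 : 0 <= M) by (apply Rle_trans with (norm (v' 0)); [apply norm_ge_0|apply HM; lra]).
assert (Hcv : forall P, cont_on P v) by (intros P; apply continuous_cont_on; intros t _; eapply hasd_continuous, Hv).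
assert (H1 : forall t, 0 <= t <= 1 -> norm (minus (v t) (v 0)) <= M).
{ intros t Ht. apply Rle_trans with (M * (t - 0)); [|nra].
  apply (mean_value_const v v' M); [lra|apply Hcv|intros s _; apply Hv|intros s Hs; apply HM; lra]. }
assert (Hd : forall t, hasd (fun t => plus (u t) (scal (RtoC (- t)) (v 0))) t (minus (v t) (v 0))).
{ intros t. apply hasd_plus; [apply Hu|].
  intros e He. exists 1. split; [lra|]. intros s _. norm_as E (zero : E).
  2:{ rewrite RtoC_minus, !RtoC_opp. ring. }
  rewrite norm_zero. apply Rmult_le_pos; [lra|apply Rabs_pos]. }
replace (minus (minus (u 1) (u 0)) (v 0)) with
  (minus (plus (u 1) (scal (RtoC (- 1)) (v 0))) (plus (u 0) (scal (RtoC (- 0)) (v 0)))).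
2:{ lin E; rewrite !RtoC_opp; ring. }
apply Rle_trans with (M * (1 - 0)); [|lra].
apply (mean_value_const (fun t => plus (u t) (scal (RtoC (- t)) (v 0)))
  (fun t => minus (v t) (v 0)) M 0 1); [lra| | |].
- apply continuous_cont_on. intros t _. eapply hasd_continuous, Hd.
- intros t _. apply Hd.
- intros t Ht. apply H1. lra.
Qed.

Definition cexp (z : C) : C := (exp (fst z) * cos (snd z), exp (fst z) * sin (snd z)).

Lemma Cmod_cexp (z : C) : Cmod (cexp z) = exp (fst z).
Proof.
unfold Cmod, cexp; simpl.
replace (_ + _) with (exp (fst z) * exp (fst z) * (Rsqr (sin (snd z)) + Rsqr (cos (snd z))))
  by (unfold Rsqr; ring).
rewrite sin2_cos2, Rmult_1_r. apply sqrt_square. left; apply exp_pos.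
Qed.

Lemma Cmod_le_components (a b : R) : Cmod (a, b) <= Rabs a + Rabs b.
Proof.
unfold Cmod; simpl. pose proof (Rabs_pos a). pose proof (Rabs_pos b).
rewrite <- (sqrt_pow2 (Rabs a + Rabs b)) by lra. apply sqrt_le_1_alt.
pose proof (Rsqr_abs a). pose proof (Rsqr_abs b). unfold Rsqr in *. simpl. nra.
Qed.

Lemma hasd_components (f g : R -> R) (t l m : R) : is_derive f t l -> is_derive g t m ->
  hasd (E := CN) (fun s => (f s, g s)) t (l, m).
Proof.
intros Hf Hg e He.
destruct (is_derive_eps f t l Hf (e / 2)) as [d1 [Hd1 K1]]; [lra|].
destruct (is_derive_eps g t m Hg (e / 2)) as [d2 [Hd2 K2]]; [lra|].
exists (Rmin d1 d2). split; [now apply Rmin_pos|]. intros s Hs.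
rmins.
specialize (K1 s ltac:(lra)). specialize (K2 s ltac:(lra)).
match goal with |- norm ?x <= _ => change (norm x) with (Cmod x) end.
match goal with |- Cmod ?x <= _ =>
  replace x with ((f s - f t - (s - t) * l, g s - g t - (s - t) * m) : C) end.
- via_le Cmod_le_components. lra.
- unfold minus, plus, opp, scal; simpl. unfold mult; simpl. unfold Cmult, Cplus, Copp; simpl.
  apply injective_projections; simpl; ring.
Qed.

(** Quadratic exponents serve both uses: [r] carries the Gaussian as a function of [s], and [q] the
    segment between two Gaussian parameters for fixed [s]. *)
Lemma cexp_hasd (p q r : C) (t : R) :
  hasd (E := CN) (fun t => cexp (p + q * RtoC t + r * RtoC (t ^ 2))%C) t
    ((q + RtoC 2 * r * RtoC t) * cexp (p + q * RtoC t + r * RtoC (t ^ 2)))%C.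
Proof.
destruct p as [p1 p2], q as [q1 q2], r as [r1 r2].
assert (Ec : forall t, cexp ((p1, p2) + (q1, q2) * RtoC t + (r1, r2) * RtoC (t ^ 2))%C =
  (exp (p1 + q1 * t + r1 * t ^ 2) * cos (p2 + q2 * t + r2 * t ^ 2),
   exp (p1 + q1 * t + r1 * t ^ 2) * sin (p2 + q2 * t + r2 * t ^ 2))).
{ intros s. unfold cexp.
  replace (fst ((p1, p2) + (q1, q2) * RtoC s + (r1, r2) * RtoC (s ^ 2))%C)
    with (p1 + q1 * s + r1 * s ^ 2) by (simpl; ring).
  replace (snd ((p1, p2) + (q1, q2) * RtoC s + (r1, r2) * RtoC (s ^ 2))%C)
    with (p2 + q2 * s + r2 * s ^ 2) by (simpl; ring). trivial. }
rewrite Ec. refine (hasd_ext (E := CN) _ _ t _ (fun s => eq_sym (Ec s)) _).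
replace ((_ + _) * _)%C with
   (((q1 + 2 * r1 * t) * cos (p2 + q2 * t + r2 * t ^ 2) - (q2 + 2 * r2 * t) * sin (p2 + q2 * t + r2 * t ^ 2))
     * exp (p1 + q1 * t + r1 * t ^ 2),
    ((q1 + 2 * r1 * t) * sin (p2 + q2 * t + r2 * t ^ 2) + (q2 + 2 * r2 * t) * cos (p2 + q2 * t + r2 * t ^ 2))
     * exp (p1 + q1 * t + r1 * t ^ 2)).
- apply hasd_components; auto_derive; trivial; simpl; ring.
- apply injective_projections; simpl; ring.
Qed.

Definition gauss (a : C) (s : R) : C := cexp (- a * RtoC (s ^ 2)).

Lemma Cmod_gauss (a : C) (s : R) : Cmod (gauss a s) = exp (- fst a * s ^ 2).
Proof. unfold gauss. rewrite Cmod_cexp. f_equal. simpl. ring. Qed.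

Lemma gauss_hasd (a : C) (s : R) :
  hasd (E := CN) (gauss a) s (- RtoC 2 * a * RtoC s * gauss a s)%C.
Proof.
pose proof (cexp_hasd (RtoC 0) (RtoC 0) (- a)%C s) as H.
replace (- RtoC 2 * a * RtoC s * gauss a s)%C with
  ((RtoC 0 + RtoC 2 * - a * RtoC s) * cexp (RtoC 0 + RtoC 0 * RtoC s + - a * RtoC (s ^ 2)))%C.
- revert H. apply hasd_ext. intros t. unfold gauss. f_equal. ring.
- unfold gauss. replace (RtoC 0 + RtoC 0 * RtoC s + - a * RtoC (s ^ 2))%C with (- a * RtoC (s ^ 2))%C by ring.
  ring.
Qed.

(** Taylor expansion of the exponential on the segment from [a] to [b], where the real part stays at
    least [al] by convexity; the remainder keeps Gaussian decay and can be integrated against the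
    cosine family. *)
Lemma gauss_taylor (a b : C) (al s : R) : al <= fst a -> al <= fst b ->
  Cmod (gauss b s - gauss a s + (b - a) * RtoC (s ^ 2) * gauss a s)%C <=
  Cmod (b - a) ^ 2 * (s ^ 4 * exp (- al * s ^ 2)).
Proof.
intros Ha Hb.
set (p := (- a * RtoC (s ^ 2))%C). set (q := (- (b - a) * RtoC (s ^ 2))%C).
set (e := fun t => cexp (p + q * RtoC t + RtoC 0 * RtoC (t ^ 2))%C).
assert (H1 : forall t, hasd (E := CN) e t (q * e t)%C).
{ intros t. pose proof (cexp_hasd p q (RtoC 0) t) as H.
  replace (q * e t)%C with ((q + RtoC 2 * RtoC 0 * RtoC t) * e t)%C by ring. exact H. }
assert (H2 : forall t, hasd (E := CN) (fun t => q * e t)%C t (q * (q * e t))%C).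
{ intros t. apply (hasd_linear (E := CN) (F := CN) (fun z : CN => scal (q : C) z) e t (q * e t)%C); [|apply H1].
  apply is_linear_scal_C. }
assert (H3 : norm (minus (minus (e 1 : CN) (e 0)) (q * e 0)%C) <=
  Cmod (b - a) ^ 2 * (s ^ 4 * exp (- al * s ^ 2))).
{ apply (taylor2 (E := CN) e (fun t => (q * e t)%C) (fun t => (q * (q * e t))%C)); trivial.
  intros t Ht. change (Cmod (q * (q * e t)) <= Cmod (b - a) ^ 2 * (s ^ 4 * exp (- al * s ^ 2))).
  rewrite !Cmod_mult. unfold e. rewrite Cmod_cexp.
  assert (Hq : Cmod q = Cmod (b - a) * s ^ 2).
  { unfold q. rewrite Cmod_mult, Cmod_opp, Cmod_R, Rabs_pos_eq by apply pow2_ge_0. trivial. }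
  rewrite Hq. unfold p, q.
  replace (fst (- a * RtoC (s ^ 2) + - (b - a) * RtoC (s ^ 2) * RtoC t + RtoC 0 * RtoC (t ^ 2))%C)
    with (- ((1 - t) * fst a + t * fst b) * s ^ 2) by (simpl; ring).
  apply Rle_trans with (Cmod (b - a) * s ^ 2 * (Cmod (b - a) * s ^ 2 * exp (- al * s ^ 2))); [|right; ring].
  repeat apply Rmult_le_compat_l; try (apply Rmult_le_pos; [apply Cmod_ge_0|apply pow2_ge_0]).
  apply exp_mono. apply Rmult_le_compat_r; [apply pow2_ge_0|]. nra. }
change (Cmod (Cminus (Cminus (e 1) (e 0)) (q * e 0)) <=
  Cmod (b - a) ^ 2 * (s ^ 4 * exp (- al * s ^ 2))) in H3.
assert (E0 : e 0 = gauss a s).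
{ unfold e, gauss. f_equal. unfold p. ring. }
assert (E1 : e 1 = gauss b s).
{ unfold e, gauss. f_equal. unfold p, q. replace (1 ^ 2) with 1 by ring. ring. }
rewrite E0, E1 in H3.
replace (gauss b s - gauss a s + (b - a) * RtoC (s ^ 2) * gauss a s)%C with
  (gauss b s - gauss a s - q * gauss a s)%C; trivial.
unfold q. ring.
Qed.

Lemma pow_le_exp (k : nat) : exists c, 0 < c /\ forall s, 0 <= s -> s ^ k <= c * exp s.
Proof.
induction k as [|k [c [Hc IH]]].
- exists 1. split; [lra|]. intros s Hs. simpl. pose proof (exp_ineq1_le s). lra.
- exists (2 ^ k * c * 2). split; [repeat apply Rmult_lt_0_compat; try apply pow_lt; lra|]. intros s Hs.
  pose proof (IH (s / 2) ltac:(lra)) as H1. pose proof (exp_ineq1_le (s / 2)) as H2.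
  assert (E : exp s = exp (s / 2) * exp (s / 2)) by (rewrite <- exp_plus; f_equal; field).
  replace (s ^ S k) with (2 ^ k * (s / 2) ^ k * s).
  2:{ rewrite <- Rpow_mult_distr. replace (2 * (s / 2)) with s by field. simpl; ring. }
  rewrite E. replace (2 ^ k * c * 2 * (exp (s / 2) * exp (s / 2))) with
    (2 ^ k * (c * exp (s / 2)) * (2 * exp (s / 2))) by ring.
  assert (0 < 2 ^ k) by (apply pow_lt; lra).
  apply Rmult_le_compat; [|lra| |lra].
  + apply Rmult_le_pos; [lra|apply pow_le; lra].
  + apply Rmult_le_compat_l; lra.
Qed.

(** Set [mu = sqrt al]. The power is absorbed by [exp (mu * s)], and completing the square bounds
    [(w + 2 * mu) * s - al * s ^ 2] by [(w / mu + 2) ^ 2 / 4]. The constant depends on [k] alone, so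
    the scaling in [al] stays visible for the limit of [z] to [0]. *)
Lemma gauss_decay (k : nat) : exists c, 0 < c /\ forall al w s, 0 < al -> 0 <= w -> 0 <= s ->
  s ^ k * exp (- al * s ^ 2) * exp (w * s) <=
  c / sqrt al ^ k * exp ((w / sqrt al + 2) ^ 2 / 4) * exp (- sqrt al * s).
Proof.
destruct (pow_le_exp k) as [c [Hc K]]. exists c. split; trivial. intros al w s Hal Hw Hs.
pose proof (sqrt_lt_R0 al Hal) as Hmu. set (mu := sqrt al) in *.
assert (Hmu2 : al = mu * mu) by (unfold mu; symmetry; apply sqrt_sqrt; lra).
rewrite Hmu2. clearbody mu.
assert (Hp : 0 < mu ^ k) by now apply pow_lt.
pose proof (K (mu * s) ltac:(nra)) as H1. rewrite Rpow_mult_distr in H1.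
assert (H2 : exp (mu * s) * exp (- (mu * mu) * s ^ 2) * exp (w * s) <=
  exp ((w / mu + 2) ^ 2 / 4) * exp (- mu * s)).
{ rewrite <- !exp_plus. apply exp_mono.
  pose proof (pow2_ge_0 (mu * s - (w / mu + 2) / 2)) as H.
  replace ((mu * s - (w / mu + 2) / 2) ^ 2) with
    (mu * mu * s ^ 2 - (w * s + 2 * mu * s) + (w / mu + 2) ^ 2 / 4) in H by (field; lra).
  lra. }
apply Rmult_le_reg_l with (mu ^ k); trivial.
replace (mu ^ k * (c / mu ^ k * exp ((w / mu + 2) ^ 2 / 4) * exp (- mu * s))) with
  (c * (exp ((w / mu + 2) ^ 2 / 4) * exp (- mu * s))) by (field; lra).
pose proof (exp_pos (- (mu * mu) * s ^ 2)). pose proof (exp_pos (w * s)).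
apply Rle_trans with (c * exp (mu * s) * (exp (- (mu * mu) * s ^ 2) * exp (w * s))).
- rewrite Rmult_assoc, <- !Rmult_assoc. rewrite (Rmult_assoc (mu ^ k * s ^ k)), (Rmult_assoc (c * _)).
  apply Rmult_le_compat_r; [nra|lra].
- replace (c * exp (mu * s) * (exp (- (mu * mu) * s ^ 2) * exp (w * s))) with
    (c * (exp (mu * s) * exp (- (mu * mu) * s ^ 2) * exp (w * s))) by ring.
  apply Rmult_le_compat_l; lra.
Qed.

(** * Gaussian means *)

Section GaussianMean.

Context {E : CSpace} `{BE : Banach E}.

Definition exp_bounded (M w : R) (f : R -> E) : Prop :=
  (forall s, continuous f s) /\ forall s, 0 <= s -> norm (f s) <= M * exp (w * s).

Definition gmoment (k : nat) (a : C) (f : R -> E) : E :=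
  iint (fun s => scal (RtoC (s ^ k) * gauss a s)%C (f s)).

Lemma kernel_continuous (k : nat) (a : C) (s : R) :
  continuous (fun s => (RtoC (s ^ k) * gauss a s)%C : CN) s.
Proof.
apply (scal_continuous (E := CN) (fun s => RtoC (s ^ k) : CN) (gauss a)).
- apply (hasd_continuous (E := CN) _ s (INR k * s ^ pred k, 0)).
  apply (hasd_components (fun s => s ^ k) (fun _ => 0)); auto_derive; trivial; ring.
- eapply (hasd_continuous (E := CN)), gauss_hasd.
Qed.

(** The exponent [S k] collects [k] powers from [s ^ k] and one from integrating
    [exp (- sqrt al * s)]; near [z = 0] these powers compensate the normalising factor. *)
Lemma gaussian_integral_bound (k : nat) : exists c, 0 < c /\
  forall (al M w : R) (F : R -> E),
  0 < al -> 0 <= w -> 0 <= M -> (forall s, continuous F s) ->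
  (forall s, 0 <= s -> norm (F s) <= M * (s ^ k * exp (- al * s ^ 2) * exp (w * s))) ->
  decays F /\ norm (iint F) <= c * M / sqrt al ^ S k * exp ((w / sqrt al + 2) ^ 2 / 4).
Proof.
destruct (gauss_decay k) as [c [Hc K]]. exists c. split; trivial.
intros al M w F Hal Hw HM HF Hb.
pose proof (sqrt_lt_R0 al Hal) as Hmu. assert (Hp : 0 < sqrt al ^ k) by now apply pow_lt.
assert (Hb' : forall s, 0 <= s -> norm (F s) <=
  c * M / sqrt al ^ k * exp ((w / sqrt al + 2) ^ 2 / 4) * exp (- sqrt al * s)).
{ intros s Hs. eapply Rle_trans; [now apply Hb|].
  specialize (K al w s Hal Hw Hs). apply (Rmult_le_compat_l M) in K; trivial.
  unfold Rdiv in *. lra. }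
split.
- split; trivial. exists (c * M / sqrt al ^ k * exp ((w / sqrt al + 2) ^ 2 / 4)), (sqrt al).
  split; [|split; trivial].
  apply Rmult_le_pos; [|left; apply exp_pos]. apply Rdiv_le_0_compat; [nra|trivial].
- via_le (iint_bound _ _ (sqrt al) Hmu HF Hb').
  right. simpl. field. lra.
Qed.

Lemma kernel_integral_bound (k : nat) : exists c, 0 < c /\
  forall (al M w : R) (f : R -> E) (h : R -> CN),
  0 < al -> 0 <= w -> 0 <= M -> exp_bounded M w f -> (forall s, continuous h s) ->
  (forall s, 0 <= s -> Cmod (h s) <= s ^ k * exp (- al * s ^ 2)) ->
  decays (fun s => scal (h s : C) (f s)) /\
  norm (iint (fun s => scal (h s : C) (f s))) <=
    c * M / sqrt al ^ S k * exp ((w / sqrt al + 2) ^ 2 / 4).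
Proof.
destruct (gaussian_integral_bound k) as [c [Hc K]]. exists c. split; trivial.
intros al M w f h Hal Hw HM [Hf Hfb] Hhc Hh. apply K; trivial.
- intros s. apply scal_continuous; [apply Hhc|apply Hf].
- intros s Hs. via_le norm_scal_C.
  apply Rle_trans with (s ^ k * exp (- al * s ^ 2) * (M * exp (w * s))); [|right; ring].
  apply Rmult_le_compat; [apply Cmod_ge_0|apply norm_ge_0|now apply Hh|now apply Hfb].
Qed.

Lemma gmoment_bound (k : nat) : exists c, 0 < c /\
  forall (a : C) (al M w : R) (f : R -> E),
  0 < al -> al <= fst a -> 0 <= w -> 0 <= M -> exp_bounded M w f ->
  decays (fun s => scal (RtoC (s ^ k) * gauss a s)%C (f s)) /\
  norm (gmoment k a f) <= c * M / sqrt al ^ S k * exp ((w / sqrt al + 2) ^ 2 / 4).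
Proof.
destruct (kernel_integral_bound k) as [c [Hc K]]. exists c. split; trivial.
intros a al M w f Hal Ha Hw HM Hf.
apply (K al M w f (fun s => (RtoC (s ^ k) * gauss a s)%C)); trivial.
- apply kernel_continuous.
- intros s Hs. rewrite Cmod_mult, Cmod_R, Cmod_gauss, Rabs_pos_eq by (apply pow_le; trivial).
  apply Rmult_le_compat_l; [now apply pow_le|]. apply exp_mono.
  apply Rmult_le_compat_r; [apply pow2_ge_0|lra].
Qed.

Lemma gmoment_decays (k : nat) (a : C) (M w : R) (f : R -> E) :
  0 < fst a -> 0 <= w -> 0 <= M -> exp_bounded M w f ->
  decays (fun s => scal (RtoC (s ^ k) * gauss a s)%C (f s)).
Proof.
intros Ha Hw HM Hf. destruct (gmoment_bound k) as [c [_ K]].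
now apply (K a (fst a) M w f Ha (Rle_refl _) Hw HM Hf).
Qed.

(** [kernel_integral_bound] with [k = 4] is applied to the kernel remainder of [gauss_taylor]. One
    constant serves all [f], so for orbits this is differentiability in operator norm, with minus
    the second moment as derivative. *)
Lemma gmoment_taylor (M w al : R) : 0 <= w -> 0 <= M -> 0 < al -> exists c, 0 <= c /\
  forall (a b : C) (r : R) (f : R -> E), al <= fst a -> al <= fst b -> 0 <= r ->
  exp_bounded (M * r) w f ->
  norm (minus (minus (gmoment 0 b f) (gmoment 0 a f))
    (scal (b - a)%C (scal (Copp (RtoC 1)) (gmoment 2 a f)))) <= c * Cmod (b - a) ^ 2 * r.
Proof.
intros Hw HM Hal. destruct (kernel_integral_bound 4) as [c [Hc K]].
exists (c * M / sqrt al ^ 5 * exp ((w / sqrt al + 2) ^ 2 / 4)).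
assert (Hmu : 0 < sqrt al) by now apply sqrt_lt_R0.
assert (Hc' : 0 <= c * M / sqrt al ^ 5 * exp ((w / sqrt al + 2) ^ 2 / 4)).
{ apply Rmult_le_pos; [|left; apply exp_pos]. apply Rdiv_le_0_compat; [nra|now apply pow_lt]. }
split; trivial.
intros a b r f Ha Hb Hr Hf.
destruct (Req_dec (Cmod (b - a)) 0) as [H0|H0].
{ apply Cmod_eq_0 in H0. assert (Hba : b = a) by (replace b with (b - a + a)%C by ring; rewrite H0; ring).
  subst b. norm_as E (zero : E). rewrite norm_zero.
  apply Rmult_le_pos; [apply Rmult_le_pos; [trivial|apply pow2_ge_0]|trivial]. }
pose proof (Cmod_ge_0 (b - a)) as Hba.
set (q := Cmod (b - a)) in *.
(* Division by [q ^ 2] brings the kernel under the bound [s ^ 4 * exp (- al * s ^ 2)]; the factor is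
   restored after integration. The case [q = 0] has been treated apart. *)
set (h := fun s => (RtoC (/ q ^ 2) * (gauss b s - gauss a s + (b - a) * RtoC (s ^ 2) * gauss a s))%C).
assert (Hq2 : 0 < q ^ 2) by (apply pow_lt; lra).
assert (D1 : decays (fun s => scal (RtoC (s ^ 0) * gauss b s)%C (f s)))
  by (apply (gmoment_decays 0 b (M * r) w); [lra|trivial|nra|trivial]).
assert (D2 : decays (fun s => scal (RtoC (s ^ 0) * gauss a s)%C (f s)))
  by (apply (gmoment_decays 0 a (M * r) w); [lra|trivial|nra|trivial]).
assert (D3 : decays (fun s => scal (RtoC (s ^ 2) * gauss a s)%C (f s)))
  by (apply (gmoment_decays 2 a (M * r) w); [lra|trivial|nra|trivial]).
destruct (K al (M * r) w f h) as [Dh Hh]; trivial; [nra| | |].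
- intros s. unfold h.
  apply (scal_continuous (E := CN) (fun _ => RtoC (/ q ^ 2) : CN)
    (fun s => (gauss b s - gauss a s + (b - a) * RtoC (s ^ 2) * gauss a s)%C : CN)); [apply continuous_const|].
  apply (continuous_plus (V := CN) (fun s => (gauss b s - gauss a s)%C : CN)
    (fun s => ((b - a) * RtoC (s ^ 2) * gauss a s)%C : CN)).
  + apply (continuous_minus (V := CN)); eapply (hasd_continuous (E := CN)), gauss_hasd.
  + apply (continuous_ext (fun s => (scal (b - a)%C ((RtoC (s ^ 2) * gauss a s)%C : CN)) : CN)).
    * intros t. change ((b - a) * (RtoC (t ^ 2) * gauss a t) = (b - a) * RtoC (t ^ 2) * gauss a t)%C. ring.
    * apply (scal_continuous (E := CN) (fun _ => (b - a)%C : CN)); [apply continuous_const|apply kernel_continuous].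
- intros s Hs. unfold h. rewrite Cmod_mult, Cmod_R, Rabs_pos_eq by (left; now apply Rinv_0_lt_compat).
  apply Rmult_le_reg_l with (q ^ 2); trivial. rewrite <- Rmult_assoc, Rinv_r, Rmult_1_l by lra.
  now apply gauss_taylor.
- assert (E1 : minus (minus (gmoment 0 b f) (gmoment 0 a f))
    (scal (b - a)%C (scal (Copp (RtoC 1)) (gmoment 2 a f))) =
    scal (RtoC (q ^ 2)) (iint (fun s => scal (h s) (f s)))).
  { unfold gmoment.
    assert (E2 : iint (fun s => scal (RtoC (q ^ 2)) (scal (h s) (f s))) =
      iint (fun s => plus (plus (scal (RtoC (s ^ 0) * gauss b s)%C (f s) : E)
        (scal (Copp (RtoC 1)) (scal (RtoC (s ^ 0) * gauss a s)%C (f s))))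
        (scal (b - a)%C (scal (RtoC (s ^ 2) * gauss a s)%C (f s))))).
    { assert (Hq1 : (RtoC (q ^ 2) * RtoC (/ q ^ 2) = 1)%C).
      { rewrite <- RtoC_mult, Rinv_r by lra. trivial. }
      apply iint_ext. intros s. unfold h. rewrite (pow_O s). lin E.
      rewrite (Cmult_assoc _ (RtoC (/ q ^ 2) * _)%C), (Cmult_assoc (RtoC (q ^ 2))), Hq1. ring. }
    rewrite <- (iint_scal (RtoC (q ^ 2))), E2 by trivial.
    assert (D2' : decays (fun s => scal (Copp (RtoC 1)) (scal (RtoC (s ^ 0) * gauss a s)%C (f s))))
      by exact (decays_linear (fun x : E => scal (Copp (RtoC 1)) x) _ (is_linear_scal_C _) D2).
    assert (D3' : decays (fun s => scal (b - a)%C (scal (RtoC (s ^ 2) * gauss a s)%C (f s))))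
      by exact (decays_linear (fun x : E => scal (b - a)%C x) _ (is_linear_scal_C _) D3).
    rewrite iint_plus by (trivial; now apply decays_plus). rewrite iint_plus by trivial.
    rewrite !iint_scal by trivial. lin E. }
  rewrite E1. via_le norm_scal_RtoC. rewrite Rabs_pos_eq by lra.
  apply (Rmult_le_compat_l (q ^ 2)) in Hh; [|lra].
  via_le Hh. right. field. lra.
Qed.

End GaussianMean.

(** * Complex differentiability with a quadratic remainder *)

(** Complex differentiability in operator norm, expressed on vectors with a constant uniform in [x].
    The quadratic remainder turns the product and chain rules into algebra of constants. *)
Definition opdiff {E F : CSpace} (S : C -> E -> F) (z : C) (L : E -> F) : Prop :=
  exists c d, 0 <= c /\ 0 < d /\ forall w x, Cmod (w - z) < d ->
  norm (minus (minus (S w x) (S z x)) (scal (w - z)%C (L x))) <= c * Cmod (w - z) ^ 2 * norm x.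

Definition cdiff (f : C -> C) (z l : C) : Prop :=
  exists c d, 0 <= c /\ 0 < d /\ forall w, Cmod (w - z) < d ->
  Cmod (f w - f z - (w - z) * l)%C <= c * Cmod (w - z) ^ 2.

Lemma cdiff_lipschitz (f : C -> C) (z l : C) : cdiff f z l ->
  exists c d, 0 <= c /\ 0 < d /\ forall w, Cmod (w - z) < d -> Cmod (f w - f z) <= c * Cmod (w - z).
Proof.
intros [c [d [Hc [Hd K]]]]. exists (c * d + Cmod l), d. pose proof (Cmod_ge_0 l).
split; [nra|]. split; trivial. intros w Hw. specialize (K w Hw).
replace (f w - f z)%C with ((f w - f z - (w - z) * l) + (w - z) * l)%C by ring.
via_le Cmod_triangle. rewrite (Cmod_mult (w - z)).
pose proof (Cmod_ge_0 (w - z)) as Hq. set (q := Cmod (w - z)) in *.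
assert (c * q ^ 2 <= c * d * q).
{ replace (c * q ^ 2) with (c * q * q) by ring. apply Rmult_le_compat_r; trivial.
  apply Rmult_le_compat_l; lra. }
lra.
Qed.

Lemma opdiff_lipschitz {E F : CSpace} (S : C -> E -> F) (z : C) (L : E -> F) :
  opdiff S z L -> is_linear L ->
  exists c d, 0 <= c /\ 0 < d /\ forall w x, Cmod (w - z) < d ->
  norm (minus (S w x) (S z x)) <= c * Cmod (w - z) * norm x.
Proof.
intros [c [d [Hc [Hd K]]]] HL. destruct (map_bound _ HL) as [M [HM KM]].
exists (c * d + M), d. split; [nra|]. split; trivial. intros w x Hw. specialize (K w x Hw).
via_le (norm_le_minus _ (scal (w - z)%C (L x))).
pose proof (norm_scal_C (w - z)%C (L x)) as H1.
pose proof (Cmod_ge_0 (w - z)) as H2. specialize (KM x). pose proof (norm_ge_0 x).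
assert (H3 : Cmod (w - z) * norm (L x) <= Cmod (w - z) * (M * norm x)) by (apply Rmult_le_compat_l; trivial).
assert (H4 : c * Cmod (w - z) ^ 2 * norm x <= c * d * Cmod (w - z) * norm x).
{ apply Rmult_le_compat_r; trivial.
  replace (c * Cmod (w - z) ^ 2) with (c * Cmod (w - z) * Cmod (w - z)) by ring.
  apply Rmult_le_compat_r; trivial. apply Rmult_le_compat_l; lra. }
lra.
Qed.

Lemma opdiff_scal {E F : CSpace} (f : C -> C) (S : C -> E -> F) (z l : C) (L : E -> F) :
  cdiff f z l -> opdiff S z L -> is_linear L -> is_linear (S z) ->
  opdiff (fun w x => scal (f w) (S w x)) z (fun x => plus (scal l (S z x)) (scal (f z) (L x))).
Proof.
intros Hf HS HL HSz.
destruct (opdiff_lipschitz S z L HS HL) as [cS [dS [HcS [HdS KS]]]].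
destruct Hf as [c1 [d1 [Hc1 [Hd1 K1]]]]. destruct HS as [c2 [d2 [Hc2 [Hd2 K2]]]].
destruct (map_bound _ HSz) as [M [HM KM]].
set (d := Rmin dS (Rmin d1 d2)).
assert (Hd : 0 < d) by (unfold d; repeat apply Rmin_pos; trivial).
exists (c1 * (cS * d + M) + Cmod l * cS + Cmod (f z) * c2), d.
pose proof (Cmod_ge_0 l). pose proof (Cmod_ge_0 (f z)).
split; [repeat apply Rplus_le_le_0_compat; repeat apply Rmult_le_pos; try lra; nra|].
split; trivial. intros w x Hw.
pose proof (Rmin_l dS (Rmin d1 d2)) as A1. pose proof (Rmin_r dS (Rmin d1 d2)) as A2. fold d in A1, A2.
rmins.
specialize (KS w x ltac:(lra)). specialize (K1 w ltac:(lra)). specialize (K2 w x ltac:(lra)).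
specialize (KM x). pose proof (Cmod_ge_0 (w - z)) as Hq. pose proof (norm_ge_0 x) as Hx.
norm_as F (plus (plus (scal (f w - f z - (w - z) * l)%C (S w x) : F)
  (scal ((w - z) * l)%C (minus (S w x) (S z x))))
  (scal (f z) (minus (minus (S w x) (S z x)) (scal (w - z)%C (L x))))).
set (q := Cmod (w - z)) in *.
via_le norm_triangle. eapply Rle_trans; [apply Rplus_le_compat_r, norm_triangle|].
assert (N1 : norm (S w x) <= (cS * d + M) * norm x).
{ via_le (norm_le_minus _ (S z x)).
  assert (cS * q * norm x <= cS * d * norm x) by (apply Rmult_le_compat_r; nra). lra. }
assert (B1 : norm (scal (f w - f z - (w - z) * l)%C (S w x) : F) <= c1 * q ^ 2 * ((cS * d + M) * norm x)).
{ via_le norm_scal_C.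
  apply Rmult_le_compat; [apply Cmod_ge_0|apply norm_ge_0|exact K1|exact N1]. }
assert (B2 : norm (scal ((w - z) * l)%C (minus (S w x) (S z x)) : F) <= q * Cmod l * (cS * q * norm x)).
{ via_le norm_scal_C. rewrite Cmod_mult. fold q.
  apply Rmult_le_compat_l; [nra|exact KS]. }
assert (B3 : norm (scal (f z) (minus (minus (S w x) (S z x)) (scal (w - z)%C (L x))) : F) <=
  Cmod (f z) * (c2 * q ^ 2 * norm x)).
{ via_le norm_scal_C. apply Rmult_le_compat_l; trivial. }
replace ((c1 * (cS * d + M) + Cmod l * cS + Cmod (f z) * c2) * q ^ 2 * norm x) with
  (c1 * q ^ 2 * ((cS * d + M) * norm x) + q * Cmod l * (cS * q * norm x) +
   Cmod (f z) * (c2 * q ^ 2 * norm x)) by ring.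
exact (Rplus_le_compat _ _ _ _ (Rplus_le_compat _ _ _ _ B1 B2) B3).
Qed.

Lemma opdiff_comp {E F : CSpace} (f : C -> C) (S : C -> E -> F) (z l : C) (L : E -> F) :
  cdiff f z l -> opdiff S (f z) L -> is_linear L ->
  opdiff (fun w x => S (f w) x) z (fun x => scal l (L x)).
Proof.
intros Hf HS HL.
destruct (cdiff_lipschitz f z l Hf) as [cf [df [Hcf [Hdf Kf]]]].
destruct Hf as [c1 [d1 [Hc1 [Hd1 K1]]]]. destruct HS as [c2 [d2 [Hc2 [Hd2 K2]]]].
destruct (map_bound _ HL) as [M [HM KM]].
set (d3 := d2 / (cf + 1)). assert (Hd3 : 0 < d3) by (apply Rdiv_lt_0_compat; lra).
exists (c2 * cf ^ 2 + c1 * M), (Rmin df (Rmin d1 d3)).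
split; [pose proof (pow2_ge_0 cf); nra|]. split; [repeat apply Rmin_pos; trivial|].
intros w x Hw.
rmins.
specialize (Kf w ltac:(lra)). specialize (K1 w ltac:(lra)).
pose proof (Cmod_ge_0 (w - z)) as Hq. pose proof (norm_ge_0 x) as Hx.
assert (Hfw : Cmod (f w - f z) < d2).
{ via_lt Kf. apply Rle_lt_trans with ((cf + 1) * Cmod (w - z)); [nra|].
  assert (Hlt : Cmod (w - z) < d3) by lra.
  apply (Rmult_lt_compat_l (cf + 1)) in Hlt; [|lra].
  replace ((cf + 1) * d3) with d2 in Hlt by (unfold d3; field; lra). exact Hlt. }
specialize (K2 (f w) x Hfw). specialize (KM x).
norm_as F (plus (minus (minus (S (f w) x) (S (f z) x)) (scal (f w - f z)%C (L x)))
  (scal (f w - f z - (w - z) * l)%C (L x))).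
set (q := Cmod (w - z)) in *.
via_le norm_triangle.
assert (B1 : c2 * Cmod (f w - f z) ^ 2 * norm x <= c2 * (cf * q) ^ 2 * norm x).
{ apply Rmult_le_compat_r; trivial. apply Rmult_le_compat_l; trivial.
  apply pow_incr. split; [apply Cmod_ge_0|trivial]. }
assert (B2 : norm (scal (f w - f z - (w - z) * l)%C (L x) : F) <= c1 * q ^ 2 * (M * norm x)).
{ via_le norm_scal_C.
  apply Rmult_le_compat; [apply Cmod_ge_0|apply norm_ge_0|exact K1|exact KM]. }
replace ((c2 * cf ^ 2 + c1 * M) * q ^ 2 * norm x) with
  (c2 * (cf * q) ^ 2 * norm x + c1 * q ^ 2 * (M * norm x)) by ring.
exact (Rplus_le_compat _ _ _ _ (Rle_trans _ _ _ K2 B1) B2).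
Qed.

Lemma opdiff_ext {E F : CSpace} (S S' : C -> E -> F) (z : C) (L L' : E -> F) (d : R) :
  0 < d -> (forall w x, Cmod (w - z) < d -> S w x = S' w x) -> (forall x, L x = L' x) ->
  opdiff S z L -> opdiff S' z L'.
Proof.
intros Hd HS HL [c [d' [Hc [Hd' K]]]]. exists c, (Rmin d d').
split; trivial. split; [now apply Rmin_pos|]. intros w x Hw.
rmins.
rewrite <- (HS w), <- (HS z), <- HL; [apply K; lra| |lra].
replace (z - z)%C with (RtoC 0) by ring. rewrite Cmod_0. trivial.
Qed.

(** The product rule for operators, with scalars acting by multiplication on [C] and evaluated at
    [1]. *)
Lemma cdiff_mult (f g : C -> C) (z l m : C) : cdiff f z l -> cdiff g z m ->
  cdiff (fun w => f w * g w)%C z (l * g z + f z * m)%C.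
Proof.
intros Hf Hg.
destruct (opdiff_scal (E := CN) (F := CN) f (fun w (x : CN) => (scal (g w) x : CN)) z l
  (fun x => (scal m x : CN))) as [c [d [Hc [Hd K]]]]; trivial.
- destruct Hg as [c [d [Hc [Hd K]]]]. exists c, d. split; trivial. split; trivial.
  intros w x Hw. specialize (K w Hw).
  norm_as CN (scal (g w - g z - (w - z) * m)%C x : CN).
  via_le norm_scal_C. apply Rmult_le_compat_r; [apply norm_ge_0|exact K].
- apply is_linear_scal_C.
- apply is_linear_scal_C.
- exists c, d. split; trivial. split; trivial. intros w Hw. specialize (K w (RtoC 1) Hw).
  change (norm (RtoC 1 : CN)) with (Cmod (RtoC 1)) in K. rewrite Cmod_1, Rmult_1_r in K.
  replace (f w * g w - f z * g z - (w - z) * (l * g z + f z * m))%C with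
    (f w * (g w * 1) - f z * (g z * 1) - (w - z) * (l * (g z * 1) + f z * (m * 1)))%C by ring.
  exact K.
Qed.

Lemma cdiff_id (z : C) : cdiff (fun w => w) z (RtoC 1).
Proof.
exists 0, 1. split; [lra|]. split; [lra|]. intros w _.
replace (w - z - (w - z) * 1)%C with (RtoC 0) by ring. rewrite Cmod_0. lra.
Qed.

(** Complex derivatives enter the constancy arguments along segments, where [constant_of_zero_deriv]
    applies. *)
Lemma opdiff_line {E F : CSpace} (S : C -> E -> F) (z w : C) (t : R) (L : E -> F) (x : E) :
  opdiff S (z + RtoC t * w)%C L -> hasd (fun s => S (z + RtoC s * w)%C x) t (scal w (L x)).
Proof.
intros [c [d [Hc [Hd K]]]] e He.
set (q := Cmod w + 1). assert (Hq : 0 < q) by (pose proof (Cmod_ge_0 w); unfold q; lra).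
set (r := c * q ^ 2 * norm x + 1).
assert (Hr : 0 < r).
{ pose proof (norm_ge_0 x). pose proof (pow2_ge_0 q). assert (0 <= c * q ^ 2 * norm x) by (repeat apply Rmult_le_pos; lra).
  unfold r. lra. }
exists (Rmin (d / q) (e / r)). split; [apply Rmin_pos; now apply Rdiv_lt_0_compat|].
intros s Hs.
rmins. assert (H1 : Rabs (s - t) < d / q) by lra.
assert (H2 : Rabs (s - t) < e / r) by lra.
assert (E1 : (z + RtoC s * w - (z + RtoC t * w))%C = (RtoC (s - t) * w)%C) by (rewrite RtoC_minus; ring).
specialize (K (z + RtoC s * w)%C x). rewrite E1, Cmod_mult, Cmod_R in K.
pose proof (Rabs_pos (s - t)) as H0. pose proof (Cmod_ge_0 w) as Hw.
assert (H3 : Rabs (s - t) * Cmod w < d).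
{ apply Rle_lt_trans with (Rabs (s - t) * q); [unfold q; nra|].
  apply (Rmult_lt_compat_r q) in H1; trivial. replace (d / q * q) with d in H1 by (field; lra). exact H1. }
specialize (K H3).
norm_as F (minus (minus (S (z + RtoC s * w)%C x) (S (z + RtoC t * w)%C x)) (scal (RtoC (s - t) * w)%C (L x))).
via_le K.
apply Rle_trans with (r * Rabs (s - t) * Rabs (s - t)).
- apply Rle_trans with (c * q ^ 2 * norm x * Rabs (s - t) * Rabs (s - t)).
  + replace (c * (Rabs (s - t) * Cmod w) ^ 2 * norm x) with
      (c * Cmod w ^ 2 * norm x * Rabs (s - t) * Rabs (s - t)) by ring.
    pose proof (norm_ge_0 x).
    repeat apply Rmult_le_compat_r; trivial. apply Rmult_le_compat_l; trivial.
    apply pow_incr. unfold q. lra.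
  + repeat apply Rmult_le_compat_r; trivial. unfold r. lra.
- apply Rmult_le_compat_r; trivial. apply (Rmult_lt_compat_l r) in H2; trivial.
  replace (r * (e / r)) with e in H2 by (field; lra). lra.
Qed.

Lemma cdiff_line (f : C -> C) (z w : C) (t : R) (l : C) :
  cdiff f (z + RtoC t * w)%C l -> hasd (E := CN) (fun s => f (z + RtoC s * w)%C) t (w * l)%C.
Proof.
intros [c [d [Hc [Hd K]]]].
pose proof (opdiff_line (E := CN) (F := CN) (fun u (x : CN) => (scal (f u) x : CN)) z w t
  (fun x => (scal l x : CN)) (RtoC 1)) as H.
replace (w * l)%C with (scal w (scal l (RtoC 1 : CN)) : CN).
- revert H. intros H. apply (hasd_ext (E := CN) (fun s => scal (f (z + RtoC s * w)%C) (RtoC 1 : CN))).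
  { intros s. apply Cmult_1_r. }
  apply H. exists c, d. split; trivial. split; trivial. intros u x Hu. specialize (K u Hu).
  norm_as CN (scal (f u - f (z + RtoC t * w) - (u - (z + RtoC t * w)) * l)%C x : CN).
  via_le norm_scal_C. apply Rmult_le_compat_r; [apply norm_ge_0|exact K].
- apply (f_equal (Cmult w)), Cmult_1_r.
Qed.

Lemma Cminus_diag_uniq (w z : C) : (w - z)%C = RtoC 0 -> w = z.
Proof. intros H. replace w with (w - z + z)%C by ring. rewrite H. ring. Qed.

Lemma opdiff_op_C_deriv {E : CSpace} (S : C -> E -> E) (z : C) (L : E -> E) :
  opdiff S z L -> op_C_deriv S z L.
Proof.
intros [c [d [Hc [Hd K]]]] e.
apply locally_C_eps. pose proof (cond_pos e) as He.
exists (Rmin d (e / (c + 1))). split; [apply Rmin_pos; trivial; apply Rdiv_lt_0_compat; lra|].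
intros w Hw Hwz x.
change (norm (minus (scal (/ (w - z))%C (minus (S w x) (S z x)) : E) (L x)) <= e * norm x).
rmins. assert (H1 : Cmod (w - z) < d) by lra.
assert (H2 : Cmod (w - z) < e / (c + 1)) by lra.
assert (H0 : (w - z)%C <> RtoC 0).
{ intros H. exact (Hwz (Cminus_diag_uniq w z H)). }
norm_as E (scal (/ (w - z))%C (minus (minus (S w x) (S z x)) (scal (w - z)%C (L x))) : E).
2:{ field. exact H0. }
via_le norm_scal_C. rewrite Cmod_inv by trivial.
pose proof (proj1 (Cmod_gt_0 _) H0) as Hp. specialize (K w x H1). pose proof (norm_ge_0 x) as Hx.
apply Rmult_le_reg_l with (Cmod (w - z)); trivial. rewrite <- Rmult_assoc, Rinv_r, Rmult_1_l by lra.
via_le K.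
apply (Rmult_lt_compat_l (c + 1)) in H2; [|lra].
replace ((c + 1) * (e / (c + 1))) with (pos e) in H2 by (field; lra).
replace (Cmod (w - z) * (e * norm x)) with (e * (Cmod (w - z) * norm x)) by ring.
replace (c * Cmod (w - z) ^ 2 * norm x) with (c * Cmod (w - z) * (Cmod (w - z) * norm x)) by ring.
apply Rmult_le_compat_r; nra.
Qed.

Lemma Re_near (z w : C) : fst z - Cmod (w - z) <= fst w.
Proof.
pose proof (Rmax_Cmod (w - z)%C) as H. pose proof (Rmax_l (Rabs (fst (w - z)%C)) (Rabs (snd (w - z)%C))) as H1.
assert (H2 : Rabs (fst w - fst z) <= Cmod (w - z)) by (eapply Rle_trans; [|apply H]; exact H1).
apply Rabs_le_between in H2. lra.
Qed.

Lemma cdiff_inv4 (z : C) : z <> RtoC 0 ->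
  cdiff (fun w => / (RtoC 4 * w))%C z (- (RtoC 4 * (/ (RtoC 4 * z) * / (RtoC 4 * z))))%C.
Proof.
intros Hz. pose proof (proj1 (Cmod_gt_0 _) Hz) as Hp.
(* The remainder is exactly [(w - z) ^ 2 / (4 * z ^ 2 * w)], and [Cmod w >= Cmod z / 2] within the
   chosen radius. *)
exists (/ (2 * Cmod z ^ 3)), (Cmod z / 2).
assert (Hp3 : 0 < Cmod z ^ 3) by now apply pow_lt.
split; [left; apply Rinv_0_lt_compat; lra|]. split; [lra|]. intros w Hw.
assert (Hw2 : Cmod z / 2 <= Cmod w).
{ pose proof (Cmod_triangle (z - w)%C w) as H. replace (z - w + w)%C with z in H by ring.
  replace (z - w)%C with (- (w - z))%C in H by ring. rewrite Cmod_opp in H. lra. }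
assert (Hw0 : w <> RtoC 0).
{ intros ->. rewrite Cmod_0 in Hw2. lra. }
assert (H4 : RtoC 4 <> RtoC 0) by (intros H; apply RtoC_inj in H; lra).
replace (/ (RtoC 4 * w) - / (RtoC 4 * z) - (w - z) * - (RtoC 4 * (/ (RtoC 4 * z) * / (RtoC 4 * z))))%C with
  ((w - z) * (w - z) * / (RtoC 4 * z * z * w))%C.
2:{ assert (E4 : RtoC 4 = (RtoC 2 * RtoC 2)%C) by (rewrite <- RtoC_mult; f_equal; ring).
    field. repeat split; trivial. }
rewrite !Cmod_mult, Cmod_inv by (repeat apply Cmult_neq_0; trivial).
rewrite !Cmod_mult, Cmod_R, (Rabs_pos_eq 4) by lra.
replace (Cmod (w - z) * Cmod (w - z) * / (4 * Cmod z * Cmod z * Cmod w)) with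
  (/ (4 * Cmod z * Cmod z * Cmod w) * Cmod (w - z) ^ 2) by ring.
apply Rmult_le_compat_r; [apply pow2_ge_0|]. apply Rinv_le_contravar; [lra|].
replace (2 * Cmod z ^ 3) with (4 * Cmod z * Cmod z * (Cmod z / 2)) by field.
apply Rmult_le_compat_l; nra.
Qed.

(** * The heat equation for Gaussian means of a cosine family *)

Lemma kernel_hasd_0 (a : C) (s : R) :
  hasd (E := CN) (fun s => (RtoC (s ^ 0) * gauss a s)%C) s (- RtoC 2 * a * RtoC s * gauss a s)%C.
Proof.
apply (hasd_ext (E := CN) (gauss a)); [|apply gauss_hasd].
intros t. rewrite pow_O. symmetry. apply Cmult_1_l.
Qed.

Lemma kernel_hasd_1 (a : C) (s : R) :
  hasd (E := CN) (fun s => (RtoC (s ^ 1) * gauss a s)%C) s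
    ((RtoC 1 - RtoC 2 * a * RtoC (s ^ 2)) * gauss a s)%C.
Proof.
assert (H1 : hasd (E := CN) (fun s => RtoC (s ^ 1)) s (RtoC 1)).
{ apply (hasd_components (fun s => s ^ 1) (fun _ => 0)); auto_derive; trivial; ring. }
pose proof (scal_hasd (E := CN) _ _ s _ _ H1 (gauss_hasd a s)) as H.
replace ((RtoC 1 - RtoC 2 * a * RtoC (s ^ 2)) * gauss a s)%C with
  (RtoC 1 * gauss a s + RtoC (s ^ 1) * (- RtoC 2 * a * RtoC s * gauss a s))%C; [exact H|].
replace (RtoC (s ^ 2)) with (RtoC s * RtoC s)%C by (rewrite <- RtoC_mult; f_equal; ring).
rewrite pow_1. ring.
Qed.

Section HeatEquation.

Context {E : CSpace} `{BE : Banach E} {K : operator E E} {Z : R -> E -> E} {M w : R}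
  (HZ : half_cosine K Z M w).

Lemma orbit_bounded (x : E) : exp_bounded (M * norm x) w (fun s => Z s x).
Proof.
split; [intros s; apply (hc_continuous HZ)|].
intros s Hs. via_le (hc_bound HZ). rewrite Rabs_pos_eq by trivial.
right; ring.
Qed.

Lemma orbit_norm_nonneg (x : E) : 0 <= M * norm x.
Proof. apply Rmult_le_pos; [apply (hc_M HZ)|apply norm_ge_0]. Qed.

(** [Z1] vanishes at [0] and has derivative [Z s y]. One more integration, in [orbit_taylor], makes
    [Z s x - x] of order [s ^ 2], hence the semigroup defect of order [z] on the domain. *)
Lemma orbit_derivative_bound (y : E) (Z1 : R -> E) :
  (forall s, 0 < s -> hasd Z1 s (Z s y)) -> (forall s, continuous Z1 s) -> Z1 0 = zero ->
  forall s, 0 <= s -> norm (Z1 s) <= M * norm y * (s * exp (w * s)).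
Proof.
intros Hd Hc H0 s Hs.
replace (Z1 s) with (minus (Z1 s) (Z1 0)) by (rewrite H0; lin E).
apply Rle_trans with (M * norm y * exp (w * s) * (s - 0)); [|right; ring].
apply (mean_value_const Z1 (fun r => Z r y)); trivial.
- apply continuous_cont_on. intros r _. apply Hc.
- intros r Hr. apply Hd. lra.
- intros r Hr. eapply Rle_trans; [apply (proj2 (orbit_bounded y)); lra|].
  apply Rmult_le_compat_l; [apply orbit_norm_nonneg|]. apply exp_mono.
  apply Rmult_le_compat_l; [apply (hc_w HZ)|lra].
Qed.

Lemma orbit_taylor (x y : E) : K x y ->
  forall s, 0 <= s -> norm (minus (Z s x) x) <= M * norm y * (s ^ 2 * exp (w * s)).
Proof.
intros Hxy s Hs. destruct (hc_deriv HZ x y Hxy) as [Z1 [H1 [H2 [H3 H4]]]].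
replace x with (Z 0 x) at 2 by apply (hc_zero HZ).
apply Rle_trans with (M * norm y * (s * exp (w * s)) * (s - 0)); [|right; ring].
apply (mean_value_const (fun r => Z r x) Z1); trivial.
- apply continuous_cont_on. intros r _. apply (hc_continuous HZ).
- intros r Hr. apply H1. lra.
- intros r Hr. eapply Rle_trans; [apply (orbit_derivative_bound y Z1 H2 H3 H4); lra|].
  apply Rmult_le_compat_l; [apply orbit_norm_nonneg|].
  apply Rmult_le_compat; [lra|left; apply exp_pos|lra|]. apply exp_mono.
  apply Rmult_le_compat_l; [apply (hc_w HZ)|lra].
Qed.

Definition mean (k : nat) (a : C) (x : E) : E := gmoment k a (fun s => Z s x).

Lemma mean_decays (k : nat) (a : C) (x : E) : 0 < fst a ->
  decays (fun s => scal (RtoC (s ^ k) * gauss a s)%C (Z s x)).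
Proof.
intros Ha. apply (gmoment_decays k a (M * norm x) w); trivial.
- apply (hc_w HZ).
- apply orbit_norm_nonneg.
- apply orbit_bounded.
Qed.

Lemma mean_linear (k : nat) (a : C) : 0 < fst a -> is_linear (mean k a).
Proof.
intros Ha. pose proof (hc_linear HZ) as L. split.
- intros x y. unfold mean, gmoment.
  rewrite <- iint_plus by now apply mean_decays. apply iint_ext. intros s.
  rewrite (map_plus _ (L s)). lin E.
- intros c x. unfold mean, gmoment.
  transitivity (scal (c : C) (iint (fun s => scal (RtoC (s ^ k) * gauss a s)%C (Z s x))) : E); [|reflexivity].
  rewrite <- (iint_scal c) by now apply mean_decays. apply iint_ext. intros s.
  etransitivity; [apply f_equal, (map_scal _ (L s))|]. lin E.
- destruct (gmoment_bound (E := E) k) as [c [Hc Kc]].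
  set (c' := c * M / sqrt (fst a) ^ S k * exp ((w / sqrt (fst a) + 2) ^ 2 / 4)).
  assert (Hp : 0 < sqrt (fst a) ^ S k) by (apply pow_lt; now apply sqrt_lt_R0).
  assert (Hc' : 0 <= c').
  { apply Rmult_le_pos; [|left; apply exp_pos]. apply Rdiv_le_0_compat; [|trivial].
    apply Rmult_le_pos; [lra|apply (hc_M HZ)]. }
  exists (c' + 1). split; [lra|]. intros x.
  destruct (Kc a (fst a) (M * norm x) w (fun s => Z s x) Ha (Rle_refl _)) as [_ Hb].
  + apply (hc_w HZ).
  + apply orbit_norm_nonneg.
  + apply orbit_bounded.
  + via_le Hb. apply Rle_trans with (c' * norm x).
    * right. unfold c'. field. lra.
    * pose proof (norm_ge_0 x). nra.
Qed.

Lemma mean_opdiff (a : C) : 0 < fst a ->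
  opdiff (fun b x => mean 0 b x) a (fun x => scal (Copp (RtoC 1)) (mean 2 a x)).
Proof.
intros Ha.
destruct (gmoment_taylor (E := E) M w (fst a / 2)) as [c [Hc Kc]];
  [apply (hc_w HZ)|apply (hc_M HZ)|lra|].
exists c, (fst a / 2). split; trivial. split; [lra|]. intros b x Hb.
apply Kc; [lra| |apply norm_ge_0|apply orbit_bounded].
pose proof (Re_near a b). lra.
Qed.

(** The antiderivative is [gauss a s * Z1 s + 2 * a * s * gauss a s * Z s x]: in its derivative the
    terms with [Z1] cancel, and it vanishes at [0] because [Z1 0 = 0]. The right-hand side does not
    contain [y] and is bounded in [x] alone. *)
Lemma heat_equation (a : C) (x y : E) : 0 < fst a -> K x y ->
  mean 0 a y = minus (scal (RtoC 4 * a * a)%C (mean 2 a x)) (scal (RtoC 2 * a)%C (mean 0 a x)).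
Proof.
intros Ha Hxy. destruct (hc_deriv HZ x y Hxy) as [Z1 [H1 [H2 [H3 H4]]]].
pose proof (hc_w HZ) as Hw. pose proof (hc_M HZ) as HM.
set (f0 := fun s => scal (RtoC (s ^ 0) * gauss a s)%C (Z s y) : E).
set (f1 := fun s => scal (RtoC (s ^ 0) * gauss a s)%C (Z s x) : E).
set (f2 := fun s => scal (RtoC (s ^ 2) * gauss a s)%C (Z s x) : E).
assert (D0 : decays f0) by now apply mean_decays.
assert (D1 : decays f1) by now apply mean_decays.
assert (D2 : decays f2) by now apply mean_decays.
assert (D1' : decays (fun s => scal (RtoC 2 * a)%C (f1 s)))
  by exact (decays_linear (fun x : E => scal (RtoC 2 * a)%C x) f1 (is_linear_scal_C _) D1).
assert (D2' : decays (fun s => scal (- (RtoC 4 * a * a))%C (f2 s)))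
  by exact (decays_linear (fun x : E => scal (- (RtoC 4 * a * a))%C x) f2 (is_linear_scal_C _) D2).
set (u1 := fun s => scal (RtoC (s ^ 0) * gauss a s)%C (Z1 s) : E).
set (u2 := fun s => scal (RtoC (s ^ 1) * gauss a s)%C (Z s x) : E).
(* The factor [s] in the bound of [Z1] is absorbed by [exp s], at the price of the rate [w + 1]. *)
assert (HZ1 : exp_bounded (M * norm y) (w + 1) Z1).
{ split; trivial. intros s Hs.
  eapply Rle_trans; [apply (orbit_derivative_bound y Z1); trivial|].
  apply Rmult_le_compat_l; [apply orbit_norm_nonneg|].
  rewrite Rmult_plus_distr_r, exp_plus, Rmult_1_l, Rmult_comm.
  apply Rmult_le_compat_l; [left; apply exp_pos|]. pose proof (exp_ineq1_le s). lra. }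
assert (Du1 : decays u1).
{ apply (gmoment_decays 0 a (M * norm y) (w + 1)); [trivial|lra|apply orbit_norm_nonneg|trivial]. }
assert (Du2 : decays u2) by now apply mean_decays.
assert (Du2' : decays (fun s => scal (RtoC 2 * a)%C (u2 s)))
  by exact (decays_linear (fun x : E => scal (RtoC 2 * a)%C x) u2 (is_linear_scal_C _) Du2).
pose proof (decays_plus _ _ Du1 Du2') as Du.
pose proof (decays_plus _ _ D0 (decays_plus _ _ D1' D2')) as Df.
assert (HI : iint (fun s => plus (f0 s) (plus (scal (RtoC 2 * a)%C (f1 s)) (scal (- (RtoC 4 * a * a))%C (f2 s)))) =
  opp (plus (u1 0) (scal (RtoC 2 * a)%C (u2 0)))).
{ apply (iint_ftc (fun s => plus (u1 s) (scal (RtoC 2 * a)%C (u2 s)))); trivial.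
  - apply continuous_cont_on. intros s _. apply Du.
  - intros s Hs.
    pose proof (scal_hasd _ _ s _ _ (kernel_hasd_0 a s) (H2 s Hs)) as G1.
    pose proof (scal_hasd _ _ s _ _ (kernel_hasd_1 a s) (H1 s Hs)) as G2.
    pose proof (hasd_linear (fun x : E => scal (RtoC 2 * a)%C x) _ s _ (is_linear_scal_C _) G2) as G2'.
    pose proof (hasd_plus _ _ s _ _ G1 G2') as G. cbv beta in G.
    match type of G with hasd _ _ ?l =>
      replace (plus (f0 s) (plus (scal (RtoC 2 * a)%C (f1 s)) (scal (- (RtoC 4 * a * a))%C (f2 s)))) with l end.
    + exact G.
    + unfold f0, f1, f2. rewrite pow_O, pow_1. simpl pow. rewrite Rmult_1_r, RtoC_mult.
      assert (E4 : RtoC 4 = (RtoC 2 * RtoC 2)%C) by (rewrite <- RtoC_mult; f_equal; ring). rewrite E4.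
      lin E.
  - apply Du. }
assert (Hu0 : plus (u1 0) (scal (RtoC 2 * a)%C (u2 0)) = zero).
{ unfold u1, u2. rewrite H4, pow_1. lin E. }
rewrite Hu0 in HI.
assert (D12 : decays (fun s => plus (scal (RtoC 2 * a)%C (f1 s)) (scal (- (RtoC 4 * a * a))%C (f2 s)) : E))
  by exact (decays_plus _ _ D1' D2').
pose proof (iint_plus f0 _ D0 D12) as P1. pose proof (iint_plus _ _ D1' D2') as P2.
pose proof (iint_scal (RtoC 2 * a)%C f1 D1) as P3. pose proof (iint_scal (- (RtoC 4 * a * a))%C f2 D2) as P4.
assert (HS : plus (mean 0 a y) (plus (scal (RtoC 2 * a)%C (mean 0 a x)) (scal (- (RtoC 4 * a * a))%C (mean 2 a x))) =
  opp (zero : E)).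
{ refine (eq_trans _ HI). symmetry. refine (eq_trans P1 _). apply f_equal.
  refine (eq_trans P2 _). exact (f_equal2 plus P3 P4). }
apply (f_equal (fun v : E => plus v (minus (scal (RtoC 4 * a * a)%C (mean 2 a x)) (scal (RtoC 2 * a)%C (mean 0 a x))))) in HS.
etransitivity; [|etransitivity; [exact HS|]]; lin E.
Qed.

End HeatEquation.

Arguments mean {E} Z k a x.

(** * The normalising factor *)

(** The constant family generated by the zero operator on [C]. It makes the scalar Gaussian integral
    an instance of [mean], so that its differential equation comes from [heat_equation] and
    [mean_opdiff]. *)
Lemma trivial_cosine : half_cosine (E := CN) (fun _ y => y = zero) (fun _ x => x) 1 0.
Proof.
split; try lra.
- intros _. apply is_linear_id.
- intros s x. rewrite Rmult_0_l, exp_0. lra.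
- intros x s. apply continuous_const.
- trivial.
- trivial.
- intros x y ->. exists (fun _ => zero). repeat split; trivial; intros s.
  + intros _. apply hasd_const.
  + intros _. apply hasd_const.
  + apply continuous_const.
Qed.

(** [gnorm a = sqrt (pi / a) / 2]; only [gnorm a ^ 2 * a = gnorm 1 ^ 2] is
    needed, which avoids a branch of the complex square root. *)
Definition gnorm (a : C) : C := mean (E := CN) (fun _ x => x) 0 a (RtoC 1).

Definition gnorm2 (a : C) : C := mean (E := CN) (fun _ x => x) 2 a (RtoC 1).

Lemma gnorm_parts (a : C) : 0 < fst a -> gnorm a = (RtoC 2 * a * gnorm2 a)%C.
Proof.
intros Ha.
assert (Ha0 : a <> RtoC 0) by (intros ->; simpl in Ha; lra).
pose proof (heat_equation trivial_cosine a (RtoC 1) zero Ha eq_refl) as H.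
rewrite (map_zero _ (mean_linear trivial_cosine 0 a Ha)) in H.
change (RtoC 0 = (RtoC 4 * a * a) * gnorm2 a - (RtoC 2 * a) * gnorm a)%C in H.
assert (E4 : RtoC 4 = (RtoC 2 * RtoC 2)%C) by (rewrite <- RtoC_mult; f_equal; ring).
rewrite E4 in H.
assert (H2 : (RtoC 2 * a)%C <> RtoC 0).
{ apply Cmult_neq_0; trivial. intros H2. apply RtoC_inj in H2. lra. }
symmetry. apply Cminus_diag_uniq.
destruct (Ceq_dec (RtoC 2 * a * gnorm2 a - gnorm a)%C (RtoC 0)) as [|Hn]; trivial.
exfalso. apply (Cmult_neq_0 _ _ H2 Hn). refine (eq_trans _ (eq_sym H)). ring.
Qed.

Lemma gnorm_cdiff (a : C) : 0 < fst a -> cdiff gnorm a (- gnorm2 a)%C.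
Proof.
intros Ha. destruct (mean_opdiff trivial_cosine a Ha) as [c [d [Hc [Hd K]]]].
exists c, d. split; trivial. split; trivial. intros b Hb. specialize (K b (RtoC 1) Hb).
change (norm (RtoC 1 : CN)) with (Cmod (RtoC 1)) in K. rewrite Cmod_1, Rmult_1_r in K.
replace (gnorm b - gnorm a - (b - a) * - gnorm2 a)%C with
  (gnorm b - gnorm a - (b - a) * (- RtoC 1 * gnorm2 a))%C by ring.
exact K.
Qed.

(** Along the segment from [1] to [a], inside the right half-plane, the product has the complex
    derivative [gnorm b * (gnorm b - 2 * b * gnorm2 b)] at [b], which is zero by [gnorm_parts]. *)
Lemma gnorm_square (a : C) : 0 < fst a -> (gnorm a * gnorm a * a = gnorm (RtoC 1) * gnorm (RtoC 1))%C.
Proof.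
intros Ha. set (g := fun b => (gnorm b * gnorm b * b)%C).
assert (Hp : forall t, 0 <= t <= 1 -> 0 < fst (RtoC 1 + RtoC t * (a - RtoC 1))%C).
{ intros t Ht. replace (fst (RtoC 1 + RtoC t * (a - RtoC 1))%C) with (1 - t + t * fst a) by (simpl; ring).
  destruct (Req_dec t 0) as [->|]; nra. }
assert (Hd : forall t, 0 <= t <= 1 ->
  hasd (E := CN) (fun s => g (RtoC 1 + RtoC s * (a - RtoC 1))%C) t zero).
{ intros t Ht. specialize (Hp t Ht). set (b := (RtoC 1 + RtoC t * (a - RtoC 1))%C) in *.
  assert (Hg : cdiff g b (RtoC 0)).
  { pose proof (cdiff_mult _ _ _ _ _ (cdiff_mult _ _ _ _ _ (gnorm_cdiff b Hp) (gnorm_cdiff b Hp)) (cdiff_id b)) as H.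
    replace (RtoC 0) with ((- gnorm2 b * gnorm b + gnorm b * - gnorm2 b) * b + gnorm b * gnorm b * 1)%C; [exact H|].
    rewrite (gnorm_parts b Hp). ring. }
  pose proof (cdiff_line g (RtoC 1) (a - RtoC 1)%C t (RtoC 0) Hg) as H.
  rewrite Cmult_0_r in H. exact H. }
assert (H : g (RtoC 1 + RtoC 1 * (a - RtoC 1))%C = g (RtoC 1 + RtoC 0 * (a - RtoC 1))%C).
{ apply (constant_of_zero_deriv (E := CN) (fun s => g (RtoC 1 + RtoC s * (a - RtoC 1))%C) 0 1); [lra| |].
  - apply continuous_cont_on. intros t Ht. eapply (hasd_continuous (E := CN)), Hd, Ht.
  - intros t Ht. apply Hd. lra. }
replace (RtoC 1 + RtoC 1 * (a - RtoC 1))%C with a in H by ring.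
replace (RtoC 1 + RtoC 0 * (a - RtoC 1))%C with (RtoC 1) in H by ring.
unfold g in H. rewrite H. ring.
Qed.

(** Three estimates add up to [1]: the integral over [[0, 1]] is within [1 / 3] of [1] as
    [1 - exp (- t ^ 2) <= t ^ 2], the part beyond [1] is at most [1 / 2] by comparison with
    [exp (- t)], and the limit is approached within less than [1 / 6]. A vanishing integral would
    force [1 < 1]. *)
Lemma gnorm_1_neq_0 : gnorm (RtoC 1) <> RtoC 0.
Proof.
intros H.
set (F := fun s => scal (RtoC (s ^ 0) * gauss (RtoC 1) s)%C (RtoC 1 : CN) : CN).
assert (HF : decays (E := CN) F)
  by exact (mean_decays (E := CN) trivial_cosine 0 (RtoC 1) (RtoC 1) Rlt_0_1).
assert (Fval : forall s, F s = RtoC (exp (- s ^ 2))).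
{ intros s. change (RtoC (s ^ 0) * gauss (RtoC 1) s * RtoC 1 = RtoC (exp (- s ^ 2)))%C.
  rewrite pow_O, Cmult_1_r, Cmult_1_l. unfold gauss, cexp.
  replace (fst (- RtoC 1 * RtoC (s ^ 2))%C) with (- s ^ 2) by (simpl; ring).
  replace (snd (- RtoC 1 * RtoC (s ^ 2))%C) with 0 by (simpl; ring).
  rewrite cos_0, sin_0, Rmult_1_r, Rmult_0_r. trivial. }
pose proof (proj1 HF) as Fc.
assert (N1 : norm (minus (minus (prim F 1) (RtoC 1 : CN)) (minus (prim F 0) (RtoC 0 : CN))) <= / 3 * 1 ^ 3 - / 3 * 0 ^ 3).
{ apply (mean_value_ineq (E := CN) (fun t => minus (prim F t) (RtoC t : CN)) (fun t => minus (F t) (RtoC 1 : CN))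
    (fun t => / 3 * t ^ 3) (fun t => t ^ 2)); [lra| | | |].
  - apply continuous_cont_on. intros t _. apply (continuous_minus (V := CN)).
    + now apply prim_continuous.
    + apply (hasd_continuous (E := CN) _ t (1, 0)). apply (hasd_components (fun s => s) (fun _ => 0)); auto_derive; trivial.
  - intros t _.
    assert (Ht : hasd (E := CN) (fun s => scal (Copp (RtoC 1)) (RtoC s : CN)) t (scal (Copp (RtoC 1)) ((1, 0) : CN))).
    { apply (hasd_linear (E := CN) (F := CN) (fun x : CN => scal (Copp (RtoC 1)) x)); [apply is_linear_scal_C|].
      apply (hasd_components (fun s => s) (fun _ => 0)); auto_derive; trivial. }
    pose proof (hasd_plus _ _ t _ _ (prim_hasd F t Fc) Ht) as G.
    replace (minus (F t) (RtoC 1 : CN)) with (plus (F t) (scal (Copp (RtoC 1)) ((1, 0) : CN))).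
    + revert G. apply hasd_ext. intros s. lin CN.
    + change ((1, 0) : CN) with (RtoC 1 : CN). lin CN.
  - intros t _. auto_derive; trivial. simpl. field.
  - intros t Ht. rewrite Fval. change (Cmod (RtoC (exp (- t ^ 2)) - RtoC 1) <= t ^ 2).
    rewrite <- RtoC_minus, Cmod_R. pose proof (exp_ineq1_le (- t ^ 2)).
    assert (exp (- t ^ 2) <= 1) by (rewrite <- exp_0; apply exp_mono; pose proof (pow2_ge_0 t); lra).
    rewrite Rabs_left1; lra. }
assert (He : exp (- (1)) < / 2).
{ rewrite exp_Ropp. apply Rinv_lt_contravar; [pose proof (exp_pos 1); lra|].
  pose proof (exp_ineq1 1). lra. }
assert (N2 : forall n, (1 <= n)%nat -> norm (minus (prim F (INR n)) (prim F 1)) <= / 2).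
{ intros n Hn. apply le_INR in Hn. simpl in Hn.
  apply Rle_trans with (- exp (- INR n) - - exp (- (1))); [|pose proof (exp_pos (- INR n)); lra].
  apply (mean_value_ineq (E := CN) (prim F) F (fun t => - exp (- t)) (fun t => exp (- t))); trivial.
  - apply continuous_cont_on. intros t _. now apply prim_continuous.
  - intros t _. now apply prim_hasd.
  - intros t _. auto_derive; trivial. ring.
  - intros t Ht. rewrite Fval. change (Cmod (RtoC (exp (- t ^ 2))) <= exp (- t)).
    rewrite Cmod_R, Rabs_pos_eq by (left; apply exp_pos). apply exp_mono. simpl. nra. }
destruct (iint_spec F HF (/ 6)) as [N HN]; [lra|].
specialize (HN (max N 1) ltac:(lia)). specialize (N2 (max N 1) ltac:(lia)).
change (iint F) with (gnorm (RtoC 1)) in HN. rewrite H in HN.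
rewrite (prim_0 F Fc) in N1.
set (p := prim F (INR (max N 1))) in *. set (q := prim F 1) in *.
assert (N3 : norm (minus q (RtoC 1 : CN)) <= / 3).
{ replace (minus q (RtoC 1 : CN)) with (minus (minus q (RtoC 1 : CN)) (minus zero (RtoC 0 : CN))).
  - eapply Rle_trans; [exact N1|]. lra.
  - change (RtoC 0 : CN) with (zero : CN). lin CN. }
pose proof (norm_minus_triangle (RtoC 1 : CN) p (RtoC 0 : CN)) as T1.
pose proof (norm_minus_triangle (RtoC 1 : CN) q p) as T2.
rewrite (norm_minus_sym (RtoC 1 : CN) q), (norm_minus_sym q p) in T2.
assert (T3 : norm (minus (RtoC 1 : CN) (RtoC 0 : CN)) = 1).
{ change (Cmod (RtoC 1 - RtoC 0) = 1). rewrite <- RtoC_minus, Cmod_R, Rminus_0_r. apply Rabs_R1. }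
rewrite T3 in T1. lra.
Qed.

(** * The holomorphic semigroup subordinated to a cosine family *)

Lemma closed_operator_limit {E F : CSpace} (K : operator E F) (x : E) (y : F) :
  closed_operator K ->
  (forall eps, 0 < eps -> exists x' y', K x' y' /\ norm (minus x' x) < eps /\ norm (minus y' y) < eps) ->
  K x y.
Proof.
intros HK H. apply (co_closed K HK (x, y)). intros HN.
pose proof (locally_norm_le_locally (V := prod_NormedModule _ E F) _ _ HN) as [e He].
destruct (H (e / 2)) as [x' [y' [H1 [H2 H3]]]]; [pose proof (cond_pos e); lra|].
apply (He (x', y')); [|exact H1].
via_lt (norm_pair_le (minus x' x) (minus y' y)). lra.
Qed.

Lemma decays_pair {E F : CSpace} `{BE : Banach E} `{BF : Banach F} (f : R -> E) (g : R -> F) :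
  decays f -> decays g -> decays (E := prod_NormedModule _ E F) (fun s => (f s, g s)).
Proof.
intros Hf Hg.
assert (L1 : is_linear (fun x : E => (x, zero : F))).
{ apply (is_linear_prod (fun x : E => x) (fun x : E => (zero : F))); [apply is_linear_id|apply is_linear_zero]. }
assert (L2 : is_linear (fun y : F => (zero : E, y))).
{ apply (is_linear_prod (fun y : F => (zero : E)) (fun y : F => y)); [apply is_linear_zero|apply is_linear_id]. }
pose proof (decays_plus _ _ (decays_linear _ f L1 Hf) (decays_linear _ g L2 Hg)) as H.
replace (fun s => (f s, g s)) with
  (fun s => plus ((f s, zero : F) : prod_NormedModule _ E F) (zero : E, g s)); [exact H|].
apply functional_extensionality. intros s.
apply injective_projections; [exact (plus_zero_r (f s))|exact (plus_zero_l (g s))].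
Qed.

Definition inv4 (z : C) : C := (/ (RtoC 4 * z))%C.

Lemma Re_pos_neq_0 (z : C) : 0 < fst z -> z <> RtoC 0.
Proof. intros H ->. simpl in H. lra. Qed.

Lemma RtoC_neq_0 (r : R) : r <> 0 -> RtoC r <> RtoC 0.
Proof. intros H K. apply RtoC_inj in K. contradiction. Qed.

Lemma Re_Cinv (z : C) : fst (/ z)%C = fst z / Cmod z ^ 2.
Proof.
unfold Cmod. rewrite pow2_sqrt; [reflexivity|].
apply Rplus_le_le_0_compat; apply pow2_ge_0.
Qed.

Lemma inv4_Re (z : C) : 0 < fst z -> fst (inv4 z) = fst z / (4 * Cmod z ^ 2).
Proof.
intros Hz. pose proof (proj1 (Cmod_gt_0 z) (Re_pos_neq_0 z Hz)).
unfold inv4. rewrite Re_Cinv, Cmod_mult, Cmod_R, Rabs_pos_eq by lra. simpl fst. field. lra.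
Qed.

Lemma inv4_Re_pos (z : C) : 0 < fst z -> 0 < fst (inv4 z).
Proof.
intros Hz. rewrite inv4_Re by trivial. pose proof (proj1 (Cmod_gt_0 z) (Re_pos_neq_0 z Hz)).
apply Rdiv_lt_0_compat; trivial. pose proof (pow_lt (Cmod z) 2). lra.
Qed.

Lemma inv4_Cmod (z : C) : 0 < fst z -> Cmod (inv4 z) = / (4 * Cmod z).
Proof.
intros Hz. pose proof (Re_pos_neq_0 z Hz). unfold inv4.
rewrite Cmod_inv by (apply Cmult_neq_0; trivial; apply RtoC_neq_0; lra).
rewrite Cmod_mult, Cmod_R, Rabs_pos_eq by lra. trivial.
Qed.

(** The inverse of [gnorm a], rewritten by [gnorm_square] as a constant multiple of [a * gnorm a],
    so that it is differentiated by the product rule. *)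
Definition gfactor (a : C) : C := (/ (gnorm (RtoC 1) * gnorm (RtoC 1)) * (a * gnorm a))%C.

Lemma gfactor_gnorm (a : C) : 0 < fst a -> (gfactor a * gnorm a)%C = RtoC 1.
Proof.
intros Ha. unfold gfactor. pose proof (gnorm_square a Ha) as H. pose proof gnorm_1_neq_0 as H0.
transitivity (/ (gnorm (RtoC 1) * gnorm (RtoC 1)) * (gnorm a * gnorm a * a))%C; [ring|].
rewrite H. field. exact H0.
Qed.

(** By [gnorm_square], [Cmod (a * gnorm a) ^ 2] is a constant times [Cmod a], and in a sector
    [Cmod a] is comparable to the real part. The growth [sqrt (fst a)] balances one power gained in
    [gmoment_bound]. *)
Lemma gfactor_Cmod (c1 : R) : 0 < c1 -> exists B, 0 < B /\
  forall a, 0 < fst a -> Cmod a <= c1 * fst a -> Cmod (gfactor a) <= B * sqrt (fst a).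
Proof.
intros Hc1. set (k := Cmod (gnorm (RtoC 1))).
assert (Hk : 0 < k) by apply (proj1 (Cmod_gt_0 _) gnorm_1_neq_0).
exists (/ (k * k) * sqrt (k * k * c1)). assert (Hkk : 0 < k * k) by nra.
split; [apply Rmult_lt_0_compat; [now apply Rinv_0_lt_compat|apply sqrt_lt_R0; nra]|].
intros a Ha Hac. unfold gfactor.
rewrite Cmod_mult, Cmod_inv by (apply Cmult_neq_0; apply gnorm_1_neq_0).
rewrite (Cmod_mult (gnorm (RtoC 1))). fold k. rewrite Rmult_assoc.
apply Rmult_le_compat_l; [left; now apply Rinv_0_lt_compat|].
rewrite <- sqrt_mult by nra.
rewrite <- (sqrt_pow2 (Cmod (a * gnorm a))) by apply Cmod_ge_0. apply sqrt_le_1_alt.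
replace (Cmod (a * gnorm a) ^ 2) with (Cmod (gnorm a * gnorm a * a) * Cmod a) by (rewrite !Cmod_mult; ring).
rewrite gnorm_square by trivial. rewrite Cmod_mult. fold k. nra.
Qed.

Section Subordination.

Context {E : CSpace} `{BE : Banach E} {K : operator E E} {Z : R -> E -> E} {M w : R}
  (HZ : half_cosine K Z M w) (HK : closed_operator K)
  (HD : forall x eps, 0 < eps -> exists x' y', K x' y' /\ norm (minus x' x) < eps).

(** [T(z) x]; the parameter of the Gaussian [exp (- a s^2)] is
    [a = 1 / (4 z)], and the value is meaningful for [z = 0] and [Re z > 0] only. *)
Definition subordinate (z : C) (x : E) : E :=
  if Rlt_dec 0 (fst z) then scal (gfactor (inv4 z)) (mean Z 0 (inv4 z) x) else x.

(** The right-hand side of [heat_equation] at [a = inv4 z], normalised. It makes sense for every [x]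
    and serves both as the derivative in [z] and as the value of [K] at [subordinate z x]. *)
Definition subordinate_deriv (z : C) (x : E) : E :=
  scal (gfactor (inv4 z)) (minus (scal (RtoC 4 * inv4 z * inv4 z)%C (mean Z 2 (inv4 z) x) : E)
    (scal (RtoC 2 * inv4 z)%C (mean Z 0 (inv4 z) x))).

Lemma subordinate_eq (z : C) (x : E) : 0 < fst z ->
  subordinate z x = scal (gfactor (inv4 z)) (mean Z 0 (inv4 z) x).
Proof. intros Hz. unfold subordinate. destruct (Rlt_dec 0 (fst z)); trivial. contradiction. Qed.

Lemma subordinate_0 (x : E) : subordinate (RtoC 0) x = x.
Proof. unfold subordinate. destruct (Rlt_dec 0 (fst (RtoC 0))) as [H|]; trivial. simpl in H. lra. Qed.

Lemma subordinate_linear (z : C) : 0 < fst z -> is_linear (subordinate z).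
Proof.
intros Hz.
apply (is_linear_ext (fun x => scal (gfactor (inv4 z)) (mean Z 0 (inv4 z) x))).
{ intros x. symmetry. now apply subordinate_eq. }
exact (is_linear_comp _ _ (mean_linear HZ 0 (inv4 z) (inv4_Re_pos z Hz)) (is_linear_scal_C _)).
Qed.

Lemma subordinate_deriv_linear (z : C) : 0 < fst z -> is_linear (subordinate_deriv z).
Proof.
intros Hz. pose proof (mean_linear HZ 0 (inv4 z) (inv4_Re_pos z Hz)) as L0.
pose proof (mean_linear HZ 2 (inv4 z) (inv4_Re_pos z Hz)) as L2.
refine (is_linear_comp (fun x => minus (scal (RtoC 4 * inv4 z * inv4 z)%C (mean Z 2 (inv4 z) x) : E)
    (scal (RtoC 2 * inv4 z)%C (mean Z 0 (inv4 z) x))) _ _ (is_linear_scal_C _)).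
refine (is_linear_comp (fun x => (scal (RtoC 4 * inv4 z * inv4 z)%C (mean Z 2 (inv4 z) x) : E,
    opp (scal (RtoC 2 * inv4 z)%C (mean Z 0 (inv4 z) x) : E))) (fun p : E * E => plus (fst p) (snd p)) _ is_linear_plus).
apply (is_linear_prod (fun x => scal (RtoC 4 * inv4 z * inv4 z)%C (mean Z 2 (inv4 z) x) : E)
  (fun x => opp (scal (RtoC 2 * inv4 z)%C (mean Z 0 (inv4 z) x) : E))).
- exact (is_linear_comp _ _ L2 (is_linear_scal_C _)).
- exact (is_linear_comp _ _ (is_linear_comp _ _ L0 (is_linear_scal_C _)) is_linear_opp).
Qed.

Lemma subordinate_deriv_eq (z : C) (x y : E) : 0 < fst z -> K x y ->
  subordinate_deriv z x = subordinate z y.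
Proof.
intros Hz Hxy. rewrite subordinate_eq by trivial.
rewrite (heat_equation HZ (inv4 z) x y (inv4_Re_pos z Hz) Hxy). reflexivity.
Qed.

(** With [a = 1 / (4 * z)] one has [da / dz = - 4 * a ^ 2], and [gnorm_parts] reduces the derivative
    of [gfactor] to [gfactor a / (2 * a)]; the product and chain rules then give exactly
    [subordinate_deriv]. *)
Lemma subordinate_opdiff (z : C) : 0 < fst z -> opdiff subordinate z (subordinate_deriv z).
Proof.
intros Hz. pose proof (inv4_Re_pos z Hz) as Ha. set (a := inv4 z) in *.
assert (C1 : cdiff gfactor a (/ (gnorm (RtoC 1) * gnorm (RtoC 1)) * (RtoC 1 * gnorm a + a * - gnorm2 a))%C).
{ pose proof (cdiff_mult _ _ _ _ _ (cdiff_id a) (gnorm_cdiff a Ha)) as H.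
  destruct H as [c [d [Hc [Hd H]]]].
  set (k := (/ (gnorm (RtoC 1) * gnorm (RtoC 1)))%C). exists (Cmod k * c), d.
  split; [apply Rmult_le_pos; [apply Cmod_ge_0|trivial]|]. split; trivial.
  intros b Hb. specialize (H b Hb). unfold gfactor. fold k.
  replace (k * (b * gnorm b) - k * (a * gnorm a) - (b - a) * (k * (RtoC 1 * gnorm a + a * - gnorm2 a)))%C
    with (k * (b * gnorm b - a * gnorm a - (b - a) * (RtoC 1 * gnorm a + a * - gnorm2 a)))%C by ring.
  rewrite Cmod_mult, Rmult_assoc. apply Rmult_le_compat_l; [apply Cmod_ge_0|exact H]. }
pose proof (mean_linear HZ 0 a Ha) as L0. pose proof (mean_linear HZ 2 a Ha) as L2.
pose proof (is_linear_comp _ _ L2 (is_linear_scal_C (E := E) (Copp (RtoC 1)))) as L2'.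
pose proof (opdiff_scal gfactor (fun b x => mean Z 0 b x) a _ _ C1 (mean_opdiff HZ a Ha) L2' L0) as D.
assert (LL : is_linear (fun x => plus (scal (/ (gnorm (RtoC 1) * gnorm (RtoC 1)) * (RtoC 1 * gnorm a + a * - gnorm2 a))%C
  (mean Z 0 a x) : E) (scal (gfactor a) (scal (Copp (RtoC 1)) (mean Z 2 a x))))).
{ refine (is_linear_comp (fun x => (scal (/ (gnorm (RtoC 1) * gnorm (RtoC 1)) * (RtoC 1 * gnorm a + a * - gnorm2 a))%C
    (mean Z 0 a x) : E, scal (gfactor a) (scal (Copp (RtoC 1)) (mean Z 2 a x)) : E))
    (fun p : E * E => plus (fst p) (snd p)) _ is_linear_plus).
  apply (is_linear_prod (fun x => scal (/ (gnorm (RtoC 1) * gnorm (RtoC 1)) * (RtoC 1 * gnorm a + a * - gnorm2 a))%C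
    (mean Z 0 a x) : E) (fun x => scal (gfactor a) (scal (Copp (RtoC 1)) (mean Z 2 a x)) : E)).
  - exact (is_linear_comp _ _ L0 (is_linear_scal_C _)).
  - exact (is_linear_comp _ _ L2' (is_linear_scal_C _)). }
pose proof (opdiff_comp inv4 (fun b x => scal (gfactor b) (mean Z 0 b x)) z _ _
  (cdiff_inv4 z (Re_pos_neq_0 z Hz)) D LL) as D'.
(* The radius [fst z] keeps the ball in the right half-plane, where [subordinate] is the Gaussian
   mean. *)
refine (opdiff_ext _ _ z _ _ (fst z) Hz _ _ D').
- intros b x Hb. symmetry. apply subordinate_eq. pose proof (Re_near z b). lra.
- intros x. unfold subordinate_deriv. fold (inv4 z). fold a. unfold gfactor. rewrite (gnorm_parts a Ha).
  lin E.
Qed.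

(** The pair of Gaussian means is one integral in [E * E] of pairs that lie in the graph of [K] by
    [hc_invariant], and the graph is closed. *)
Lemma subordinate_graph (z : C) (x y : E) : 0 < fst z -> K x y -> K (subordinate z x) (subordinate z y).
Proof.
intros Hz Hxy. rewrite !subordinate_eq by trivial. apply (co_scal K HK).
pose proof (mean_decays HZ 0 (inv4 z) x (inv4_Re_pos z Hz)) as Dx.
pose proof (mean_decays HZ 0 (inv4 z) y (inv4_Re_pos z Hz)) as Dy.
pose proof (decays_pair _ _ Dx Dy) as D.
set (f := fun s => (scal (RtoC (s ^ 0) * gauss (inv4 z) s)%C (Z s x) : E,
  scal (RtoC (s ^ 0) * gauss (inv4 z) s)%C (Z s y) : E)) in *.
pose proof (iint_linear (fun p : E * E => fst p) f is_linear_fst D) as E1.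
pose proof (iint_linear (fun p : E * E => snd p) f is_linear_snd D) as E2.
unfold mean, gmoment. unfold f in E1, E2. simpl in E1, E2. fold f in E1, E2.
simpl pow. rewrite <- E1, <- E2.
apply (iint_closed (E := prod_NormedModule _ E E) (fun p => K (fst p) (snd p)) f).
- apply (co_closed K HK).
- apply (co_zero K HK).
- intros p q. apply (co_plus K HK).
- intros r p. apply (co_scal K HK).
- exact D.
- intros s. apply (co_scal K HK), (hc_invariant HZ), Hxy.
Qed.

(** On the domain this is [subordinate_deriv_eq]; both sides are bounded in [x], the domain is dense
    and the graph closed, so it extends to every [x]. *)
Lemma subordinate_smoothing (z : C) (x : E) : 0 < fst z -> K (subordinate z x) (subordinate_deriv z x).
Proof.
intros Hz. apply (closed_operator_limit K _ _ HK). intros e He.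
destruct (map_bound _ (subordinate_linear z Hz)) as [M1 [HM1 K1]].
destruct (map_bound _ (subordinate_deriv_linear z Hz)) as [M2 [HM2 K2]].
destruct (HD x (e / (M1 + M2))) as [x' [y' [H1 H2]]]; [apply Rdiv_lt_0_compat; lra|].
exists (subordinate z x'), (subordinate_deriv z x'). split; [|split].
- rewrite (subordinate_deriv_eq z x' y' Hz H1). now apply subordinate_graph.
- rewrite <- (map_minus _ (subordinate_linear z Hz)). via_lt K1.
  apply (Rmult_lt_compat_l (M1 + M2)) in H2; [|lra].
  replace ((M1 + M2) * (e / (M1 + M2))) with e in H2 by (field; lra).
  pose proof (norm_ge_0 (minus x' x)). nra.
- rewrite <- (map_minus _ (subordinate_deriv_linear z Hz)). via_lt K2.
  apply (Rmult_lt_compat_l (M1 + M2)) in H2; [|lra].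
  replace ((M1 + M2) * (e / (M1 + M2))) with e in H2 by (field; lra).
  pose proof (norm_ge_0 (minus x' x)). nra.
Qed.

(** The normalisation makes [x] the Gaussian mean of the constant orbit [x], so the difference is
    the mean of [Z s x - x]. *)
Lemma subordinate_defect (z : C) (x : E) : 0 < fst z ->
  minus (subordinate z x) x =
  scal (gfactor (inv4 z)) (iint (fun s => scal (gauss (inv4 z) s) (minus (Z s x) x))).
Proof.
intros Hz. pose proof (inv4_Re_pos z Hz) as Ha. set (a := inv4 z) in *.
rewrite subordinate_eq by trivial. fold a.
pose proof (mean_decays HZ 0 a x Ha) as Dx.
pose proof (mean_decays (E := CN) trivial_cosine 0 a (RtoC 1) Ha) as D1.
assert (Lx : is_linear (fun c : CN => scal (c : C) x)).
{ split.
  - intros c d. apply scal_Cplus.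
  - intros c d. apply scal_Cmult.
  - exists (norm x + 1). pose proof (norm_ge_0 x). split; [lra|]. intros c.
    via_le norm_scal_C. change (norm c) with (Cmod c).
    pose proof (Cmod_ge_0 c). nra. }
pose proof (iint_linear (fun c : CN => scal (c : C) x) _ Lx D1) as E1.
pose proof (decays_linear (fun c : CN => scal (c : C) x) _ Lx D1) as D2.
pose proof (decays_linear (fun v : E => scal (Copp (RtoC 1)) v) _ (is_linear_scal_C _) D2) as D3.
assert (E2 : iint (fun s => scal (gauss a s) (minus (Z s x) x)) =
  plus (mean Z 0 a x) (scal (Copp (RtoC 1)) (scal (gnorm a) x))).
{ transitivity (iint (fun s => plus (scal (RtoC (s ^ 0) * gauss a s)%C (Z s x) : E)
    (scal (Copp (RtoC 1)) (scal (RtoC (s ^ 0) * gauss a s * RtoC 1)%C x : E)))).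
  - apply iint_ext. intros s. rewrite pow_O. lin E.
  - refine (eq_trans (iint_plus _ _ Dx D3) _). apply f_equal.
    refine (eq_trans (iint_scal (Copp (RtoC 1)) _ D2) _). apply f_equal. symmetry. exact E1. }
rewrite E2.
assert (E3 : scal (gfactor a * gnorm a)%C x = x) by (rewrite (gfactor_gnorm a Ha); apply scal_C1).
transitivity (minus (scal (gfactor a) (mean Z 0 a x) : E) (scal (gfactor a * gnorm a)%C x)); [|lin E].
now rewrite E3.
Qed.

(** In the sector, [al = fst (inv4 z)] is at least [1 / (4 * c1 * Cmod z)]. The factor [sqrt al] of
    [gfactor] cancels the [1 / sqrt al] of the zeroth moment; with the [s ^ 2] of [orbit_taylor] the
    integral carries [1 / sqrt al ^ 3], which leaves [1 / al <= 4 * c1 * Cmod z]. *)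
Lemma subordinate_sector_bound (c1 : R) : 0 < c1 -> exists B d, 0 < B /\ 0 < d /\
  forall z, 0 < fst z -> Cmod z <= c1 * fst z -> Cmod z < d ->
  (forall x, norm (subordinate z x) <= B * norm x) /\
  (forall x y, K x y -> norm (minus (subordinate z x) x) <= B * Cmod z * norm y).
Proof.
intros Hc1.
destruct (gfactor_Cmod c1 Hc1) as [B [HB KB]].
destruct (gmoment_bound (E := E) 0) as [m0 [Hm0 K0]].
destruct (gaussian_integral_bound (E := E) 2) as [m2 [Hm2 K2]].
pose proof (hc_w HZ) as Hw. pose proof (hc_M HZ) as HM.
set (Ew := exp ((w + 2) ^ 2 / 4)). assert (HEw : 0 < Ew) by apply exp_pos.
set (C0 := B * m0 * M * Ew). set (C2 := B * m2 * M * Ew * (4 * c1)).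
assert (HC0 : 0 <= C0) by (unfold C0; repeat apply Rmult_le_pos; lra).
assert (HC2 : 0 <= C2) by (unfold C2; repeat apply Rmult_le_pos; lra).
(* For [Cmod z < / (4 * c1)] one has [al >= 1], so the exponential factor of the moment bounds is at
   most [Ew]. *)
exists (C0 + C2 + 1), (/ (4 * c1)). split; [lra|]. split; [apply Rinv_0_lt_compat; lra|].
intros z Hz Hzc Hzd.
pose proof (inv4_Re_pos z Hz) as Ha. pose proof (proj1 (Cmod_gt_0 z) (Re_pos_neq_0 z Hz)) as Hp.
assert (Hal : / (4 * c1 * Cmod z) <= fst (inv4 z)).
{ rewrite inv4_Re by trivial.
  replace (/ (4 * c1 * Cmod z)) with (Cmod z / c1 / (4 * Cmod z ^ 2)) by (field; lra).
  apply Rmult_le_compat_r; [left; apply Rinv_0_lt_compat; pose proof (pow_lt (Cmod z) 2 Hp); lra|].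
  apply Rmult_le_reg_r with c1; trivial. unfold Rdiv. rewrite Rmult_assoc, Rinv_l by lra. lra. }
assert (Hac : Cmod (inv4 z) <= c1 * fst (inv4 z)).
{ rewrite inv4_Cmod by trivial. apply (Rmult_le_compat_l c1) in Hal; [|lra].
  replace (c1 * / (4 * c1 * Cmod z)) with (/ (4 * Cmod z)) in Hal by (field; lra). exact Hal. }
assert (Hal1 : 1 <= fst (inv4 z)).
{ eapply Rle_trans; [|apply Hal]. rewrite <- Rinv_1 at 1.
  apply (Rmult_lt_compat_l (4 * c1)) in Hzd; [|lra]. rewrite Rinv_r in Hzd by lra.
  apply Rinv_le_contravar; nra. }
set (a := inv4 z) in *. set (al := fst a) in *.
assert (Hs1 : 1 <= sqrt al) by (rewrite <- sqrt_1; now apply sqrt_le_1_alt).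
assert (Hss : sqrt al * sqrt al = al) by (apply sqrt_sqrt; lra).
assert (HE : exp ((w / sqrt al + 2) ^ 2 / 4) <= Ew).
{ apply exp_mono. apply Rmult_le_compat_r; [lra|].
  assert (0 <= w / sqrt al) by (apply Rdiv_le_0_compat; lra).
  assert (w / sqrt al <= w).
  { apply Rmult_le_reg_r with (sqrt al); [lra|]. unfold Rdiv. rewrite Rmult_assoc, Rinv_l by lra. nra. }
  apply pow_incr. lra. }
specialize (KB a Ha Hac). fold al in KB.
split.
- intros x. rewrite subordinate_eq by trivial. fold a.
  destruct (K0 a al (M * norm x) w (fun s => Z s x)) as [_ Hb];
    [lra|apply Rle_refl|trivial|now apply (orbit_norm_nonneg HZ)|now apply (orbit_bounded HZ)|].
  change (gmoment 0 a (fun s => Z s x)) with (mean Z 0 a x) in Hb.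
  via_le norm_scal_C.
  pose proof (norm_ge_0 x) as Hx.
  apply Rle_trans with (B * sqrt al * (m0 * (M * norm x) / sqrt al ^ 1 * Ew)).
  + apply Rmult_le_compat; [apply Cmod_ge_0|apply norm_ge_0|exact KB|].
    eapply Rle_trans; [exact Hb|]. apply Rmult_le_compat_l; trivial.
    apply Rdiv_le_0_compat; [|simpl; lra]. repeat apply Rmult_le_pos; lra.
  + replace (B * sqrt al * (m0 * (M * norm x) / sqrt al ^ 1 * Ew)) with (C0 * norm x)
      by (unfold C0; field; lra).
    apply Rmult_le_compat_r; lra.
- intros x y Hxy. rewrite subordinate_defect by trivial. fold a.
  destruct (K2 al (M * norm y) w (fun s => scal (gauss a s) (minus (Z s x) x))) as [_ Hb].
  + lra.
  + trivial.
  + now apply (orbit_norm_nonneg HZ).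
  + intros s. apply scal_continuous.
    * eapply (hasd_continuous (E := CN)), gauss_hasd.
    * apply (continuous_minus (V := E)); [apply (hc_continuous HZ)|apply continuous_const].
  + intros s Hs. via_le norm_scal_C. rewrite Cmod_gauss. fold al.
    apply Rle_trans with (exp (- al * s ^ 2) * (M * norm y * (s ^ 2 * exp (w * s)))); [|right; ring].
    apply Rmult_le_compat_l; [left; apply exp_pos|]. now apply (orbit_taylor HZ).
  + via_le norm_scal_C. pose proof (norm_ge_0 y) as Hy.
    apply Rle_trans with (B * sqrt al * (m2 * (M * norm y) / sqrt al ^ 3 * Ew)).
    * apply Rmult_le_compat; [apply Cmod_ge_0|apply norm_ge_0|exact KB|].
      eapply Rle_trans; [exact Hb|]. apply Rmult_le_compat_l; trivial.
      apply Rdiv_le_0_compat; [|apply pow_lt; lra]. repeat apply Rmult_le_pos; lra.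
    * replace (B * sqrt al * (m2 * (M * norm y) / sqrt al ^ 3 * Ew)) with
        (B * m2 * M * Ew * norm y * / al)
        by (replace (/ al) with (/ (sqrt al * sqrt al)) by (now rewrite Hss); field; lra).
      assert (Hinv : / al <= 4 * c1 * Cmod z).
      { rewrite <- (Rinv_inv (4 * c1 * Cmod z)). apply Rinv_le_contravar; [|exact Hal].
        apply Rinv_0_lt_compat. nra. }
      apply Rle_trans with (B * m2 * M * Ew * norm y * (4 * c1 * Cmod z)).
      { apply Rmult_le_compat_l; [repeat apply Rmult_le_pos; lra|exact Hinv]. }
      replace (B * m2 * M * Ew * norm y * (4 * c1 * Cmod z)) with (C2 * (Cmod z * norm y)) by (unfold C2; ring).
      rewrite Rmult_assoc. apply Rmult_le_compat_r; [nra|lra].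
Qed.

Lemma subordinate_sector_continuous (c1 : R) (x : E) (eps : R) : 0 < c1 -> 0 < eps ->
  exists d, 0 < d /\ forall z, 0 < fst z -> Cmod z <= c1 * fst z -> Cmod z < d ->
  norm (minus (subordinate z x) x) < eps.
Proof.
intros Hc1 He. destruct (subordinate_sector_bound c1 Hc1) as [B [d [HB [Hd KB]]]].
destruct (HD x (eps / 2 / (B + 1))) as [x' [y' [H1 H2]]]; [apply Rdiv_lt_0_compat; lra|].
set (q := B * (norm y' + 1)). assert (Hq : 0 < q) by (unfold q; pose proof (norm_ge_0 y'); nra).
exists (Rmin d (eps / 2 / q)). split; [apply Rmin_pos; trivial; apply Rdiv_lt_0_compat; lra|].
intros z Hz Hzc Hzd.
rmins. assert (Hz1 : Cmod z < d) by lra.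
assert (Hz2 : Cmod z < eps / 2 / q) by lra.
destruct (KB z Hz Hzc Hz1) as [K1 K2]. specialize (K2 x' y' H1). specialize (K1 (minus x' x)).
rewrite (map_minus _ (subordinate_linear z Hz)) in K1.
norm_as E (plus (minus (minus (subordinate z x') x') (minus (subordinate z x') (subordinate z x))) (minus x' x)).
via_lt norm_triangle.
eapply Rle_lt_trans; [apply Rplus_le_compat_r, norm_minus_le|].
apply (Rmult_lt_compat_l (B + 1)) in H2; [|lra].
replace ((B + 1) * (eps / 2 / (B + 1))) with (eps / 2) in H2 by (field; lra).
apply (Rmult_lt_compat_l q) in Hz2; trivial.
replace (q * (eps / 2 / q)) with (eps / 2) in Hz2 by (field; lra).
assert (B * Cmod z * norm y' <= q * Cmod z).
{ unfold q. pose proof (Cmod_ge_0 z). nra. }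
lra.
Qed.

Lemma ray_sector (z : C) (t : R) : 0 < fst z -> 0 < t ->
  0 < fst (RtoC t * z)%C /\ Cmod (RtoC t * z) <= Cmod z / fst z * fst (RtoC t * z)%C /\
  Cmod (RtoC t * z) = t * Cmod z.
Proof.
intros Hz Ht. replace (fst (RtoC t * z)%C) with (t * fst z) by (simpl; ring).
rewrite Cmod_mult, Cmod_R, Rabs_pos_eq by lra. split; [nra|]. split; trivial.
right. field. lra.
Qed.

(** The path is differentiated only for [t < 1]: at [t = 1] the inner operator reaches [z = 0], and
    there continuity along the ray of [u], which lies in a sector with constant [Cmod u / fst u],
    takes over. *)
Lemma subordinate_plus (z u : C) (x : E) : 0 < fst z -> 0 < fst u ->
  subordinate (z + u)%C x = subordinate z (subordinate u x).
Proof.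
intros Hz Hu.
set (v := fun t => subordinate (RtoC (1 - t) * u)%C x).
set (phi := fun t => subordinate (z + RtoC t * u)%C (v t)).
assert (Hzt : forall t, 0 <= t -> 0 < fst (z + RtoC t * u)%C).
{ intros t Ht. replace (fst (z + RtoC t * u)%C) with (fst z + t * fst u) by (simpl; ring). nra. }
assert (Hv : forall t, t < 1 -> hasd v t (scal (- u)%C (subordinate_deriv (RtoC (1 - t) * u)%C x))).
{ intros t Ht.
  assert (Eq : forall r, (u + RtoC r * - u)%C = (RtoC (1 - r) * u)%C) by (intros r; rewrite RtoC_minus; ring).
  apply (hasd_ext (fun r => subordinate (u + RtoC r * - u)%C x)).
  { intros r. unfold v. now rewrite Eq. }
  rewrite <- Eq. apply opdiff_line. apply subordinate_opdiff. rewrite Eq.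
  apply (ray_sector u (1 - t) Hu). lra. }
assert (HS : forall t y, 0 <= t -> hasd (fun s => subordinate (z + RtoC s * u)%C y) t
  (scal u (subordinate_deriv (z + RtoC t * u)%C y))).
{ intros t y Ht. apply opdiff_line, subordinate_opdiff, Hzt, Ht. }
assert (HSlin : forall t, 0 <= t -> exists d, 0 < d /\ forall s, Rabs (s - t) < d ->
  is_linear (subordinate (z + RtoC s * u)%C)).
{ intros t Ht. exists (fst z / fst u). split; [now apply Rdiv_lt_0_compat|].
  intros s Hs. apply subordinate_linear.
  replace (fst (z + RtoC s * u)%C) with (fst z + s * fst u) by (simpl; ring).
  apply Rabs_def2 in Hs. destruct Hs as [_ Hs].
  assert (Hs' : - (fst z / fst u) < s) by lra. apply (Rmult_lt_compat_r (fst u)) in Hs'; trivial.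
  replace (- (fst z / fst u) * fst u) with (- fst z) in Hs' by (field; lra). lra. }
assert (HSb : forall t, 0 <= t -> locally_bounded (fun s => subordinate (z + RtoC s * u)%C) t).
{ intros t Ht. pose proof (Hzt t Ht) as Hp.
  destruct (opdiff_lipschitz _ _ _ (subordinate_opdiff _ Hp) (subordinate_deriv_linear _ Hp)) as [c [d [Hc [Hd Kl]]]].
  destruct (map_bound _ (subordinate_linear _ Hp)) as [B [HB KB]].
  set (q := Cmod u + 1). assert (Hq : 0 < q) by (pose proof (Cmod_ge_0 u); unfold q; lra).
  exists (c * d + B), (d / q). split; [nra|]. split; [now apply Rdiv_lt_0_compat|]. intros s y Hs.
  assert (Hd' : Cmod (z + RtoC s * u - (z + RtoC t * u)) < d).
  { replace (z + RtoC s * u - (z + RtoC t * u))%C with (RtoC (s - t) * u)%C by (rewrite RtoC_minus; ring).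
    rewrite Cmod_mult, Cmod_R. apply Rle_lt_trans with (Rabs (s - t) * q).
    - apply Rmult_le_compat_l; [apply Rabs_pos|unfold q; lra].
    - apply (Rmult_lt_compat_r q) in Hs; trivial. replace (d / q * q) with d in Hs by (field; lra). exact Hs. }
  specialize (Kl _ y Hd'). specialize (KB y). pose proof (norm_ge_0 y).
  via_le (norm_le_minus _ (subordinate (z + RtoC t * u)%C y)).
  assert (c * Cmod (z + RtoC s * u - (z + RtoC t * u)) * norm y <= c * d * norm y).
  { apply Rmult_le_compat_r; trivial. apply Rmult_le_compat_l; lra. }
  lra. }
assert (v1 : v 1 = x).
{ unfold v. rewrite Rminus_diag. rewrite Cmult_0_l. apply subordinate_0. }
assert (Hvc : cont_on (fun t => 0 <= t <= 1) v).
{ intros t Ht e He. destruct (Req_dec t 1) as [->|Hne].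
  - rewrite v1.
    destruct (subordinate_sector_continuous (Cmod u / fst u) x e) as [d [Hd Kd]]; trivial.
    { apply Rdiv_lt_0_compat; trivial. apply (proj1 (Cmod_gt_0 u)), Re_pos_neq_0, Hu. }
    set (q := Cmod u + 1). assert (Hq : 0 < q) by (pose proof (Cmod_ge_0 u); unfold q; lra).
    exists (d / q). split; [now apply Rdiv_lt_0_compat|]. intros s Hs Hs1.
    destruct (Req_dec s 1) as [->|Hs2].
    + rewrite v1. norm_as E (zero : E). rewrite norm_zero. trivial.
    + destruct (ray_sector u (1 - s) Hu ltac:(lra)) as [A1 [A2 A3]]. apply Kd; trivial.
      rewrite A3. rewrite Rabs_minus_sym, Rabs_pos_eq in Hs1 by lra.
      apply Rle_lt_trans with ((1 - s) * q); [apply Rmult_le_compat_l; [lra|unfold q; lra]|].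
      apply (Rmult_lt_compat_r q) in Hs1; trivial. replace (d / q * q) with d in Hs1 by (field; lra). exact Hs1.
  - destruct (proj1 (continuous_eps v t) (hasd_continuous _ _ _ (Hv t ltac:(lra))) e He) as [d [Hd Kd]].
    exists d. split; trivial. intros s _ Hs. now apply Kd. }
assert (Hphi : phi 1 = phi 0).
{ apply (constant_of_zero_deriv phi 0 1); [lra| |].
  - intros t Ht. unfold phi.
    apply (family_continuous (fun s => subordinate (z + RtoC s * u)%C) (fun t => 0 <= t <= 1) v t Ht).
    + intros s Hs. apply subordinate_linear, Hzt. lra.
    + destruct (HSb t ltac:(lra)) as [B [d [HB [Hd Kb]]]]. exists B, d. auto.
    + intros e He.
      destruct (proj1 (continuous_eps _ t) (hasd_continuous _ _ _ (HS t (v t) ltac:(lra))) e He) as [d [Hd Kd]].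
      exists d. auto.
    + intros e He. apply Hvc; trivial.
  - intros t Ht. unfold phi.
    set (ut := (RtoC (1 - t) * u)%C). set (zt := (z + RtoC t * u)%C).
    assert (Hut : 0 < fst ut) by (apply (ray_sector u (1 - t) Hu); lra).
    assert (Hzt' : 0 < fst zt) by (apply Hzt; lra).
    pose proof (family_hasd (fun s => subordinate (z + RtoC s * u)%C) v t
      (scal u (subordinate_deriv zt (v t))) (scal (- u)%C (subordinate_deriv ut x))) as H.
    replace (zero : E) with (plus (scal u (subordinate_deriv zt (v t)))
      (subordinate zt (scal (- u)%C (subordinate_deriv ut x)))).
    + apply H.
      * apply locally_R_eps, HSlin. lra.
      * apply HSb. lra.
      * apply HS. lra.
      * eapply hasd_continuous, HS. lra.
      * apply Hv. lra.
    (* The inner vector is in the domain of [K] by smoothing, so the outer derivative there is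
       [subordinate zt] of the inner one, and the two terms cancel. *)
    + rewrite (map_scal _ (subordinate_linear zt Hzt')).
      rewrite (subordinate_deriv_eq zt (v t) (subordinate_deriv ut x) Hzt').
      * lin E.
      * unfold v. fold ut. now apply subordinate_smoothing. }
unfold phi in Hphi. rewrite v1 in Hphi.
replace (z + RtoC 1 * u)%C with (z + u)%C in Hphi by ring.
replace (z + RtoC 0 * u)%C with z in Hphi by ring.
unfold v in Hphi. rewrite Rminus_0_r, Cmult_1_l in Hphi. exact Hphi.
Qed.

End Subordination.

Arguments subordinate {E} Z z x.
Arguments subordinate_deriv {E} Z z x.

(** * Generation and classical solutions *)

Lemma sector_half_plane (delta : R) (z : C) : delta <= PI / 2 -> sector delta z -> 0 < fst z.
Proof.
intros Hd [r [phi [Hr [Hphi ->]]]]. simpl. apply Rabs_def2 in Hphi.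
apply Rmult_lt_0_compat; trivial. apply cos_gt_0; lra.
Qed.

Lemma sector_Cmod (delta : R) (z : C) : 0 < delta < PI / 2 -> sector delta z ->
  Cmod z <= / cos delta * fst z.
Proof.
intros Hd [r [phi [Hr [Hphi ->]]]].
assert (Hcd : 0 < cos delta) by (apply cos_gt_0; lra).
assert (Hcos : cos delta <= cos phi).
{ replace (cos phi) with (cos (Rabs phi))
    by (unfold Rabs; destruct (Rcase_abs phi); [apply cos_neg|trivial]).
  pose proof (Rabs_pos phi). pose proof PI_RGT_0.
  apply cos_decr_1; lra. }
assert (HC : Cmod (r * cos phi, r * sin phi) = r).
{ unfold Cmod; simpl.
  replace (_ + _) with (r * r * (Rsqr (sin phi) + Rsqr (cos phi))) by (unfold Rsqr; ring).
  rewrite sin2_cos2, Rmult_1_r. apply sqrt_square. lra. }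
rewrite HC. simpl. apply Rmult_le_reg_l with (cos delta); trivial.
rewrite <- Rmult_assoc, Rinv_r, Rmult_1_l by lra. rewrite Rmult_comm. apply Rmult_le_compat_l; lra.
Qed.

(** The mean value inequality for [v] minus its candidate tangent turns a limit of derivatives at
    [0] into a right derivative. *)
Lemma one_sided_derivative {E : CSpace} (v v' : R -> E) (l : E) :
  cont_on (fun t => 0 <= t) v -> (forall t, 0 < t -> hasd v t (v' t)) ->
  (forall eps, 0 < eps -> exists d, 0 < d /\ forall t, 0 < t < d -> norm (minus (v' t) l) < eps) ->
  forall eps, 0 < eps -> exists d, 0 < d /\ forall h, 0 < h < d ->
    norm (minus (minus (v h) (v 0)) (scal (RtoC h) l)) <= eps * h.
Proof.
intros Hc Hd Hl e He. destruct (Hl e He) as [d [Hd0 K]]. exists d. split; trivial.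
intros h Hh.
assert (HL : forall t, hasd (fun s => scal (RtoC (- s)) l) t (opp l)).
{ intros t e' He'. exists 1. split; [lra|]. intros s _. norm_as E (zero : E).
  2:{ rewrite !RtoC_opp, RtoC_minus. ring. }
  rewrite norm_zero. apply Rmult_le_pos; [lra|apply Rabs_pos]. }
norm_as E (minus (plus (v h) (scal (RtoC (- h)) l)) (plus (v 0) (scal (RtoC (- 0)) l))).
2: rewrite !RtoC_opp; ring.
replace (e * h) with (e * (h - 0)) by ring.
apply (mean_value_const (fun t => plus (v t) (scal (RtoC (- t)) l)) (fun t => plus (v' t) (opp l)) e); [lra| | |].
- intros t Ht e' He'.
  destruct (Hc t ltac:(lra) (e' / 2)) as [d1 [Hd1 K1]]; [lra|].
  destruct (proj1 (continuous_eps _ t) (hasd_continuous _ _ _ (HL t)) (e' / 2)) as [d2 [Hd2 K2]]; [lra|].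
  exists (Rmin d1 d2). split; [now apply Rmin_pos|]. intros s Hs Hst.
  rmins.
  specialize (K1 s ltac:(lra) ltac:(lra)). specialize (K2 s ltac:(lra)).
  norm_as E (plus (minus (v s) (v t)) (minus (scal (RtoC (- s)) l : E) (scal (RtoC (- t)) l))).
  via_lt norm_triangle.
  apply (Rlt_le_trans _ (e' / 2 + e' / 2)); [|lra]. apply Rplus_lt_compat; [exact K1|exact K2].
- intros t Ht. apply hasd_plus; [apply Hd; lra|apply HL].
- intros t Ht. left. exact (K t ltac:(lra)).
Qed.

Lemma generator_unique {E : CSpace} (T : R -> E -> E) (x y z : E) :
  semigroup_generator T x y -> semigroup_generator T x z -> y = z.
Proof.
intros Hy Hz. apply eq_of_norm_minus. intros e He.
destruct (proj1 (generator_eps T x y) Hy (e / 2)) as [d1 [Hd1 K1]]; [lra|].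
destruct (proj1 (generator_eps T x z) Hz (e / 2)) as [d2 [Hd2 K2]]; [lra|].
set (h := Rmin d1 d2 / 2). rmins.
assert (Hm : 0 < Rmin d1 d2) by (now apply Rmin_pos).
assert (Hh : 0 < h) by (unfold h; lra).
specialize (K1 h ltac:(unfold h in *; lra)). specialize (K2 h ltac:(unfold h in *; lra)).
norm_as E (scal (RtoC (/ h)) (minus (minus (minus (T h x) x) (scal (RtoC h) z))
  (minus (minus (T h x) x) (scal (RtoC h) y))) : E).
2,3: rewrite RtoC_inv by lra; field; apply RtoC_neq_0; lra.
via_le norm_scal_RtoC. assert (0 < / h) by (now apply Rinv_0_lt_compat).
rewrite Rabs_pos_eq by lra. apply Rle_trans with (/ h * (e * h)); [|right; field; lra].
apply Rmult_le_compat_l; [lra|]. via_le norm_minus_le. lra.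
Qed.

Lemma hasd_reflect {E : CSpace} (v : R -> E) (t s : R) (l : E) :
  hasd v (t - s) l -> hasd (fun r => v (t - r)) s (opp l).
Proof.
intros H e He. destruct (H e He) as [d [Hd K]]. exists d. split; trivial. intros r Hr.
specialize (K (t - r)). replace (t - r - (t - s)) with (- (r - s)) in K by ring.
rewrite Rabs_Ropp in K. specialize (K Hr).
norm_as E (minus (minus (v (t - r)) (v (t - s))) (scal (RtoC (- (r - s))) l)).
2:{ rewrite RtoC_opp. ring. }
exact K.
Qed.

Lemma semigroup_solution_unique {E : CSpace} `{BE : Banach E} (T : R -> E -> E) (U D : R -> E) :
  C0_semigroup T -> cont_on (fun t => 0 <= t) U -> (forall t, 0 < t -> hasd U t (D t)) ->
  (forall t, 0 < t -> semigroup_generator T (U t) (D t)) ->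
  forall t, 0 <= t -> U t = T t (U 0).
Proof.
intros HT Hc Hd HG t Ht.
assert (H : T (Rabs (t - t)) (U t) = T (Rabs (t - 0)) (U 0)).
{ apply (constant_of_zero_deriv (fun s => T (Rabs (t - s)) (U s)) 0 t Ht).
  - intros s Hs.
    apply (family_continuous (fun s => T (Rabs (t - s))) (fun s => 0 <= s <= t) U s Hs).
    + intros r _. apply (semigroup_even_linear T HT).
    + destruct (semigroup_even_bounded T HT (t - s)) as [B [d [HB [Hd0 K]]]].
      exists B, d. split; trivial. split; trivial. intros r x _ Hr. apply K.
      replace (t - r - (t - s)) with (- (r - s)) by ring. now rewrite Rabs_Ropp.
    + intros e He.
      destruct (proj1 (continuous_eps _ (t - s)) (semigroup_even_continuous T HT (U s) (t - s)) e He) as [d [Hd0 K]].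
      exists d. split; trivial. intros r _ Hr. apply K.
      replace (t - r - (t - s)) with (- (r - s)) by ring. now rewrite Rabs_Ropp.
    + intros e He. destruct (Hc s ltac:(lra) e He) as [d [Hd0 K]]. exists d. split; trivial.
      intros r Hr. apply K. lra.
  - intros s Hs.
    pose proof (family_hasd (fun s => T (Rabs (t - s))) U s (opp (T (t - s) (D s))) (D s)) as H.
    replace (zero : E) with (plus (opp (T (t - s) (D s))) (T (Rabs (t - s)) (D s))).
    + apply H.
      * apply filter_forall. intros r. apply (semigroup_even_linear T HT).
      * destruct (semigroup_even_bounded T HT (t - s)) as [B [d [HB [Hd0 K]]]].
        exists B, d. split; trivial. split; trivial. intros r x Hr. apply K.
        replace (t - r - (t - s)) with (- (r - s)) by ring. now rewrite Rabs_Ropp.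
      * apply (hasd_reflect (fun r => T (Rabs r) (U s)) t s (T (t - s) (D s))).
        apply (semigroup_hasd T HT); [lra|]. apply HG. lra.
      * apply (continuous_comp (fun r : R => t - r) (fun r => T (Rabs r) (D s))).
        -- apply (continuous_minus (V := R_NormedModule)); [apply continuous_const|apply continuous_id].
        -- apply (semigroup_even_continuous T HT).
      * apply Hd. lra.
    + rewrite Rabs_pos_eq by lra. lin E. }
rewrite Rminus_diag, Rabs_R0, (c0_zero T HT), Rminus_0_r, Rabs_pos_eq in H by trivial. exact H.
Qed.

(** * Restriction to real times and identification of the generator *)

Section RealTime.

Context {E : CSpace} `{BE : Banach E} {K : operator E E} {Z : R -> E -> E} {M w : R}
  (HZ : half_cosine K Z M w) (HK : closed_operator K)
  (HD : forall x eps, 0 < eps -> exists x' y', K x' y' /\ norm (minus x' x) < eps).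

Let T := fun t => subordinate Z (RtoC t).

Lemma real_hasd (t : R) (x : E) : 0 < t -> hasd (fun s => T s x) t (subordinate_deriv Z (RtoC t) x).
Proof.
intros Ht.
assert (Eq : forall s, (RtoC 0 + RtoC s * RtoC 1)%C = RtoC s) by (intros s; ring).
pose proof (opdiff_line (subordinate Z) (RtoC 0) (RtoC 1) t (subordinate_deriv Z (RtoC t)) x) as H.
rewrite Eq in H. specialize (H (subordinate_opdiff HZ (RtoC t) Ht)).
rewrite scal_C1 in H. revert H. apply hasd_ext. intros s. now rewrite Eq.
Qed.

Lemma real_C0_semigroup : C0_semigroup T.
Proof.
assert (H0 : forall x, T 0 x = x) by apply subordinate_0.
split.
- intros t Ht. destruct (Req_dec t 0) as [->|Hn].
  + apply (is_linear_ext (fun x => x)); [intros x; symmetry; apply H0|apply is_linear_id].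
  + apply (subordinate_linear HZ). simpl. lra.
- exact H0.
- intros s t x Hs Ht. destruct (Req_dec s 0) as [->|Hs0].
  { now rewrite Rplus_0_l, H0. }
  destruct (Req_dec t 0) as [->|Ht0].
  { now rewrite Rplus_0_r, H0. }
  unfold T. rewrite RtoC_plus. apply (subordinate_plus HZ HK HD); simpl; lra.
- intros x. apply (proj1 (cont_on_iff _ _)). intros t Ht e He.
  destruct (Req_dec t 0) as [->|Hn].
  + destruct (subordinate_sector_continuous HZ HD 1 x e) as [d [Hd Kd]]; trivial; [lra|].
    exists d. split; trivial. intros s Hs Hst. rewrite Rminus_0_r in Hst. rewrite H0.
    destruct (Req_dec s 0) as [->|Hs0].
    * rewrite H0. norm_as E (zero : E). rewrite norm_zero. trivial.
    * apply Kd; [simpl; lra| |].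
      -- rewrite Cmod_R, Rabs_pos_eq by trivial. simpl. lra.
      -- now rewrite Cmod_R.
  + destruct (proj1 (continuous_eps _ t) (hasd_continuous _ _ _ (real_hasd t x ltac:(lra))) e He) as [d [Hd Kd]].
    exists d. auto.
Qed.

(** For [K x y] the derivative [T t y] of the orbit tends to [y] at [0]. Conversely, for [x] in the
    domain of the generator, smoothing puts [T t x] in the domain of [K] with value [T t y], and [t]
    tends to [0] in the closed graph. *)
Lemma real_generator : op_eq K (semigroup_generator T).
Proof.
pose proof real_C0_semigroup as HT.
assert (Himp : forall x y, K x y -> semigroup_generator T x y).
{ intros x y Hxy. apply generator_eps.
  assert (E0 : T 0 x = x) by apply subordinate_0.

  assert (Hlim : forall eps, 0 < eps -> exists d, 0 < d /\ forall h, 0 < h < d ->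
    norm (minus (minus (T h x) (T 0 x)) (scal (RtoC h) y)) <= eps * h).
  { apply (one_sided_derivative (fun t => T t x) (fun t => T t y)).
    - apply (semigroup_cont_on T HT).
    - intros t Ht. pose proof (real_hasd t x Ht) as H.
      rewrite (subordinate_deriv_eq HZ (RtoC t) x y Ht Hxy) in H. exact H.
    - intros e He. destruct (semigroup_cont_on T HT y 0 (Rle_refl 0) e He) as [d [Hd Kd]].
      exists d. split; trivial. intros t Ht. specialize (Kd t ltac:(lra)).
      rewrite Rminus_0_r, Rabs_pos_eq in Kd by lra. specialize (Kd ltac:(lra)).
      replace (T 0 y) with y in Kd by (symmetry; apply subordinate_0). exact Kd. }
  intros e He. destruct (Hlim e He) as [d [Hd Kd]]. exists d. split; trivial.
  intros h Hh. specialize (Kd h Hh). rewrite E0 in Kd. exact Kd. }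
intros x y. split; [apply Himp|]. intros Hxy.
apply (closed_operator_limit K x y HK). intros e He.
destruct (semigroup_cont_on T HT x 0 (Rle_refl 0) e He) as [d1 [Hd1 K1]].
destruct (semigroup_cont_on T HT y 0 (Rle_refl 0) e He) as [d2 [Hd2 K2]].
set (t := Rmin d1 d2 / 2). rmins.
assert (Hm : 0 < Rmin d1 d2) by (now apply Rmin_pos). assert (Ht : 0 < t) by (unfold t; lra).
exists (T t x), (T t y). split; [|split].
- pose proof (subordinate_smoothing HZ HK HD (RtoC t) x Ht) as HS.
  rewrite (generator_unique T (T t x) (T t y) (subordinate_deriv Z (RtoC t) x)); trivial.
  + apply (generator_invariant T HT); [lra|trivial].
  + apply Himp, HS.
- specialize (K1 t ltac:(lra)). rewrite Rminus_0_r, Rabs_pos_eq in K1 by lra.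
  replace (T 0 x) with x in K1 by (symmetry; apply subordinate_0). apply K1. unfold t; lra.
- specialize (K2 t ltac:(lra)). rewrite Rminus_0_r, Rabs_pos_eq in K2 by lra.
  replace (T 0 y) with y in K2 by (symmetry; apply subordinate_0). apply K2. unfold t; lra.
Qed.

Lemma half_cosine_analytic : generates_analytic_semigroup (PI / 2) K.
Proof.
exists (subordinate Z). split; [|apply real_generator].
pose proof PI_RGT_0. split.
- lra.
- intros z Hz. apply (subordinate_linear HZ). now apply (sector_half_plane (PI / 2)); [lra|].
- apply subordinate_0.
- intros z u x Hz Hu. apply (subordinate_plus HZ HK HD);
    now apply (sector_half_plane (PI / 2)); [lra|].
- intros z Hz. assert (Hz' : 0 < fst z) by now apply (sector_half_plane (PI / 2)); [lra|].
  exists (subordinate_deriv Z z). split; [now apply (subordinate_deriv_linear HZ)|].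
  now apply opdiff_op_C_deriv, (subordinate_opdiff HZ).
- intros delta x Hd.
  assert (FF : Filter (within (sector delta) (locally (RtoC 0)))) by apply within_filter, locally_filter.
  apply (filterlim_eps (within (sector delta) (locally (RtoC 0)))). intros e He.
  assert (Hcd : 0 < cos delta) by (apply cos_gt_0; lra).
  (* [/ cos delta] bounds [Cmod z / fst z] on the sector of half-angle [delta]. *)
  destruct (subordinate_sector_continuous HZ HD (/ cos delta) x e) as [d [Hd0 Kd]]; trivial.
  { now apply Rinv_0_lt_compat. }
  apply locally_C_eps. exists d. split; trivial. intros z Hz Hs.
  replace (z - RtoC 0)%C with z in Hz by ring.
  apply Kd; trivial.
  + apply (sector_half_plane delta); trivial; lra.
  + now apply sector_Cmod.
Qed.

(** For [s > t / 2] the derivative is [T (s - t / 2)] applied to a fixed vector, the derivative at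
    [t / 2], so its continuity is strong continuity of [T]. *)
Lemma real_deriv_continuous (x : E) (t : R) : 0 < t ->
  continuous (fun s => subordinate_deriv Z (RtoC s) x) t.
Proof.
intros Ht. pose proof real_C0_semigroup as HT.
set (y := subordinate_deriv Z (RtoC (t / 2)) x).
assert (Ht2 : 0 < fst (RtoC (t / 2))) by (simpl; lra).
assert (Hshift : forall s, t / 2 < s -> subordinate_deriv Z (RtoC s) x = T (Rabs (s - t / 2)) y).
{ intros s Hs. rewrite Rabs_pos_eq by lra.
  pose proof (subordinate_smoothing HZ HK HD (RtoC (t / 2)) x Ht2) as H1.
  assert (Hr : 0 < fst (RtoC (s - t / 2))) by (simpl; lra).
  pose proof (subordinate_graph HZ HK (RtoC (s - t / 2)) _ _ Hr H1) as H2.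
  rewrite <- (subordinate_plus HZ HK HD) in H2 by trivial.
  rewrite <- RtoC_plus in H2. replace (s - t / 2 + t / 2) with s in H2 by ring.
  apply (co_fun K HK (subordinate Z (RtoC s) x)); [|exact H2].
  apply (subordinate_smoothing HZ HK HD). simpl. lra. }
apply continuous_eps. intros e He.
destruct (proj1 (continuous_eps _ (t - t / 2)) (semigroup_even_continuous T HT y (t - t / 2)) e He) as [d [Hd Kd]].
exists (Rmin d (t / 2)). split; [apply Rmin_pos; lra|]. intros s Hs.
rmins.
assert (Hs2 : Rabs (s - t) < t / 2) by lra. apply Rabs_def2 in Hs2.
rewrite !Hshift by lra. apply Kd. replace (s - t / 2 - (t - t / 2)) with (s - t) by ring. lra.
Qed.

End RealTime.

Theorem reduction_matrix_generation (V X : CSpace) `{BV : Banach V} `{BX : Banach X}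
  (j : V -> X) (G : operator X X) (A : V -> X) :
  closed_operator G -> embedding j -> generates_C0_semigroup (phase_matrix j G) -> is_linear A ->
  generates_analytic_semigroup (PI / 2) (reduction_matrix j A G) /\
  well_posed j A G /\
  (forall (f : V) (g : X),
    (exists u : R -> V, classical_solution j A G f g u) /\
    (forall u1 u2 : R -> V,
      classical_solution j A G f g u1 -> classical_solution j A G f g u2 ->
      forall t, 0 <= t -> u1 t = u2 t)).
Proof.
intros HG Hj [S [HS HSgen]] HA.
destruct (reduction_half_cosine j G A Hj HG HA S HS HSgen) as [Z [M [w HZ]]].
pose proof (reduction_closed j G A Hj HG HA) as HK.
pose proof (reduction_dense j G A Hj S HS HSgen) as HD.
set (K := reduction_matrix j A G) in *.
set (T := fun t => subordinate Z (RtoC t)).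
pose proof (real_C0_semigroup HZ HK HD) as HT. fold T in HT.
pose proof (real_generator HZ HK HD) as HTgen. fold T in HTgen.
split; [exact (half_cosine_analytic HZ HK HD)|]. split; [now exists T|].
intros f g. split.
- set (x := (f, g) : V * X). set (D := fun t => subordinate_deriv Z (RtoC t) x).
  assert (T0 : T 0 x = x) by apply subordinate_0.
  assert (HKD : forall t, 0 < t -> K (T t x) (D t)).
  { intros t Ht. now apply (subordinate_smoothing HZ HK HD). }
  assert (Hd : forall t, 0 < t -> hasd (fun s => T s x) t (D t)).
  { intros t Ht. now apply (real_hasd HZ). }
  assert (Lj : is_linear (fun p : V * X => j (fst p))).
  { exact (is_linear_comp _ _ is_linear_fst (proj1 Hj)). }
  assert (Hju : forall t, 0 < t -> hasd (fun s => j (fst (T s x))) t (snd (T t x))).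
  { intros t Ht. rewrite <- (proj1 (HKD t Ht)).
    exact (hasd_linear (fun p : V * X => j (fst p)) _ t _ Lj (Hd t Ht)). }
  exists (fun t => fst (T t x)), (fun t => snd (T t x)), D.
  split; [|split; [|split; [|split; [|split]]]].
  + intros t Ht. apply deriv_on_hasd_on. destruct (Req_dec t 0) as [->|Hn].
    * intros e He.
      (* At [0] the orbit of a general [(f, g)] is only known to be continuous in [V * X], but [j u]
         is differentiable there in [X], since its derivative [snd (T t x)] extends continuously to
         [0]. *)
      destruct (one_sided_derivative (fun t => j (fst (T t x))) (fun t => snd (T t x)) (snd (T 0 x))) with (eps := e)
        as [d [Hd0 Kd]]; trivial.
      -- intros s Hs e' He'. destruct (map_bound _ Lj) as [B [HB KB]].
         destruct (semigroup_cont_on T HT x s Hs (e' / B)) as [d [Hd0 Kd]]; [now apply Rdiv_lt_0_compat|].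
         exists d. split; trivial. intros r Hr Hrs. rewrite <- (map_minus _ (proj1 Hj)).
         via_lt (KB (minus (T r x) (T s x))).
         specialize (Kd r Hr Hrs). apply (Rmult_lt_compat_l B) in Kd; trivial.
         replace (B * (e' / B)) with e' in Kd by (field; lra). exact Kd.
      -- intros e' He'. destruct (semigroup_cont_on T HT x 0 Ht e' He') as [d [Hd0 Kd]].
         exists d. split; trivial. intros s Hs.
         via_lt (norm_snd_le (minus (T s x) (T 0 x))).
         apply Kd; [lra|]. rewrite Rminus_0_r, Rabs_pos_eq; lra.
      -- exists d. split; trivial. intros s Hs Hs0. rewrite Rminus_0_r in *. rewrite Rabs_pos_eq in * by trivial.
         destruct (Req_dec s 0) as [->|Hs1].
         ++ norm_as X (zero : X). rewrite norm_zero. lra.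
         ++ apply Kd. lra.
    * apply hasd_on_hasd, Hju. lra.
  + refine (proj1 (cont_on_iff (E := prod_NormedModule _ V X) (Rle 0) _) _). intros t Ht e He.
    destruct (semigroup_cont_on T HT x t Ht e He) as [d [Hd0 Kd]]. exists d. split; [trivial|exact Kd].
  + intros t Ht. apply deriv_on_hasd_on, hasd_on_hasd.
    apply (hasd_ext (fun s => T s x)); [|now apply Hd]. intros s. apply surjective_pairing.
  + refine (proj1 (cont_on_iff (E := prod_NormedModule _ V X) (Rlt 0) D) _).
    apply continuous_cont_on. intros t Ht.
    now apply (real_deriv_continuous HZ HK HD).
  + intros t Ht. exact (proj2 (HKD t Ht)).
  + rewrite T0. split; reflexivity.
- assert (Hsol : forall u, classical_solution j A G f g u -> forall t, 0 <= t -> u t = fst (T t (f, g))).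
  { intros u [v [D [H1 [H2 [H3 [_ [H5 [H6 H7]]]]]]]] t Ht.
    assert (Hd : forall s, 0 < s -> hasd (fun r => (u r, v r)) s (D s)).
    { intros s Hs. apply (hasd_on_open (Rlt 0)); [|apply deriv_on_hasd_on, H3, Hs].
      apply locally_R_eps. exists s. split; trivial. intros r Hr. apply Rabs_def2 in Hr. lra. }
    assert (HU : (u t, v t) = T t (u 0, v 0)).
    { apply (semigroup_solution_unique T (fun s => (u s, v s)) D HT); trivial.
      - exact (proj2 (cont_on_iff (E := prod_NormedModule _ V X) (Rle 0) _) H2).
      (* The first component of [D s] is mapped by [j] to [v s], as both are derivatives of [j u];
         this is the first equation in the graph of the reduction matrix. *)
      - intros s Hs. apply HTgen. split; [|exact (H5 s Hs)]. simpl.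
        apply (hasd_uniq (fun r => j (u r)) s).
        + apply (hasd_linear (fun p : V * X => j (fst p)) (fun r => (u r, v r)) s (D s)); [|now apply Hd].
          exact (is_linear_comp _ _ is_linear_fst (proj1 Hj)).
        + apply (hasd_on_open (Rle 0)); [|apply deriv_on_hasd_on, H1; lra].
          apply locally_R_eps. exists s. split; trivial. intros r Hr. apply Rabs_def2 in Hr. lra. }
    rewrite H6, H7 in HU. now rewrite <- HU. }
  intros u1 u2 Hu1 Hu2 t Ht. now rewrite (Hsol u1 Hu1 t Ht), (Hsol u2 Hu2 t Ht).
Qed.

Theorem theorem6p2 :
  forall (V X : CompleteNormedModule C_AbsRing) (j : V -> X)
    (Cop : operator X X) (A : V -> X),
  generates_COF_phase_space j Cop ->
  is_linear A ->
  generates_analytic_semigroup (PI / 2) (reduction_matrix j A Cop) /\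
  well_posed j A Cop /\
  (forall (f : V) (g : X),
    (exists u : R -> V, classical_solution j A Cop f g u) /\
    (forall u1 u2 : R -> V,
      classical_solution j A Cop f g u1 ->
      classical_solution j A Cop f g u2 ->
      forall t, 0 <= t -> u1 t = u2 t)).
Proof.
intros V X j Cop A [HC [_ [Hj [_ HG]]]] HA.
exact (reduction_matrix_generation V X j Cop A HC Hj HG HA).
Qed.
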